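(* Let $n\in\{2,3\}$. In each of the following three situations, $V_j$ Mosco-converges to $V$ (as closed subspaces of $H^{-1/2}(\mathbb{R}^{n-1})$) as $j\to\infty$: (i) (increasing open) $V:=\widetilde H^{-1/2}(\Gamma)$ and $V_j:=\widetilde H^{-1/2}(\Gamma_j)$, where $\Gamma$ and $\Gamma_j$ ($j\in\mathbb{N}_0$) are non-empty, bounded and open subsets of $\mathbb{R}^{n-1}$ with $\Gamma_j\subset\Gamma_{j+1}$ for $j\in\mathbb{N}_0$, and $\Gamma=\bigcup_{j\in\mathbb{N}_0}\Gamma_j$; (ii) (decreasing compact) $V:=H^{-1/2}_\Gamma$ and $V_j:=H^{-1/2}_{\Gamma_j}$, where $\Gamma$ and $\Gamma_j$ are non-empty and compact subsets of $\mathbb{R}^{n-1}$ with $\Gamma_j\supset\Gamma_{j+1}$ for $j\in\mathbb{N}_0$, and $\Gamma=\bigcap_{j\in\mathbb{N}_0}\Gamma_j$; (iii) (sandwiched) $V:=\widetilde H^{-1/2}(\Gamma)$ and $V_j:=\widetilde H^{-1/2}(\Gamma_j)$, where $\Gamma$ and $\Gamma_j$ are non-empty, bounded and open subsets of $\mathbb{R}^{n-1}$ with $\widetilde H^{-1/2}(\Gamma)=H^{-1/2}_{\overline\Gamma}$, and there exist $\Gamma_j^-\subset\mathbb{R}^{n-1}$ non-empty, bounded and open and $\Gamma_j^+\subset\mathbb{R}^{n-1}$ non-empty and compact such that, for all $j\in\mathbb{N}_0$, $\Gamma_j^-\subset\Gamma_{j+1}^-$, $\Gamma_j^+\supset\Gamma_{j+1}^+$,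 $\Gamma_j^-\subset\Gamma_j\subset\Gamma_j^+$, and $\Gamma=\bigcup_{j\in\mathbb{N}_0}\Gamma_j^-$, $\overline\Gamma=\bigcap_{j\in\mathbb{N}_0}\Gamma_j^+$.
   Context: Sobolev spaces: for $m\in\mathbb{N}$ and $s\in\mathbb{R}$, $H^s(\mathbb{R}^m)$ is the Hilbert space of tempered distributions $u$ whose Fourier transform $\hat u$ is locally integrable with $\|u\|_{H^s(\mathbb{R}^m)}^2=\int_{\mathbb{R}^m}(1+|\xi|^2)^s|\hat u(\xi)|^2\,d\xi<\infty$. For $F\subset\mathbb{R}^m$ closed, $H^s_F=\{u\in H^s(\mathbb{R}^m):\operatorname{supp}u\subset F\}$. For $\Omega\subset\mathbb{R}^m$ non-empty and open, $\widetilde H^s(\Omega)$ is the closure of $C_0^\infty(\Omega)$ in $H^s(\mathbb{R}^m)$. Mosco convergence: closed subspaces $W_j$ of a Hilbert space $H$ Mosco-converge to a closed subspace $W$ of $H$ if (i) for every $w\in W$ there exist $w_j\in W_j$ with $\|w_j-w\|_H\to0$; and (ii) if $(W_{j_m})$ is a subsequence of $(W_j)$, $w_m\in W_{j_m}$ for $m\in\mathbb{N}$, and $w_m\rightharpoonup w$ weakly in $H$, then $w\in W$. *)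

(* Defs.v *)
From HB Require Import structures.
From mathcomp Require Import all_boot all_order all_algebra.
From mathcomp Require Import complex.
From mathcomp Require Import all_classical all_reals all_analysis.

Set Implicit Arguments.
Unset Strict Implicit.
Unset Printing Implicit Defensive.

Import Order.TTheory GRing.Theory Num.Theory.
Import numFieldNormedType.Exports.

Local Open Scope classical_set_scope.
Local Open Scope ring_scope.
Local Open Scope complex_scope.

Section measurable_row.
Context {d} {T : sigmaRingType d}.
Variable m : nat.

Let coord (i : 'I_m) (x : 'rV[T]_m) : T := x 0 i.

Let row_set0 : g_sigma_preimage coord set0.
Proof. exact: sigma_algebra0. Qed.

Let row_setC A : g_sigma_preimage coord A -> g_sigma_preimage coord (~` A).
Proof. exact: sigma_algebraC. Qed.

Let row_bigcup (F : _^nat) : (forall i, g_sigma_preimage coord (F i)) ->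
  g_sigma_preimage coord (\bigcup_i (F i)).
Proof. exact: sigma_algebra_bigcup. Qed.

(* The product sigma-algebra, as for [m.-tuple T]; it is the Borel
   sigma-algebra when [T] is the real line. *)
HB.instance Definition _ := @isMeasurable.Build (measure_tuple_display d)
  'rV[T]_m (g_sigma_preimage coord) row_set0 row_setC row_bigcup.

End measurable_row.

Lemma measurable_row_coord d (T : sigmaRingType d) m (i : 'I_m) :
  measurable_fun [set: 'rV[T]_m] (fun x : 'rV[T]_m => x 0 i).
Proof.
move=> _ Y mY; rewrite setTI; apply: sub_sigma_algebra => /=.
rewrite -bigcup_seq/=; exists i => /=; first by rewrite mem_index_enum.
by exists Y => //; rewrite setTI.
Qed.

Lemma measurable_fun_row d1 d2 (T1 : measurableType d1)
    (T2 : measurableType d2) m (f : T1 -> 'rV[T2]_m) :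
  (forall i, measurable_fun [set: T1] (fun x => f x 0 i)) ->
  measurable_fun [set: T1] f.
Proof.
move=> mf.
suff : g_sigma_preimage (fun i x => f x 0 i) `<=` measurable.
  rewrite (g_sigma_preimage_comp (fun i (x : 'rV[T2]_m) => x 0 i) f) => prefS.
  by move=> _ A mA; apply: prefS; exists A.
apply: smallest_sub; first exact: sigma_algebra_measurable.
case: m => [|m] in f mf *; first by rewrite big_ord0.
rewrite -bigcup_mkord_ord; apply: bigcup_sub => i Ii.
by move=> A [B mB <-]; exact: mf.
Qed.

Section lebesgue_row.
Variable R : realType.

Definition row_cons m (p : measurableTypeR R * 'rV[R]_m) : 'rV[R]_m.+1 :=
  row_mx (p.1 : R)%:M p.2.

Definition row_uncons m (v : 'rV[R]_m.+1) : measurableTypeR R * 'rV[R]_m :=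
  (v 0 ord0, \row_j v 0 (lift ord0 j)).

Lemma row_consK m : cancel (@row_cons m) (@row_uncons m).
Proof.
case=> x v; rewrite /row_uncons /row_cons /=; congr pair.
  rewrite (_ : ord0 = @lshift 1 m ord0); last exact/val_inj.
  by rewrite (@row_mxEl _ 1 1 m) mxE eqxx mulr1n.
apply/rowP => j; rewrite mxE (_ : lift ord0 j = @rshift 1 m j).
  by rewrite (@row_mxEr _ 1 1 m).
exact/val_inj.
Qed.

Lemma measurable_row_cons m : measurable_fun setT (@row_cons m).
Proof.
apply: measurable_fun_row => i; rewrite /row_cons.
case: (@splitP 1 m i) => j ij.
  rewrite (_ : (fun x => _) = fst); first exact: measurable_fst.
  apply/funext => -[x v] /=; rewrite (_ : i = @lshift 1 m j); last exact/val_inj.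
  by rewrite (@row_mxEl _ 1 1 m) mxE !ord1 eqxx mulr1n.
rewrite (_ : (fun x => _) = (fun v : 'rV[R]_m => v 0 j) \o snd).
  by apply: measurableT_comp => //; exact: measurable_row_coord.
apply/funext => -[x v] /=; rewrite (_ : i = @rshift 1 m j); last exact/val_inj.
by rewrite (@row_mxEr _ 1 1 m).
Qed.

Lemma measurable_row_uncons m : measurable_fun setT (@row_uncons m).
Proof.
apply/measurable_fun_pairP; split => /=; first exact: measurable_row_coord.
apply: measurable_fun_row => i.
rewrite [X in measurable_fun _ X](_ : _ = fun x : 'rV[R]_m.+1 => x 0 (lift ord0 i)).
  exact: measurable_row_coord.
by apply/funext => x /=; rewrite mxE.
Qed.

Section step.
Variables (m : nat) (mu : {sigma_finite_measure set 'rV[R]_m -> \bar R}).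

Definition lebesgue_row_step : set 'rV[R]_m.+1 -> \bar R :=
  pushforward (@lebesgue_measure R \x mu)%E (@row_cons m).

Let mpreimage (A : set 'rV[R]_m.+1) :
  measurable A -> measurable (@row_cons m @^-1` A).
Proof.
by move=> mA; rewrite -[X in measurable X]setTI; exact: measurable_row_cons.
Qed.

Let lebesgue_row_step0 : lebesgue_row_step set0 = 0%E.
Proof. by rewrite /lebesgue_row_step /pushforward preimage_set0 measure0. Qed.

Let lebesgue_row_step_ge0 A : (0 <= lebesgue_row_step A)%E.
Proof. by rewrite /lebesgue_row_step /pushforward measure_ge0. Qed.

Let lebesgue_row_step_sigma_additive : semi_sigma_additive lebesgue_row_step.
Proof.
move=> F mF tF mUF; rewrite /lebesgue_row_step /pushforward preimage_bigcup.
apply: measure_semi_sigma_additive.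
- by move=> n; exact: mpreimage.
- apply/trivIsetP => /= i j _ _ ij; rewrite -preimage_setI.
  by move/trivIsetP : tF => /(_ _ _ _ _ ij) ->//; rewrite preimage_set0.
- by rewrite -preimage_bigcup; exact: mpreimage.
Qed.

HB.instance Definition _ := isMeasure.Build _ _ _ lebesgue_row_step
  lebesgue_row_step0 lebesgue_row_step_ge0 lebesgue_row_step_sigma_additive.

Let lebesgue_row_step_sigma_finite : sigma_finite setT lebesgue_row_step.
Proof.
have /sigma_finiteP[F [TF ndF Foo]] := sigma_finiteT (@lebesgue_measure R).
have /sigma_finiteP[G [TG ndG Goo]] := sigma_finiteT mu.
exists (fun k => @row_uncons m @^-1` (F k `*` G k)).
  rewrite -preimage_bigcup (_ : \bigcup_k _ = setT) ?preimage_setT//.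
  rewrite -setXTT TF TG predeqE => -[x y]; split.
    by move=> [n _ []/= ? ?]; split; exists n.
  move=> [/= [n _ Fnx] [k _ Gky]]; exists (maxn n k) => //; split.
  - by move: x Fnx; exact/subsetPset/ndF/leq_maxl.
  - by move: y Gky; exact/subsetPset/ndG/leq_maxr.
move=> k; have [mFk Fkoo] := Foo k; have [mGk Gkoo] := Goo k; split.
  rewrite -[X in measurable X]setTI; apply: measurable_row_uncons => //.
  exact: measurableX.
rewrite /lebesgue_row_step /pushforward -comp_preimage.
rewrite (_ : _ \o _ = id) ?preimage_id; last first.
  by apply/funext => p; exact: row_consK.
by rewrite product_measure1E// lte_mul_pinfty// ge0_fin_numE.
Qed.

HB.instance Definition _ := @Measure_isSigmaFinite.Build _ _ _
  lebesgue_row_step lebesgue_row_step_sigma_finite.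

End step.

Fixpoint lebesgue_row (m : nat) :
    {sigma_finite_measure set 'rV[R]_m -> \bar R} :=
  if m is m'.+1 then lebesgue_row_step (lebesgue_row m') else \d_(0 : 'rV[R]_0).

End lebesgue_row.

Section functions.
Variables (R : realType) (m : nat).
Implicit Types (f g phi : 'rV[R]_m -> R[i]) (x xi : 'rV[R]_m).

Local Notation cRe := (@complex.Re R).
Local Notation cIm := (@complex.Im R).
Local Notation cabs := (@ComplexField.Normc.normc R).

Definition dotv x xi : R := \sum_(i < m) x 0 i * xi 0 i.

Definition cpartial (i : 'I_m) f : 'rV[R]_m -> R[i] := fun x =>
  'D_('e_i) (cRe \o f) x +i* 'D_('e_i) (cIm \o f) x.

(* A multi-index of order [size a] is encoded by a sequence of directions. *)
Definition cpartials (a : seq 'I_m) f : 'rV[R]_m -> R[i] := foldr cpartial f a.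

Definition smooth f : Prop := forall (a : seq 'I_m) x,
  differentiable (cRe \o cpartials a f) x /\
  differentiable (cIm \o cpartials a f) x.

(* [schwartz_seminorm k], for [k] in nat, is an increasing family of seminorms
   that defines the topology of the Schwartz space. *)
Definition schwartz_seminorm (k : nat) f : \bar R :=
  ereal_sup [set y | exists (a : seq 'I_m) (x : 'rV[R]_m), (size a <= k)%N /\
    y = ((1 + dotv x x) ^+ k * cabs (cpartials a f x))%:E].

Definition schwartz : set ('rV[R]_m -> R[i]) :=
  [set f | smooth f /\ forall k, (schwartz_seminorm k f < +oo)%E].

Definition fsupport f : set 'rV[R]_m := closure [set x | f x != 0].

Definition C0infty (Omega : set 'rV[R]_m) : set ('rV[R]_m -> R[i]) :=
  [set f | [/\ smooth f, compact (fsupport f) & fsupport f `<=` Omega]].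

Definition cintegral f : R[i] :=
  (\int[lebesgue_row R m]_x cRe (f x)) +i* (\int[lebesgue_row R m]_x cIm (f x)).

Definition clocally_integrable f : Prop :=
  forall K : set 'rV[R]_m, compact K ->
    (lebesgue_row R m).-integrable K (EFin \o (cRe \o f)) /\
    (lebesgue_row R m).-integrable K (EFin \o (cIm \o f)).

(* (2 pi)^(-m/2) \int exp(- i x . xi) f(x) dx *)
Definition fourier f : 'rV[R]_m -> R[i] := fun xi =>
  (Num.sqrt (2 * pi) ^- m)%:C *
  cintegral (fun x => (cos (dotv x xi) -i* sin (dotv x xi)) * f x).

(* Functionals are total on [R^m -> C]; those that are tempered distributions
   are normalised to vanish outside the Schwartz space, so that two of them are
   equal exactly when they agree on Schwartz functions. *)
Local Notation functional := (('rV[R]_m -> R[i]) -> R[i]).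
Implicit Types u v : functional.

Definition tempered : set functional := [set u |
  [/\ forall (c : R[i]) f g, schwartz f -> schwartz g ->
        u (c *: f + g) = c * u f + u g,
      exists (k : nat) (M : R), forall f, schwartz f ->
        ((cabs (u f))%:E <= M%:E * schwartz_seminorm k f)%E &
      forall f, ~ schwartz f -> u f = 0]].

Definition distr_of f : functional :=
  patch (fun=> 0) schwartz (fun phi => cintegral (fun x => f x * phi x)).

Definition distr_fourier u : functional :=
  patch (fun=> 0) schwartz (u \o fourier).

Definition fourier_density u : set ('rV[R]_m -> R[i]) :=
  [set g | clocally_integrable g /\ distr_fourier u = distr_of g].

(* A density is unique up to a null set, so the choice made by [xget] does not
   affect integrals. *)
Definition fourier_fun u : 'rV[R]_m -> R[i] :=
  xget (fun=> 0) (fourier_density u).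

Definition distr_support u : set 'rV[R]_m :=
  ~` \bigcup_(U in [set U | open U /\ forall phi, C0infty U phi -> u phi = 0]) U.

Definition sobolev_energy (s : R) u : \bar R :=
  (\int[lebesgue_row R m]_xi
     ((1 + dotv xi xi) `^ s * cabs (fourier_fun u xi) ^+ 2)%:E)%E.

Definition sobolev (s : R) : set functional := [set u |
  [/\ tempered u, fourier_density u !=set0 & (sobolev_energy s u < +oo)%E]].

Definition sobolev_norm (s : R) u : R := Num.sqrt (fine (sobolev_energy s u)).

Definition sobolev_supported (s : R) (F : set 'rV[R]_m) : set functional :=
  sobolev s `&` [set u | distr_support u `<=` F].

Definition sobolev_tilde (s : R) (Omega : set 'rV[R]_m) : set functional :=
  sobolev s `&` [set u | forall e : R, 0 < e ->
    exists2 phi, C0infty Omega phi & sobolev_norm s (u - distr_of phi) < e].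

End functions.

(* The Hilbert space is given as a subset [H] of an ambient vector space,
   together with its norm. *)
Section mosco.
Variables (R : realType) (E : lmodType R[i]) (H : set E) (nrm : E -> R).

Definition bounded_functional (l : E -> R[i]) : Prop :=
  (forall (c : R[i]) u v, H u -> H v -> l (c *: u + v) = c * l u + l v) /\
  exists M : R, forall u, H u -> ComplexField.Normc.normc (l u) <= M * nrm u.

Definition weakly_converges (w_ : nat -> E) (w : E) : Prop :=
  [/\ forall k, H (w_ k), H w &
      forall l : E -> R[i], bounded_functional l ->
        (l (w_ k) : R[i]^o) @[k --> \oo] --> (l w : R[i]^o)].

Definition closed_subspace (W : set E) : Prop :=
  [/\ W `<=` H, W 0,
      forall (c : R[i]) u v, W u -> W v -> W (c *: u + v) &
      forall u, H u ->
        (forall e : R, 0 < e -> exists2 w, W w & nrm (u - w) < e) -> W u].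

Definition mosco_converges (W_ : nat -> set E) (W : set E) : Prop :=
  [/\ forall j, closed_subspace (W_ j),
      closed_subspace W,
      forall w, W w -> exists w_ : nat -> E, (forall j, W_ j (w_ j)) /\
        nrm (w_ j - w) @[j --> \oo] --> (0 : R) &
      forall (j_ : nat -> nat) (w_ : nat -> E) (w : E),
        {homo j_ : a b / (a < b)%N} -> (forall k, W_ (j_ k) (w_ k)) ->
        weakly_converges w_ w -> W w].

End mosco.

(* Main.v *)
(* Pairing with a Schwartz function is continuous on H^s: by Fourier inversion
   every Schwartz function is a transform, so Cauchy-Schwarz with the weights
   (1 + |xi|^2)^(s/2) and (1 + |xi|^2)^(-s/2) applies. Hence H^s_F, the set of
   the u with u(phi) = 0 for all test functions phi supported off the closed F,
   is closed under weak limits. A test function supported off the intersection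
   of decreasing closed sets is, by compactness, supported off one of them; so
   weak limits of elements of the decreasing spaces lie in the intersection
   space. Dually, a test function in an increasing union of open sets lives in
   one of them, which gives strong approximation in the increasing spaces.
   The spaces tilde H^s(Omega) are weakly closed because closed subspaces of an
   inner product space are separated from outside points by bounded functionals;
   the sandwiched case combines the two monotone ones. *)
Require Import Defs.
From HB Require Import structures.
From mathcomp Require Import all_boot all_order all_algebra.
From mathcomp Require Import complex.
From mathcomp Require Import all_classical all_reals all_analysis.
From mathcomp Require Import measurable_realfun.
From mathcomp Require Import ring lra.
Set Implicit Arguments.
Unset Strict Implicit.
Unset Printing Implicit Defensive.
Import Order.TTheory GRing.Theory Num.Theory.
Import numFieldNormedType.Exports.
Local Open Scope classical_set_scope.
Local Open Scope ring_scope.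

(** * Smooth and Schwartz functions *)

(** Elements of H^s are bare functionals, and [fourier_fun] picks one density among all those that
    agree almost everywhere. Hence no identity between chosen densities holds pointwise: linearity
    of the transform, and with it the inner product, rests on uniqueness of a density up to a null
    set. That uniqueness asks for enough test functions to reach all Borel sets, which smooth bumps
    converging to indicators of boxes provide. The analysis is done with real functions: a Fourier
    integral is split into a cosine and a sine integral, and inversion inserts a wide Gaussian into
    a double integral that does not converge absolutely. The inner product is likewise the real one,
    with multiplication by i as an isometry. Separation from a closed subspace therefore first
    yields a real-linear functional l, and weak convergence is tested against l(u) - i l(iu). *)

Section real_smooth.
Context {R : realType} {m : nat}.
Implicit Types (f g h : 'rV[R]_m -> R) (x : 'rV[R]_m) (a : seq 'I_m).

Definition rpartial (i : 'I_m) f : 'rV[R]_m -> R := fun x => 'D_('e_i) f x.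

Definition rpartials a f := foldr rpartial f a.

Definition rsmooth f := forall a x, differentiable (rpartials a f) x.

Lemma rpartials_rcons a i f :
  rpartials (rcons a i) f = rpartials a (rpartial i f).
Proof. by rewrite /rpartials foldr_rcons. Qed.

(** Coinduction for smoothness: a concrete function is placed in a class of differentiable functions
    stable under partial derivatives, so that no formula for its higher derivatives has to be
    found. *)
Lemma rsmooth_coind (P : ('rV[R]_m -> R) -> Prop) :
  (forall f, P f -> forall x, differentiable f x) ->
  (forall f i, P f -> P (rpartial i f)) ->
  forall f, P f -> rsmooth f.
Proof.
move=> Pd Pp f Pf a x; apply: Pd.
by elim: a => //= i a; exact: Pp.
Qed.

Lemma rsmooth_differentiable f : rsmooth f -> forall x, differentiable f x.
Proof. by move=> sf x; exact: (sf [::]). Qed.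

Lemma rsmooth_derivable f : rsmooth f -> forall x v, derivable f x v.
Proof. by move=> sf x v; exact/diff_derivable/rsmooth_differentiable. Qed.

Lemma rsmooth_continuous f : rsmooth f -> continuous f.
Proof.
by move=> sf x; exact/differentiable_continuous/rsmooth_differentiable.
Qed.

Lemma rsmooth_rpartial i f : rsmooth f -> rsmooth (rpartial i f).
Proof. by move=> sf a x; rewrite -rpartials_rcons; exact: sf. Qed.

Lemma rpartial_cst i (c : R) : rpartial i (cst c) = cst 0.
Proof. by apply/funext => x; exact: derive_cst. Qed.

Lemma rpartialD i f g : rsmooth f -> rsmooth g ->
  rpartial i (f + g) = rpartial i f + rpartial i g.
Proof.
by move=> sf sg; apply/funext => x; apply: deriveD; exact: rsmooth_derivable.
Qed.

Lemma rpartialZ i (c : R) f : rsmooth f ->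
  rpartial i (c *: f) = c *: rpartial i f.
Proof.
by move=> sf; apply/funext => x; apply: deriveZ; exact: rsmooth_derivable.
Qed.

Lemma rpartialM i f g : rsmooth f -> rsmooth g ->
  rpartial i (f * g) = f * rpartial i g + g * rpartial i f.
Proof.
by move=> sf sg; apply/funext => x; apply: deriveM; exact: rsmooth_derivable.
Qed.

Lemma rsmooth_cst (c : R) : rsmooth (cst c).
Proof.
apply: (@rsmooth_coind (fun f => exists c : R, f = cst c)); last by exists c.
- by move=> _ [? ->] x.
- by move=> _ i [? ->]; exists 0; exact: rpartial_cst.
Qed.

Lemma rsmoothD f g : rsmooth f -> rsmooth g -> rsmooth (f + g).
Proof.
move=> sf sg.
apply: (@rsmooth_coind (fun h => exists f g, [/\ rsmooth f, rsmooth g & h = f + g]));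
  last by exists f, g.
- by move=> _ [? [? [? ? ->]]] x; apply: differentiableD; exact: rsmooth_differentiable.
- move=> _ i [f' [g' [? ? ->]]]; exists (rpartial i f'), (rpartial i g').
  by split; [exact: rsmooth_rpartial..|exact: rpartialD].
Qed.

Lemma rsmoothZ (c : R) f : rsmooth f -> rsmooth (c *: f).
Proof.
move=> sf.
apply: (@rsmooth_coind (fun h => exists2 f, rsmooth f & h = c *: f));
  last by exists f.
- by move=> _ [? ? ->] x; apply: differentiableZ; exact: rsmooth_differentiable.
- move=> _ i [f' ? ->]; exists (rpartial i f'); first exact: rsmooth_rpartial.
  exact: rpartialZ.
Qed.

Lemma rsmoothN f : rsmooth f -> rsmooth (- f).
Proof. by rewrite -scaleN1r; exact: rsmoothZ. Qed.

Lemma rsmoothB f g : rsmooth f -> rsmooth g -> rsmooth (f - g).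
Proof. by move=> sf sg; apply: rsmoothD => //; exact: rsmoothN. Qed.

(** Leibniz's rule turns one product into a sum of two, so the class stable under [rpartial]
    consists of finite sums of products. *)
Inductive product_sum : ('rV[R]_m -> R) -> Prop :=
| product_sumM f g : rsmooth f -> rsmooth g -> product_sum (f * g)
| product_sumD f g : product_sum f -> product_sum g -> product_sum (f + g).

Lemma rsmoothM f g : rsmooth f -> rsmooth g -> rsmooth (f * g).
Proof.
move=> sf sg.
have pd h : product_sum h -> forall x, differentiable h x.
  elim => [f' g' ? ? x|f' g' _ df _ dg x].
    by apply: differentiableM; exact: rsmooth_differentiable.
  exact: differentiableD.
apply: (@rsmooth_coind product_sum) => //; last exact: product_sumM.
move=> h i; elim => [f' g' sf' sg'|f' g' pf IHf pg IHg].
  by rewrite rpartialM//; apply: product_sumD; apply: product_sumM => //;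
    exact: rsmooth_rpartial.
rewrite (_ : rpartial i _ = rpartial i f' + rpartial i g').
  exact: product_sumD.
by apply/funext => x; apply: deriveD; apply: diff_derivable; exact: pd.
Qed.

(** The stable class is that of all [f / g ^+ n] with [f] smooth: a derivative has numerator
    [g * rpartial i f - n * f * rpartial i g] over [g ^+ n.+1]. *)
Lemma rsmoothV g : rsmooth g -> (forall x, g x != 0) ->
  rsmooth (fun x => (g x)^-1).
Proof.
move=> sg g0.
pose gV : 'rV[R]_m -> R := fun x => (g x)^-1.
have dg x : differentiable gV x.
  by apply: differentiableV => //; exact: rsmooth_differentiable.
have dgX n x : differentiable (gV ^+ n) x.
  by case: n => [|n]; [rewrite expr0; exact: differentiable_cst|exact: differentiableX].
apply: (@rsmooth_coind (fun h => exists n f, rsmooth f /\ h = f * gV ^+ n));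
  last 1 first.
  exists 1%N, (cst 1); split; first exact: rsmooth_cst.
  by apply/funext => x; rewrite /gV/= mulrfctE mul1r.
- move=> _ [n [f [sf ->]]] x; apply: differentiableM => //.
  exact: rsmooth_differentiable.
- move=> _ i [n [f [sf ->]]].
  exists n.+1, (g * rpartial i f - n%:R *: (f * rpartial i g)); split.
    apply: rsmoothB; first by apply: rsmoothM => //; exact: rsmooth_rpartial.
    by apply: rsmoothZ; apply: rsmoothM => //; exact: rsmooth_rpartial.
  apply/funext => x; rewrite /rpartial deriveM; last 2 first.
    exact: rsmooth_derivable.
    exact: diff_derivable.
  rewrite deriveX; last exact: diff_derivable.
  rewrite /gV deriveV//; last exact: rsmooth_derivable.
  rewrite -[(g * _ - _) * _]/(fun x => _) /=.
  rewrite mulrfctE !fctE.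
  have gx0 := g0 x.
  case: n => [|n]; rewrite /GRing.scale/= ?exprS ?exprVn ?fctE ?expr0.
    by field.
  by field; rewrite expf_neq0//.
Qed.

End real_smooth.

(** * The Euclidean product on row vectors and a criterion for differentiability *)

Section dotv.
Context {R : realType} {m : nat}.
Implicit Types (x y z : 'rV[R]_m).

Lemma dotvC x y : dotv x y = dotv y x.
Proof. by apply: eq_bigr => i _; rewrite mulrC. Qed.

Lemma dotvDr x y z : dotv x (y + z) = dotv x y + dotv x z.
Proof.
by rewrite /dotv -big_split; apply: eq_bigr => i _; rewrite mxE mulrDr.
Qed.

Lemma dotvZr (c : R) x y : dotv x (c *: y) = c * dotv x y.
Proof.
by rewrite /dotv mulr_sumr; apply: eq_bigr => i _; rewrite mxE mulrCA.
Qed.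

Lemma dotvDl x y z : dotv (x + y) z = dotv x z + dotv y z.
Proof. by rewrite dotvC dotvDr !(dotvC z). Qed.

Lemma dotvZl (c : R) x y : dotv (c *: x) y = c * dotv x y.
Proof. by rewrite dotvC dotvZr dotvC. Qed.

Lemma dotv_delta x i : dotv x 'e_i = x 0 i.
Proof.
rewrite /dotv (bigD1 i)//= mxE !eqxx mulr1 big1 ?addr0// => j ji.
by rewrite mxE (negbTE ji) andbF mulr0.
Qed.

Lemma dotv_ge0 x : 0 <= dotv x x.
Proof. by apply: sumr_ge0 => i _; rewrite -expr2 sqr_ge0. Qed.

Lemma ge1_dotv x : 1 <= 1 + dotv x x.
Proof. by rewrite lerDl dotv_ge0. Qed.

Lemma gt0_dotv x : 0 < 1 + dotv x x.
Proof. exact: lt_le_trans (ge1_dotv x). Qed.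

Lemma sqr_coord_le x i : x 0 i ^+ 2 <= dotv x x.
Proof.
rewrite /dotv (bigD1 i)//= -expr2 lerDl sumr_ge0// => j _.
by rewrite -expr2 sqr_ge0.
Qed.

Lemma coord_le x i : `|x 0 i| <= 1 + dotv x x.
Proof.
have := sqr_coord_le x i; set t := dotv x x; rewrite -real_normK ?num_real//.
by move: `|_| => u ut; nra.
Qed.

Lemma coord_le_norm x i : `|x 0 i| <= `|x|.
Proof.
by rewrite [leRHS]/Num.Def.normr/= mx_normrE (le_bigmax _ _ (0, i)).
Qed.

Lemma dotv_le_norm x y : `|dotv x y| <= m%:R * `|x| * `|y|.
Proof.
rewrite /dotv (le_trans (ler_norm_sum _ _ _))//.
rewrite (@le_trans _ _ (\sum_(i < m) `|x| * `|y|))//.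
  by apply: ler_sum => i _; rewrite normrM ler_pM// coord_le_norm.
by rewrite sumr_const card_ord -[leLHS]mulr_natl mulrA.
Qed.

Fact dotv_is_linear x : linear (dotv x : 'rV[R]_m -> R).
Proof. by move=> c y z; rewrite dotvDr dotvZr. Qed.

HB.instance Definition _ x := GRing.isLinear.Build R 'rV[R]_m R *:%R (dotv x)
  (dotv_is_linear x).

Lemma dotv_continuous x : continuous (dotv x : 'rV[R]_m -> R).
Proof.
move=> y; apply/(@cvgrPdist_le _ _ _ (nbhs y)) => e e0; near=> z.
rewrite -linearB/= (le_trans (dotv_le_norm _ _))//.
rewrite (@le_trans _ _ ((m%:R * `|x| + 1) * `|y - z|))//.
  by rewrite ler_wpM2r// lerDl.
rewrite -ler_pdivlMl ?ltr_wpDl// mulrC.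
near: z; apply: cvgr_dist_le; first exact: cvg_id.
by rewrite divr_gt0// ltr_wpDl.
Unshelve. all: by end_near. Qed.

(** A remainder quadratic in [h] identifies the gradient at once; differentiation under the integral
    sign is later reduced to this criterion. *)
Lemma differentiable_quadratic (f : 'rV[R]_m -> R) x a (C : R) :
  (forall h, `|f (x + h) - f x - dotv a h| <= C * `|h| ^+ 2) ->
  differentiable f x /\ forall v, 'D_v f x = dotv a v.
Proof.
move=> fC.
(* [C] carries no sign, so it is replaced by [C + |C| + 1], which is positive and larger. *)
have C0 : 0 <= C + `|C| by rewrite addrC -lerBlDr sub0r (le_trans (ler_norm _))// normrN.
have fo : f \o shift x = cst (f x) + dotv a +o_ (0 : 'rV[R]_m) id.
  apply/eqaddoP => e e0.
  have he : \forall h \near (0 : 'rV[R]_m), `|h| <= e / (C + `|C| + 1).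
    apply/nbhs_normP; exists (e / (C + `|C| + 1)).
      by rewrite /= divr_gt0// ltr_wpDl.
    by move=> h /ltW; rewrite sub0r normrN.
  near=> h.
  rewrite -[(_ - _) h]/(f (h + x) - (f x + dotv a h)) opprD addrA (addrC h).
  rewrite (le_trans (fC h))// (@le_trans _ _ ((C + `|C| + 1) * `|h| * `|h|))//.
    rewrite expr2 mulrA !ler_wpM2r// -addrA lerDl.
    by rewrite addr_ge0.
  rewrite ler_wpM2r// -ler_pdivlMl ?ltr_wpDl// mulrC.
  by near: h; exact: he.
have dfa : 'd f x = dotv a :> ('rV[R]_m -> R).
  by apply: diff_unique => //; exact: dotv_continuous.
have df : differentiable f x.
  by apply/diff_locallyP; rewrite dfa; split => //; exact: dotv_continuous.
by split => // v; rewrite deriveE// dfa.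
Unshelve. all: by end_near. Qed.

End dotv.

(** * Real-valued Schwartz functions *)

Section real_schwartz.
Context {R : realType} {m : nat}.
Implicit Types (f g h : 'rV[R]_m -> R) (x y : 'rV[R]_m) (a : seq 'I_m).

Lemma rpartial_coord i j :
  rpartial i (fun x => x 0 j : R) = cst ((j == i)%:R) :> ('rV[R]_m -> R).
Proof.
apply/funext => x; rewrite /rpartial deriveE; last exact: differentiable_coord.
rewrite (_ : (fun _ => _) = dotv 'e_j); last first.
  by apply/funext => y; rewrite dotvC dotv_delta.
rewrite (@diff_lin _ _ _ (dotv 'e_j)); last exact: dotv_continuous.
by rewrite /= dotv_delta mxE eqxx eq_sym.
Qed.

Lemma rsmooth_coord j : rsmooth (fun x : 'rV[R]_m => x 0 j : R).
Proof.
apply: (@rsmooth_coind _ _ (fun f => rsmooth f \/ f = fun x => x 0 j));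
  last by right.
- move=> f [/rsmooth_differentiable//|-> x]; exact: differentiable_coord.
- move=> f i [sf|->]; left; first exact: rsmooth_rpartial.
  by rewrite rpartial_coord; exact: rsmooth_cst.
Qed.

Lemma rsmooth_sum (I : Type) (s : seq I) (F : I -> 'rV[R]_m -> R) :
  (forall i, rsmooth (F i)) -> rsmooth (\sum_(i <- s) F i).
Proof.
move=> sF; elim/big_ind : _ => //; first exact: rsmooth_cst.
by move=> f g; exact: rsmoothD.
Qed.

Lemma rsmooth_prod (I : Type) (s : seq I) (F : I -> 'rV[R]_m -> R) :
  (forall i, rsmooth (F i)) -> rsmooth (fun x => \prod_(i <- s) F i x).
Proof.
move=> sF; elim: s => [|i s IHs].
  rewrite (_ : (fun _ => _) = cst 1); first exact: rsmooth_cst.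
  by apply/funext => x; rewrite big_nil.
rewrite (_ : (fun _ => _) = F i * (fun x => \prod_(i <- s) F i x)).
  exact: rsmoothM.
by apply/funext => x; rewrite big_cons.
Qed.

Lemma rsmooth_weight : rsmooth (fun x : 'rV[R]_m => 1 + dotv x x).
Proof.
rewrite (_ : (fun _ => _) = cst 1 +
    \sum_(i < m) (fun x : 'rV[R]_m => x 0 i : R) * (fun x => x 0 i)).
  apply: rsmoothD; first exact: rsmooth_cst.
  by apply: rsmooth_sum => i; apply: rsmoothM; exact: rsmooth_coord.
by apply/funext => x; rewrite [RHS]/(_ + _) fct_sumE.
Qed.

Lemma rsmooth_weightX k : rsmooth (fun x : 'rV[R]_m => (1 + dotv x x) ^+ k).
Proof.
elim: k => [|k IHk].
  by under eq_fun do rewrite expr0; exact: rsmooth_cst.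
by under eq_fun do rewrite exprS; exact: rsmoothM rsmooth_weight IHk.
Qed.

Lemma continuous_weight : continuous (fun x : 'rV[R]_m => 1 + dotv x x).
Proof. exact/rsmooth_continuous/rsmooth_weight. Qed.

Definition rapid f := forall k, exists C : R, forall x,
  (1 + dotv x x) ^+ k * `|f x| <= C.

Definition rschwartz f := rsmooth f /\ forall a, rapid (rpartials a f).

Lemma rschwartz_coind (P : ('rV[R]_m -> R) -> Prop) :
  (forall f, P f -> forall x, differentiable f x) ->
  (forall f i, P f -> P (rpartial i f)) ->
  (forall f, P f -> rapid f) ->
  forall f, P f -> rschwartz f.
Proof.
move=> Pd Pp Pr f Pf; split; first exact: (rsmooth_coind Pd Pp Pf).
by move=> a; apply: Pr; elim: a => //= i a; exact: Pp.
Qed.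

Lemma rschwartz_rsmooth f : rschwartz f -> rsmooth f.
Proof. by case. Qed.

Lemma rschwartz_rapid f : rschwartz f -> rapid f.
Proof. by case=> _ /(_ [::]). Qed.

Lemma rschwartz_rpartial i f : rschwartz f -> rschwartz (rpartial i f).
Proof.
case=> sf rf; split=> [|a]; first exact: rsmooth_rpartial.
by rewrite -rpartials_rcons.
Qed.

Lemma rapidD f g : rapid f -> rapid g -> rapid (f + g).
Proof.
move=> rf rg k; have [C fC] := rf k; have [D gD] := rg k.
exists (C + D) => x; apply: le_trans (lerD (fC x) (gD x)).
rewrite -mulrDr ler_wpM2l ?exprn_ge0 ?(ltW (gt0_dotv _))//.
exact: ler_normD.
Qed.

Lemma rapidZ (c : R) f : rapid f -> rapid (c *: f).
Proof.
move=> rf k; have [C fC] := rf k.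
exists (`|c| * C) => x; rewrite [(c *: f) x]/(c * f x) normrM mulrCA.
by rewrite ler_wpM2l.
Qed.

Lemma rapidM_poly g f k (C : R) : (forall x, `|g x| <= C * (1 + dotv x x) ^+ k) ->
  rapid f -> rapid (g * f).
Proof.
move=> gC rf j; have [D fD] := rf (k + j)%N.
exists (`|C| * D) => x; rewrite [(g * f) x]/(g x * f x) normrM.
apply: le_trans (ler_wpM2l (normr_ge0 C) (fD x)).
rewrite exprD; move: (gC x); have := ler_norm C.
have := exprn_ge0 k (ltW (gt0_dotv x)); have := exprn_ge0 j (ltW (gt0_dotv x)).
move: (_ ^+ j) (_ ^+ k) => u v u0 v0 Cn gC'.
rewrite [leLHS](_ : _ = `|g x| * (u * `|f x|)); last by rewrite mulrCA.
rewrite [leRHS](_ : _ = `|C| * v * (u * `|f x|)); last by rewrite !mulrA.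
rewrite ler_wpM2r ?mulr_ge0// (le_trans gC')// ler_wpM2r//.
Qed.

Lemma rschwartzD f g : rschwartz f -> rschwartz g -> rschwartz (f + g).
Proof.
move=> sf sg.
apply: (@rschwartz_coind
  (fun h => exists f g, [/\ rschwartz f, rschwartz g & h = f + g]));
  last by exists f, g.
- move=> _ [f' [g' [[? _] [? _] ->]]] x.
  by apply: differentiableD; exact: rsmooth_differentiable.
- move=> _ i [f' [g' [? ? ->]]]; exists (rpartial i f'), (rpartial i g').
  by split; [exact: rschwartz_rpartial..|rewrite rpartialD//; exact: rschwartz_rsmooth].
- by move=> _ [f' [g' [? ? ->]]]; apply: rapidD; exact: rschwartz_rapid.
Qed.

Lemma rschwartzZ (c : R) f : rschwartz f -> rschwartz (c *: f).
Proof.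
move=> sf.
apply: (@rschwartz_coind (fun h => exists2 f, rschwartz f & h = c *: f));
  last by exists f.
- move=> _ [f' [? _] ->] x.
  by apply: differentiableZ; exact: rsmooth_differentiable.
- move=> _ i [f' ? ->]; exists (rpartial i f'); first exact: rschwartz_rpartial.
  by rewrite rpartialZ//; exact: rschwartz_rsmooth.
- by move=> _ [f' ? ->]; apply: rapidZ; exact: rschwartz_rapid.
Qed.

Lemma rschwartzN f : rschwartz f -> rschwartz (- f).
Proof. by rewrite -scaleN1r; exact: rschwartzZ. Qed.

(** Differentiating [x_j f] leaves an extra term [(j == i) f], so the stable class is that of all
    [x_j f + g] with [f] and [g] Schwartz. *)
Lemma rschwartz_coordM j f : rschwartz f ->
  rschwartz ((fun x => x 0 j : R) * f).
Proof.
move=> sf; have r0 : rschwartz (0 *: f) by exact: rschwartzZ.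
apply: (@rschwartz_coind (fun h => exists f g,
  [/\ rschwartz f, rschwartz g & h = (fun x => x 0 j : R) * f + g]));
  last by exists f, (0 *: f); rewrite scale0r addr0; split => //; rewrite -(scale0r f).
- move=> _ [f' [g' [[? _] [? _] ->]]] x.
  apply: differentiableD; last exact: rsmooth_differentiable.
  by apply: differentiableM; [exact: differentiable_coord|exact: rsmooth_differentiable].
- move=> _ i [f' [g' [sf' sg' ->]]].
  exists (rpartial i f'), ((j == i)%:R *: f' + rpartial i g').
  split; [exact: rschwartz_rpartial|by apply: rschwartzD; [exact: rschwartzZ|exact: rschwartz_rpartial]|].
  have [/= ? ?] := (rschwartz_rsmooth sf', rschwartz_rsmooth sg').
  rewrite rpartialD//; last by apply: rsmoothM => //; exact: rsmooth_coord.
  rewrite rpartialM//; last exact: rsmooth_coord.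
  rewrite rpartial_coord addrA; congr (_ + _ + _).
  by apply/funext => x; exact: mulrC.
- move=> _ [f' [g' [? ? ->]]]; apply: rapidD; last exact: rschwartz_rapid.
  apply: (@rapidM_poly _ _ 1 1); last exact: rschwartz_rapid.
  by move=> x; rewrite mul1r expr1; exact: coord_le.
Qed.

Lemma rpartials_off (K : set 'rV[R]_m) f a : closed K ->
  (forall x, ~ K x -> f x = 0) -> forall x, ~ K x -> rpartials a f x = 0.
Proof.
move=> cK f0; elim: a => //= i a IHa x Kx.
rewrite /rpartial -(derive_cst (0 : R) x 'e_i); apply: near_eq_derive.
have : open (~` K) by exact: closed_openC.
by rewrite openE => /(_ _ Kx); apply: filterS.
Qed.

Lemma compact_rschwartz (K : set 'rV[R]_m) f : compact K -> rsmooth f ->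
  (forall x, ~ K x -> f x = 0) -> rschwartz f.
Proof.
move=> cK sf f0; split => // a k.
have cpt : compact ((fun x => (1 + dotv x x) ^+ k * `|rpartials a f x|) @` K).
  apply: continuous_compact => //; apply: continuous_subspaceT => x.
  apply: (@continuousM _ _ (fun x => (1 + dotv x x) ^+ k)
    (fun x => `|rpartials a f x|)); first exact: (rsmooth_continuous (rsmooth_weightX k)).
  apply: continuous_comp; last exact: norm_continuous.
  by apply: differentiable_continuous; exact: sf.
have [M [_ /(_ (M + 1))]] := compact_bounded cpt.
rewrite ltrDl ltr01 => /(_ erefl) KM.
exists (`|M + 1|) => x; have [Kx|/(rpartials_off a (compact_closed (@norm_hausdorff _ _) cK) f0) ->] := pselect (K x); last first.
  by rewrite normr0 mulr0.
have /KM : ((fun x => (1 + dotv x x) ^+ k * `|rpartials a f x|) @` K)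
  ((1 + dotv x x) ^+ k * `|rpartials a f x|) by exists x.
by rewrite /= => /(le_trans (ler_norm _)) /le_trans; apply; exact: ler_norm.
Qed.

(** A Schwartz seminorm is a supremum over all words of length at most [k], so the separate bounds
    have to be merged. The induction strips the innermost derivative and adds up the bounds of the
    finitely many directions. *)
Lemma rschwartz_uniform N k f : rschwartz f -> exists C : R,
  forall a, (size a <= k)%N -> forall x,
    (1 + dotv x x) ^+ N * `|rpartials a f x| <= C.
Proof.
elim: k f => [|k IHk] f sf.
  have [C fC] := rschwartz_rapid sf N; exists C => -[]//.
have [C0 fC0] := rschwartz_rapid sf N.
have /choice[C fC] : forall i, exists C, forall a, (size a <= k)%N -> forall x,
    (1 + dotv x x) ^+ N * `|rpartials a (rpartial i f) x| <= C.
  by move=> i; apply: IHk; exact: rschwartz_rpartial.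
exists (`|C0| + \sum_i `|C i|) => a; case/lastP: a => [_ x|a i].
  by rewrite (le_trans (fC0 x))// (le_trans (ler_norm _))// lerDl sumr_ge0.
rewrite size_rcons => ak x; rewrite rpartials_rcons (le_trans (fC i a ak x))//.
rewrite (le_trans (ler_norm _))// (bigD1 i)//= addrCA lerDl addr_ge0//.
by rewrite sumr_ge0.
Qed.

End real_schwartz.

(** * Bump functions and supports *)

Section bump.
Context {R : realType}.
Implicit Types (p : {poly R}) (t : R).

Lemma exprn_le_expR n t : 0 <= t -> t ^+ n <= n`!%:R * expR t.
Proof.
move=> t0; case: n => [|n].
  by rewrite expr0 fact0 mul1r -expR0 ler_expR.
rewrite mulrC -ler_pdivrMr ?ltr0n ?fact_gt0//.
by rewrite (le_trans _ (expR_ge1Dxn n t0))// lerDr.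
Qed.

Lemma horner_le_expR p : exists C : R, forall t, 0 <= t ->
  `|p.[t]| <= C * expR t.
Proof.
exists (\sum_(i < size p) `|p`_i| * i`!%:R) => t t0.
rewrite horner_coef (le_trans (ler_norm_sum _ _ _))// mulr_suml ler_sum// => i _.
by rewrite normrM -mulrA ler_wpM2l// ger0_norm ?exprn_ge0// exprn_le_expR.
Qed.

(** For [p = 1] this is the classical function exp(-1/t), extended by 0. The polynomial in 1/t makes
    the family stable under differentiation. *)
Definition flat p t := if 0 < t then p.[t^-1] * expR (- t^-1) else 0.

(** The exponential absorbs two extra powers of 1/t, as the bound on [p * 'X^2] shows. The resulting
    quadratic decay at 0 gives the derivative 0 there. *)
Lemma flat_le p : exists C : R, forall t, `|flat p t| <= C * t ^+ 2.
Proof.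
have [C pC] := horner_le_expR (p * 'X^2); exists C => u.
have C0 : 0 <= C.
  have := pC 0 (lexx _); rewrite expR0 mulr1; exact: le_trans.
rewrite /flat; case: ifPn => [u0|_]; last by rewrite normr0 mulr_ge0// sqr_ge0.
rewrite normrM (ger0_norm (expR_ge0 _)) expRN ler_pdivrMr ?expR_gt0//.
have := pC u^-1; rewrite invr_ge0 (ltW u0) => /(_ erefl).
rewrite hornerM hornerXn normrM [`|u^-1 ^+ 2|]ger0_norm ?exprn_ge0 ?invr_ge0 ?(ltW u0)//.
by rewrite exprVn ler_pdivrMr ?exprn_gt0// mulrAC.
Qed.

Lemma is_derive_flat p t :
  is_derive t 1 (flat p) (flat ('X^2 * (p - p^`())) t).
Proof.
have [t0|t0|->] := ltgtP t 0.
- have near0 : \forall u \near t, cst 0 u = flat p u.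
    near=> u; rewrite /flat ifF//.
    by apply/negbTE; rewrite -leNgt ltW//; near: u; exact: lt_nbhsl.
  apply: (near_eq_is_derive near0); rewrite /flat ifF; first exact: is_derive_cst.
  by rewrite ltNge ltW.
- have neart : \forall u \near t, p.[u^-1] * expR (- u^-1) = flat p u.
    near=> u; rewrite /flat ifT//.
    by near: u; exact: (lt_nbhsr t0).
  apply: (near_eq_is_derive neart).
  have tn0 : t != 0 by rewrite gt_eqF.
  have dV : is_derive t 1 (fun u : R => u^-1) (- t^-2).
    apply: DeriveDef; first exact: derivableV.
    by rewrite deriveV//= derive_id /GRing.scale/= mulr1.
  have dp : is_derive t 1 ((horner p) \o (fun u : R => u^-1)) (p^`().[t^-1] * - t^-2).
    exact: is_derive1_comp.
  have dNV : is_derive t 1 (fun u : R => - u^-1) (t^-2).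
    by have := @is_deriveN _ _ _ _ _ _ _ dV; rewrite opprK.
  have de : is_derive t 1 (expR \o (fun u : R => - u^-1)) (expR (- t^-1) * t^-2).
    exact: is_derive1_comp.
  have := @is_deriveM _ _ _ _ _ _ _ _ dp de; move/is_derive_eq; apply.
  rewrite /flat t0 hornerM hornerXn !hornerE /GRing.scale/=.
  by field.
- have [C pC] := flat_le p.
  rewrite [X in is_derive _ _ _ X](_ : _ = 0); last by rewrite /flat ltxx.
  have : (fun h : R => h^-1 *: ((flat p \o shift 0) (h *: 1) - flat p 0)) @ 0^' --> (0 : R).
    apply/cvgr0Pnorm_le => e e0; near=> h.
    have hn0 : h != 0 by near: h; exact: nbhs_dnbhs_neq.
    rewrite /= addr0 [_ *: 1]mulr1 [flat p 0]/flat ltxx subr0.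
    rewrite normrM normfV ler_pdivrMl ?normr_gt0//.
    rewrite (le_trans (pC _))// -real_normK ?num_real// expr2 mulrCA ler_wpM2l//.
    rewrite (@le_trans _ _ ((`|C| + 1) * `|h|))//.
      by rewrite ler_wpM2r// (le_trans (ler_norm _))// lerDl.
    rewrite -ler_pdivlMl ?ltr_wpDl// mulrC.
    near: h; apply: dnbhs0_le.
    by rewrite divr_gt0// ltr_wpDl.
  move=> h; apply: DeriveDef; first by apply/cvg_ex; exists 0.
  exact/cvg_lim.
Unshelve. all: by end_near. Qed.

Lemma flat_ge0 t : 0 <= flat 1 t.
Proof.
by rewrite /flat; case: ifP => // _; rewrite hornerC mul1r expR_ge0.
Qed.

Lemma flat_gt0 t : 0 < t -> 0 < flat 1 t.
Proof. by rewrite /flat => ->; rewrite hornerC mul1r expR_gt0. Qed.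

Lemma flat_eq0 t : t <= 0 -> flat 1 t = 0.
Proof. by rewrite /flat ltNge => ->. Qed.

Definition smooth_step t := flat 1 t / (flat 1 t + flat 1 (1 - t)).

Lemma step_den_gt0 t : 0 < flat 1 t + flat 1 (1 - t).
Proof.
have [t0|t0] := ltP 0 t; first by rewrite ltr_pwDl ?flat_gt0 ?flat_ge0.
by rewrite ltr_wpDl ?flat_ge0// flat_gt0// subr_gt0 (le_lt_trans t0).
Qed.

Lemma step_ge0 t : 0 <= smooth_step t.
Proof. by rewrite divr_ge0 ?flat_ge0 ?(ltW (step_den_gt0 _)). Qed.

Lemma step_le1 t : smooth_step t <= 1.
Proof. by rewrite ler_pdivrMr ?step_den_gt0// mul1r lerDl flat_ge0. Qed.

Lemma step_eq0 t : t <= 0 -> smooth_step t = 0.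
Proof. by move=> t0; rewrite /smooth_step flat_eq0// mul0r. Qed.

Lemma step_eq1 t : 1 <= t -> smooth_step t = 1.
Proof.
move=> t1; rewrite /smooth_step [flat 1 (1 - t)]flat_eq0 ?subr_le0// addr0 divff//.
by rewrite gt_eqF// flat_gt0// (lt_le_trans ltr01).
Qed.

Context {m : nat}.
Implicit Types (x lo hi : 'rV[R]_m).

Lemma rsmooth_affine (c b : R) (i : 'I_m) :
  rsmooth (fun x : 'rV[R]_m => c * x 0 i + b).
Proof.
rewrite (_ : (fun _ => _) = c *: (fun x : 'rV[R]_m => x 0 i : R) + cst b)//.
apply: rsmoothD; last exact: rsmooth_cst.
by apply: rsmoothZ; exact: rsmooth_coord.
Qed.

(** By the chain rule and [is_derive_flat], the scalar multiples of all [flat q] composed with one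
    fixed affine coordinate form a stable class. *)
Lemma rsmooth_flat p (c b : R) (i : 'I_m) :
  rsmooth (fun x : 'rV[R]_m => flat p (c * x 0 i + b)).
Proof.
pose A x := c * x 0 i + b.
have sA : rsmooth A by exact: rsmooth_affine.
have df q x : differentiable (flat q \o A) x.
  apply: differentiable_comp; first exact: rsmooth_differentiable.
  by apply/derivable1_diffP; have [] := is_derive_flat q (A x).
apply: (@rsmooth_coind _ _
    (fun f => exists q k, f = k *: (flat q \o A))); last first.
- by exists p, 1; rewrite scale1r.
- move=> _ j [q [k ->]]; exists ('X^2 * (q - q^`())), (k * (c * (i == j)%:R)).
  apply/funext => x; rewrite /rpartial deriveZ; last exact/diff_derivable.
  rewrite deriveE// diff_comp; last 2 first.
    exact: rsmooth_differentiable.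
    by apply/derivable1_diffP; have [] := is_derive_flat q (A x).
  rewrite /= diff1E; last first.
    by apply/derivable1_diffP; have [] := is_derive_flat q (A x).
  rewrite derive1E (@derive_val _ _ _ _ _ _ _ (is_derive_flat q (A x))).
  rewrite -deriveE; last exact: rsmooth_differentiable.
  rewrite (_ : 'D_('e_j) A x = c * (i == j)%:R).
    by rewrite [RHS]/GRing.scale/= /GRing.scale/= -!mulrA.
  rewrite -[LHS]/(rpartial j A x).
  rewrite [A](_ : _ = c *: (fun x : 'rV[R]_m => x 0 i : R) + cst b)//.
  rewrite rpartialD; [|by apply: rsmoothZ; exact: rsmooth_coord|exact: rsmooth_cst].
  rewrite rpartialZ; last exact: rsmooth_coord.
  by rewrite rpartial_cst rpartial_coord addr0.
- by move=> _ [q [k ->]] x; apply: differentiableZ.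
Qed.

Lemma rsmooth_step (c b : R) (i : 'I_m) :
  rsmooth (fun x : 'rV[R]_m => smooth_step (c * x 0 i + b)).
Proof.
rewrite (_ : (fun _ => _) = (fun x => flat 1 (c * x 0 i + b)) *
  (fun x => (((fun x => flat 1 (c * x 0 i + b)) +
              (fun x => flat 1 (- c * x 0 i + (1 - b)))) x)^-1)); last first.
  apply/funext => x; rewrite /smooth_step -[RHS]/(_ * (_ + _)^-1).
  by congr (_ / (_ + flat 1 _)); ring.
apply: rsmoothM; first exact: rsmooth_flat.
apply: rsmoothV; first by apply: rsmoothD; exact: rsmooth_flat.
move=> x; rewrite -[X in X != 0]/(_ + _).
rewrite [X in _ + flat 1 X](_ : _ = 1 - (c * x 0 i + b)); last by ring.
by rewrite gt_eqF// step_den_gt0.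
Qed.

Definition box lo hi : set 'rV[R]_m := [set x | forall i, lo 0 i < x 0 i < hi 0 i].

(** For positive [k] each factor climbs from 0 at a face to 1 at distance 1/k from it. The bump thus
    vanishes off the box, while its plateau fills the box as [k] grows. *)
Definition box_bump (k : R) lo hi x : R :=
  \prod_i (smooth_step (k * (x 0 i - lo 0 i)) * smooth_step (k * (hi 0 i - x 0 i))).

Lemma rsmooth_box_bump k lo hi : rsmooth (box_bump k lo hi).
Proof.
rewrite /box_bump.
apply: (@rsmooth_prod _ _ _ _ (fun i x => smooth_step (k * (x 0 i - lo 0 i)) * smooth_step (k * (hi 0 i - x 0 i)))) => i.
apply: (@rsmoothM _ _ (fun x => smooth_step (k * (x 0 i - lo 0 i))) (fun x => smooth_step (k * (hi 0 i - x 0 i)))).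
  under eq_fun do rewrite mulrBr; exact: rsmooth_step.
under eq_fun do rewrite mulrBr addrC -mulNr; exact: rsmooth_step.
Qed.

Lemma box_bump_ge0 k lo hi x : 0 <= box_bump k lo hi x.
Proof. by apply: prodr_ge0 => i _; rewrite mulr_ge0// step_ge0. Qed.

Lemma box_bump_le1 k lo hi x : box_bump k lo hi x <= 1.
Proof.
apply: Num.Theory.prodr_ile1 => i _; rewrite mulr_ge0 ?step_ge0//=.
by rewrite mulr_ile1 ?step_ge0 ?step_le1.
Qed.

Lemma box_bump_eq0 k lo hi x : 0 <= k -> ~ box lo hi x -> box_bump k lo hi x = 0.
Proof.
move=> k0 /existsNP[i /negP]; rewrite negb_and -!leNgt => xi.
apply/eqP; rewrite /box_bump; apply/prodf_eq0; exists i => //.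
rewrite mulf_eq0; case/orP: xi => xi; apply/orP; [left|right]; apply/eqP;
  by apply: step_eq0; rewrite mulr_ge0_le0// subr_le0.
Qed.

Lemma box_bump_eq1 k lo hi x :
  (forall i, 1 <= k * (x 0 i - lo 0 i) /\ 1 <= k * (hi 0 i - x 0 i)) ->
  box_bump k lo hi x = 1.
Proof.
by move=> h; rewrite /box_bump big1// => i _; have [? ?] := h i;
  rewrite !step_eq1// mulr1.
Qed.

Lemma cvg_box_bump lo hi x :
  (box_bump k%:R lo hi x : R) @[k --> \oo] --> (\1_(box lo hi) x : R).
Proof.
have [bx|bx] := pselect (box lo hi x); last first.
  rewrite indicE memNset//; under eq_fun do rewrite box_bump_eq0//.
  exact: cvg_cst.
rewrite indicE mem_set//; apply: cvg_near_cst.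
have near1 (d : R) : 0 < d -> \forall k \near \oo, 1 <= k%:R * d.
  move=> d0; near=> k; rewrite -ler_pdivrMr// div1r.
  by near: k; exact: nbhs_infty_ger.
have : \forall k \near \oo, forall i,
    1 <= k%:R * (x 0 i - lo 0 i) /\ 1 <= k%:R * (hi 0 i - x 0 i).
  apply: filter_forall => i; have /andP[? ?] := bx i.
  by apply: filterS2 (near1 (x 0 i - lo 0 i) _) (near1 (hi 0 i - x 0 i) _);
    rewrite ?subr_gt0//.
by apply: filterS => k; exact: box_bump_eq1.
Unshelve. all: by end_near. Qed.

End bump.

(** * Complex-valued smooth functions, Schwartz functions and test functions *)

Section complex_functions.
Context {R : realType} {m : nat}.
Local Notation cRe := (@complex.Re R).
Local Notation cIm := (@complex.Im R).
Local Notation cabs := (@ComplexField.Normc.normc R).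
Implicit Types (f g : 'rV[R]_m -> R[i]) (x : 'rV[R]_m).

Lemma cabsE (z : R[i]) : cabs z = Num.sqrt (cRe z ^+ 2 + cIm z ^+ 2).
Proof. by case: z. Qed.

Lemma cabs_ge0 (z : R[i]) : 0 <= cabs z.
Proof. by rewrite cabsE sqrtr_ge0. Qed.

Lemma cabs_sqr (z : R[i]) : cabs z ^+ 2 = cRe z ^+ 2 + cIm z ^+ 2.
Proof. by rewrite cabsE sqr_sqrtr// addr_ge0// sqr_ge0. Qed.

Lemma normRe_le_cabs (z : R[i]) : `|cRe z| <= cabs z.
Proof.
by rewrite -(ler_pXn2r (n := 2))// ?nnegrE ?cabs_ge0// cabs_sqr
  real_normK ?num_real// lerDl sqr_ge0.
Qed.

Lemma normIm_le_cabs (z : R[i]) : `|cIm z| <= cabs z.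
Proof.
by rewrite -(ler_pXn2r (n := 2))// ?nnegrE ?cabs_ge0// cabs_sqr
  real_normK ?num_real// lerDr sqr_ge0.
Qed.

Lemma cabs_le (z : R[i]) : cabs z <= `|cRe z| + `|cIm z|.
Proof.
rewrite -(ler_pXn2r (n := 2))// ?nnegrE ?cabs_ge0 ?addr_ge0// cabs_sqr.
rewrite sqrrD !real_normK ?num_real// -addrA lerD2l lerDr.
by rewrite mulrn_wge0// mulr_ge0.
Qed.

Lemma Re_cpartials a f : cRe \o cpartials a f = rpartials a (cRe \o f).
Proof.
elim: a => //= i a IHa; apply/funext => x /=.
by rewrite /rpartial -IHa.
Qed.

Lemma Im_cpartials a f : cIm \o cpartials a f = rpartials a (cIm \o f).
Proof.
elim: a => //= i a IHa; apply/funext => x /=.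
by rewrite /rpartial -IHa.
Qed.

Lemma smoothP f : smooth f <-> rsmooth (cRe \o f) /\ rsmooth (cIm \o f).
Proof.
split=> [sf|[sr si] a x]; last by rewrite Re_cpartials Im_cpartials.
by split => a x; have := sf a x; rewrite Re_cpartials Im_cpartials => -[].
Qed.

Lemma schwartz_seminorm_le k f (C : R) :
  (forall a x, (size a <= k)%N ->
     (1 + dotv x x) ^+ k * cabs (cpartials a f x) <= C) <->
  (schwartz_seminorm k f <= C%:E)%E.
Proof.
split=> [fC|fC a x ak].
  by apply: ge_ereal_sup => _ [a [x [ak ->]]]; rewrite lee_fin fC.
rewrite -lee_fin; apply: le_trans fC; apply: ereal_sup_ubound.
by exists a, x.
Qed.

Lemma schwartz_seminorm_ge0 k f : (0 <= schwartz_seminorm k f)%E.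
Proof.
apply: (@le_trans _ _ ((1 + dotv (0 : 'rV[R]_m) 0) ^+ k * cabs (cpartials [::] f 0))%:E).
  by rewrite lee_fin mulr_ge0 ?cabs_ge0// exprn_ge0// ltW// gt0_dotv.
by apply: ereal_sup_ubound; exists [::], 0.
Qed.

Lemma schwartz_seminorm_fin k f : schwartz f ->
  (schwartz_seminorm k f) \is a fin_num.
Proof.
by case=> _ /(_ k) fk; rewrite ge0_fin_numE// schwartz_seminorm_ge0.
Qed.

Lemma schwartz_seminorm_homo k l f : (k <= l)%N ->
  (schwartz_seminorm k f <= schwartz_seminorm l f)%E.
Proof.
move=> kl; apply: ge_ereal_sup => _ [a [x [ak ->]]].
apply: (@le_trans _ _ ((1 + dotv x x) ^+ l * cabs (cpartials a f x))%:E).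
  by rewrite lee_fin ler_wpM2r ?cabs_ge0// ler_weXn2l// ge1_dotv.
apply: ereal_sup_ubound; exists a, x; split => //.
exact: leq_trans kl.
Qed.

Lemma schwartzP f :
  schwartz f <-> rschwartz (cRe \o f) /\ rschwartz (cIm \o f).
Proof.
split=> [[/smoothP[sr si] fk]|[sr si]].
  have bnd k a : exists C : R, forall x, (1 + dotv x x) ^+ k * cabs (cpartials a f x) <= C.
    (* One index of the seminorm governs both the power of the weight and the number of derivatives,
       hence the maximum. *)
    have /fineK : schwartz_seminorm (maxn k (size a)) f \is a fin_num.
      by rewrite ge0_fin_numE// schwartz_seminorm_ge0.
    move=> fE; exists (fine (schwartz_seminorm (maxn k (size a)) f)) => x.
    apply: (@le_trans _ _ ((1 + dotv x x) ^+ (maxn k (size a)) * cabs (cpartials a f x))).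
      by rewrite ler_wpM2r ?cabs_ge0// ler_weXn2l ?ge1_dotv// leq_maxl.
    apply: (schwartz_seminorm_le _ _ _).2; last exact: leq_maxr.
    by rewrite fE.
  have pos k x : 0 <= (1 + dotv x x : R) ^+ k by rewrite exprn_ge0// ltW// gt0_dotv.
  split; split => // a k; have [C fC] := bnd k a; exists C => x;
    apply: le_trans (fC x); rewrite ler_wpM2l//.
    by rewrite -Re_cpartials; exact: normRe_le_cabs.
  by rewrite -Im_cpartials; exact: normIm_le_cabs.
split; first by apply/smoothP; split; exact: rschwartz_rsmooth.
move=> k; have [C rC] := rschwartz_uniform k k sr.
have [D iD] := rschwartz_uniform k k si.
apply: (@le_lt_trans _ _ (C + D)%:E); last exact: ltry.
apply/schwartz_seminorm_le => a x ak.
apply: le_trans (lerD (rC a ak x) (iD a ak x)).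
rewrite -mulrDr ler_wpM2l//; first by rewrite exprn_ge0// ltW// gt0_dotv.
rewrite -Re_cpartials -Im_cpartials; exact: cabs_le.
Qed.

Lemma fsupport_eq0 f x : ~ fsupport f x -> f x = 0.
Proof. by apply: contra_notP => /eqP fx; exact: subset_closure. Qed.

(** Any compact set outside which [f] vanishes may replace the exact support; such a set is easy to
    produce for sums and products. *)
Lemma C0inftyP (Omega : set 'rV[R]_m) f :
  C0infty Omega f <-> [/\ rsmooth (cRe \o f), rsmooth (cIm \o f) &
    exists K, [/\ compact K, K `<=` Omega & forall x, ~ K x -> f x = 0]].
Proof.
split=> [[/smoothP[? ?] cf fO]|[sr si [K [cK KO f0]]]].
  by split => //; exists (fsupport f); split => // x; exact: fsupport_eq0.
have fK : fsupport f `<=` K.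
  rewrite /fsupport [K](closure_id K).1; last exact: compact_closed.
  by apply: closure_subset => x /eqP fx; apply: contrapT => /f0.
split; [exact/smoothP| |exact: subset_trans KO].
by apply: subclosed_compact fK => //; exact: closed_closure.
Qed.

Lemma C0infty_subset (A B : set 'rV[R]_m) : A `<=` B -> C0infty A `<=` C0infty B.
Proof. by move=> AB f [? ? ?]; split => //; exact: subset_trans AB. Qed.

Lemma C0infty_schwartz (Omega : set 'rV[R]_m) f : C0infty Omega f -> schwartz f.
Proof.
move=> /C0inftyP[? ? [K [cK _ f0]]]; apply/schwartzP.
by split; apply: (compact_rschwartz cK) => // x /f0 /= ->.
Qed.

Lemma Re_comp_lin (c : R[i]) f g : cRe \o (c *: f + g) =
  cRe c *: (cRe \o f) - cIm c *: (cIm \o f) + (cRe \o g).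
Proof.
apply/funext => x; rewrite -[RHS]/(cRe c * cRe (f x) - cIm c * cIm (f x) + cRe (g x)).
rewrite -[LHS]/(cRe (c * f x + g x)).
by case: c (f x) (g x) => ? ? [? ?] [].
Qed.

Lemma Im_comp_lin (c : R[i]) f g : cIm \o (c *: f + g) =
  cRe c *: (cIm \o f) + cIm c *: (cRe \o f) + (cIm \o g).
Proof.
apply/funext => x; rewrite -[RHS]/(cRe c * cIm (f x) + cIm c * cRe (f x) + cIm (g x)).
rewrite -[LHS]/(cIm (c * f x + g x)).
by case: c (f x) (g x) => ? ? [? ?] [].
Qed.

Lemma schwartz_lin (c : R[i]) f g : schwartz f -> schwartz g -> schwartz (c *: f + g).
Proof.
move=> /schwartzP[fr fi] /schwartzP[gr gi]; apply/schwartzP.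
rewrite Re_comp_lin Im_comp_lin; split; apply: rschwartzD => //;
  apply: rschwartzD; rewrite ?scaleNr; try apply: rschwartzN; exact: rschwartzZ.
Qed.

Lemma C0infty_lin (Omega : set 'rV[R]_m) (c : R[i]) f g :
  C0infty Omega f -> C0infty Omega g -> C0infty Omega (c *: f + g).
Proof.
move=> /C0inftyP[fr fi [K [cK KO f0]]] /C0inftyP[gr gi [L [cL LO g0]]].
apply/C0inftyP; rewrite Re_comp_lin Im_comp_lin; split.
- by do 2! apply: rsmoothD => //; try apply: rsmoothN; exact: rsmoothZ.
- by do 2! apply: rsmoothD => //; exact: rsmoothZ.
- exists (K `|` L); split; [exact: compactU|by move=> x [/KO|/LO]|].
  move=> x /not_orP[/f0 fx /g0 gx].
  by rewrite -[LHS]/(c * f x + g x) fx gx mulr0 addr0.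
Qed.

Lemma C0infty_mul (Omega U K : set 'rV[R]_m) (chi : 'rV[R]_m -> R) f :
  rsmooth chi -> closed K -> K `<=` U -> (forall x, ~ K x -> chi x = 0) ->
  C0infty Omega f -> C0infty (Omega `&` U) (fun x => (chi x)%:C%C * f x).
Proof.
move=> schi cK KU chi0 /C0inftyP[fr fi [L [cL LO f0]]]; apply/C0inftyP; split.
- rewrite (_ : _ \o _ = chi * (cRe \o f)); first exact: rsmoothM.
  apply/funext => x; rewrite -[RHS]/(chi x * cRe (f x)) /=.
  by case: (f x) => u v /=; rewrite mul0r subr0.
- rewrite (_ : _ \o _ = chi * (cIm \o f)); first exact: rsmoothM.
  apply/funext => x; rewrite -[RHS]/(chi x * cIm (f x)) /=.
  by case: (f x) => u v /=; rewrite mul0r addr0.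
- exists (K `&` L); split.
  + by rewrite setIC; exact: compact_closedI.
  + by move=> x [Kx Lx]; split; [exact: LO|exact: KU].
  + move=> x /not_andP[/chi0 ->|/f0 ->]; last by rewrite mulr0.
    by rewrite mul0r.
Qed.

End complex_functions.

(** * Supports of tempered distributions *)

Section support.
Context {R : realType} {m : nat}.
Local Notation functional := (('rV[R]_m -> R[i]) -> R[i]).
Implicit Types (u : functional) (f g phi : 'rV[R]_m -> R[i]) (x y : 'rV[R]_m).

Lemma tempered_lin u (c : R[i]) f g : tempered u -> schwartz f -> schwartz g ->
  u (c *: f + g) = c * u f + u g.
Proof. by case=> ul _ _; exact: ul. Qed.

Lemma schwartz0 : schwartz (0 : 'rV[R]_m -> R[i]).
Proof.
apply/schwartzP; split; exact: (compact_rschwartz compact0 (@rsmooth_cst _ _ 0)).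
Qed.

Lemma tempered0 u : tempered u -> u 0 = 0.
Proof.
move=> tu; have := @tempered_lin u (-1) 0 0 tu schwartz0 schwartz0.
by rewrite scaler0 addr0 mulN1r addNr.
Qed.

Definition cube x (r : R) : set 'rV[R]_m :=
  [set y | forall i, y 0 i \in `[x 0 i - r, x 0 i + r]].

Lemma compact_cube x r : compact (cube x r).
Proof.
by apply: (@rV_compact _ _ (fun i => `[x 0 i - r, x 0 i + r]%classic)) => i;
  exact: segment_compact.
Qed.

(** With steepness [2 / r] the bump equals 1 at distance at least [r / 2] from the faces, that is,
    on the ball of radius [r / 2] about [x] in the maximum norm. *)
Definition cutoff (r : R) x : 'rV[R]_m -> R :=
  box_bump (2 / r) (x - const_mx r) (x + const_mx r).

Lemma cutoff_eq1 (r : R) x y : 0 < r -> ball x (r / 2) y -> cutoff r x y = 1.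
Proof.
move=> r0 [_ xy]; apply: box_bump_eq1 => i; rewrite !mxE.
have := xy 0 i; rewrite /ball/= ltr_norml => /andP[xy1 xy2].
split; rewrite mulrAC ler_pdivlMr// mul1r; lra.
Qed.

Lemma cutoff_eq0 (r : R) x y : 0 < r ->
  ~ cube x r y -> cutoff r x y = 0.
Proof.
move=> r0 yx; apply: box_bump_eq0; first by rewrite divr_ge0// ltW.
apply: contra_not yx => yx i; have := yx i; rewrite !mxE => /andP[/ltW ? /ltW ?].
by rewrite in_itv/=; apply/andP.
Qed.

(* Multiplying successively by [1 - cutoff] removes from [phi] its part near
   each of the finitely many points, on which [u] vanishes. *)
Lemma distr_support_eq0 u (F : set 'rV[R]_m) phi : tempered u ->
  distr_support u `<=` F -> C0infty (~` F) phi -> u phi = 0.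
Proof.
move=> tu uF Cphi; have [_ cphi phiF] := Cphi.
(* The radius is meaningful only for points in the support of [phi]; elsewhere it takes the default
   value 0. *)
have /choice[r rP] x : exists r : R, fsupport phi x -> 0 < r /\
    exists U, [/\ open U, forall psi, C0infty U psi -> u psi = 0 &
      cube x r `<=` U].
  have [px|npx] := pselect (fsupport phi x); last by exists 0.
  have : (\bigcup_(U in [set U | open U /\ forall phi, C0infty U phi -> u phi = 0]) U) x.
    by apply: contrapT => nx; exact: phiF px (uF _ nx).
  move=> [U [oU uU] Ux].
  have [e /= e0 eU] : nbhs_ball x U by apply/nbhs_ballP; exact: open_nbhs_nbhs.
  (* Halved, because the cube is closed and the ball of radius [e] is open. *)
  exists (e / 2) => _; split; first by rewrite divr_gt0.
  exists U; split => // y yx; apply: eU; split => // i j; rewrite ord1.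
  have := yx j; rewrite in_itv/= => /andP[? ?].
  by rewrite /ball/= ltr_norml; apply/andP; split; lra.
have := cphi; rewrite compact_cover => /(_ _ (fsupport phi) (fun x => ball x (r x / 2))).
case.
- by move=> x _; exact: ball_open.
- move=> x px; exists x => //; apply: ballxx.
  by have [? _] := rP x px; rewrite divr_gt0.
move=> D Dphi phiD.
pose prd (s : seq 'rV[R]_m) y : R := \prod_(x <- s) (1 - cutoff (r x) x y).
have sprd s : rsmooth (prd s).
  apply: rsmooth_prod => x; apply: (@rsmoothB _ _ (cst 1)); first exact: rsmooth_cst.
  exact: rsmooth_box_bump.
have Cprd s psi : C0infty (~` F) psi ->
    C0infty (~` F) (fun y => (prd s y)%:C%C * psi y).
  move=> Cpsi; rewrite -(setIT (~` F)).
  by apply: (C0infty_mul (K := setT) (sprd s)) => // x [].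
have step (s : seq 'rV[R]_m) psi : (forall x, x \in s -> fsupport phi x) ->
    C0infty (~` F) psi ->
    u psi = u (fun y => (prd s y)%:C%C * psi y).
  elim: s psi => [|x s IHs] psi sD Cpsi.
    congr u; apply/funext => y; rewrite /prd big_nil.
    by rewrite [X in X * _](_ : _ = 1)// mul1r.
  have [r0 [U [oU uU rU]]] : 0 < r x /\
    exists U, [/\ open U, forall psi, C0infty U psi -> u psi = 0 &
      cube x (r x) `<=` U].
    by apply: rP; exact: sD x (mem_head _ _).
  have cK : closed (cube x (r x)) 
    by apply: compact_closed; [exact: norm_hausdorff|exact: compact_cube].
  rewrite (IHs psi)//; last by move=> y ys; apply: sD; rewrite in_cons ys orbT.
  set psi' := fun y => _.
  have Cpsi' : C0infty (~` F) psi' by exact: Cprd.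
  have Cx : C0infty (~` F `&` U) (fun y => (cutoff (r x) x y)%:C%C * psi' y).
    apply: (C0infty_mul (K := cube x (r x))) => //; first exact: rsmooth_box_bump.
    by move=> y Ky; exact: cutoff_eq0.
  have Cxs := Cprd (x :: s) psi Cpsi.
  (* Split [psi'] as [cutoff * psi' + (1 - cutoff) * psi']: the first summand is supported in [U],
     where [u] vanishes, and the second is the product for the longer list. *)
  rewrite (_ : psi' = 1 *: (fun y => (cutoff (r x) x y)%:C%C * psi' y) +
      (fun y => (prd (x :: s) y)%:C%C * psi y)); last first.
    apply/funext => y; rewrite scale1r -[RHS]/(_ + _) /psi' /prd big_cons.
    rewrite rmorphM rmorphB rmorph1; ring.
  rewrite tempered_lin//; [|exact: C0infty_schwartz Cx|exact: C0infty_schwartz Cxs].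
  rewrite uU ?mulr0 ?add0r//.
  by apply: C0infty_subset Cx; exact: subIsetr.
have DE x : x \in finmap.enum_fset D -> fsupport phi x.
  by move=> xD; have := Dphi x xD; rewrite inE.
(* The balls of half radius cover the support of [phi], and on each of them one factor [1 - cutoff]
   is zero, so the whole product is the zero function. *)
rewrite (step (finmap.enum_fset D) phi)// (_ : (fun y => _) = 0); first exact: tempered0.
apply/funext => y; have [py|/fsupport_eq0 ->] := pselect (fsupport phi y); last first.
  by rewrite mulr0.
have [x xD xy] := phiD y py.
rewrite /prd (_ : \prod_(_ <- _) _ = 0) ?mul0r//; apply/eqP.
rewrite prodf_seq_eq0; apply/hasP; exists x => //=; apply/eqP.
rewrite cutoff_eq1 ?subrr//.
by have [] := rP x (DE x xD).
Qed.

Lemma sobolev_supportP (s : R) (F : set 'rV[R]_m) u : closed F -> sobolev s u ->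
  distr_support u `<=` F <-> (forall phi, C0infty (~` F) phi -> u phi = 0).
Proof.
move=> cF [tu _ _]; split=> [uF phi|u0]; first exact: distr_support_eq0.
move=> x ux; apply: contrapT => Fx; apply: ux; exists (~` F) => //.
by split => //; exact: closed_openC.
Qed.

End support.

(** * Integration on row vectors *)

Section row_borel.
Context {R : realType} {m : nat}.
Implicit Types (x lo hi : 'rV[R]_m).

Lemma measurable_box lo hi : measurable (box lo hi).
Proof.
rewrite (_ : box lo hi = \bigcap_(i in [set: 'I_m])
    ((fun x => x 0 i) @^-1` `]lo 0 i, hi 0 i[%classic)); last first.
  apply/seteqP; split=> x xb i; last by have := xb i I; rewrite /= in_itv.
  by move=> _; have := xb i; rewrite /= in_itv.
apply: fin_bigcap_measurable; first exact: finite_finset.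
move=> i _; rewrite -[X in measurable X]setTI.
exact: measurable_row_coord.
Qed.

(** The sigma-algebra is the product one, so it must be compared with the topology: an open set is
    the countable union of the boxes inside it that have a rational centre and half-width
    1/(n+1). *)
Lemma open_row_measurable (U : set 'rV[R]_m) : open U -> measurable U.
Proof.
move=> oU.
pose qbox (p : 'rV[rat]_m * nat) : set 'rV[R]_m :=
  box (map_mx ratr p.1 - const_mx p.2.+1%:R^-1) (map_mx ratr p.1 + const_mx p.2.+1%:R^-1).
rewrite (_ : U = \bigcup_p (if `[< qbox p `<=` U >] then qbox p else set0)).
  apply: countable_bigcupT_measurable; first exact: countableP.
  by move=> p; case: ifP => _ //; exact: measurable_box.
apply/seteqP; split=> [x Ux|x [p _]]; last by case: asboolP => [h /h|].
have [e /= e0 eU] : nbhs_ball x U by apply/nbhs_ballP; exact: open_nbhs_nbhs.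
(* Half of [e], since both [x] and the points of the box lie within 1/(n+1) of the rational
   centre. *)
have [n ne] : exists n : nat, n.+1%:R^-1 < e / 2.
  have e20 : 0 < e / 2 by rewrite divr_gt0.
  exists (Num.truncn (e / 2)^-1).
  rewrite invf_plt ?posrE// truncnS_gt//.
have /choice[q qP] (i : 'I_m) : exists q : rat,
    x 0 i - n.+1%:R^-1 < ratr q < x 0 i + n.+1%:R^-1.
  have : x 0 i - n.+1%:R^-1 < x 0 i + n.+1%:R^-1.
    by rewrite ltrD2l gtrN// invr_gt0.
  by move=> /rat_in_itvoo[q]; rewrite in_itv/=; exists q.
exists (\row_i q i, n) => //; case: asboolP => [_|].
  by move=> i; rewrite !mxE/=; have /andP[] := qP i;
    rewrite ltrBlDr => -> /=; rewrite ltrBlDr => ->.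
case; move=> y yq; apply: eU; split => // k i; rewrite ord1 {k}.
have := yq i; rewrite !mxE /= => /andP; have := andP (qP i).
move: (ratr _) (_^-1) ne => r c ne [? ?] [? ?].
by rewrite /ball/= ltr_norml; apply/andP; split; lra.
Qed.

Lemma continuous_row_measurable (f : 'rV[R]_m -> R) : continuous f ->
  measurable_fun setT f.
Proof.
move=> /continuousP cf; apply: (measurability _ (RGenOpens.measurableE R)).
move=> _ [_ [a [b ->] <-]]; rewrite setTI.
apply: open_row_measurable; apply: cf; exact: interval_open.
Qed.

Lemma compact_row_measurable (K : set 'rV[R]_m) : compact K -> measurable K.
Proof.
move=> cK; have clK : closed K.
  by apply: compact_closed; [exact: norm_hausdorff|].
rewrite -(setCK K); apply: measurableC; apply: open_row_measurable.
exact: closed_openC.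
Qed.

(** A pi-system generating the sigma-algebra, the starting point of the Dynkin argument in
    [test_zero_nbox]. *)
Definition boxes : set (set 'rV[R]_m) := [set A | exists lo hi, A = box lo hi].

Lemma boxes_setI : setI_closed boxes.
Proof.
move=> _ _ [l1 [h1 ->]] [l2 [h2 ->]].
exists (\row_i Num.max (l1 0 i) (l2 0 i)), (\row_i Num.min (h1 0 i) (h2 0 i)).
apply/seteqP; split => [x [b1 b2] i|x bx].
  rewrite !mxE gt_max lt_min; have /andP[l1x xh1] := b1 i.
  by have /andP[l2x xh2] := b2 i; rewrite l1x xh1 l2x xh2.
by split => i; have := bx i; rewrite !mxE gt_max lt_min => /andP[/andP[l1x l2x] /andP[xh1 xh2]];
  apply/andP.
Qed.

Definition nbox (n : nat) : set 'rV[R]_m := box (const_mx (- n%:R)) (const_mx n%:R).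

Lemma bigcup_nbox : \bigcup_n nbox n = setT.
Proof.
apply/seteqP; split => // x _; exists (Num.truncn `|x|).+1 => // i; rewrite !mxE.
rewrite -ltr_norml (le_lt_trans (coord_le_norm _ _))//.
exact: truncnS_gt.
Qed.

Lemma measurable_boxes : measurable = <<s boxes >>.
Proof.
apply/seteqP; split => [A|]; last first.
  apply: smallest_sub; first exact: sigma_algebra_measurable.
  by move=> _ [lo [hi ->]]; exact: measurable_box.
suff : g_sigma_preimage (fun i (x : 'rV[R]_m) => x 0 i) `<=` <<s boxes >>.
  by move=> + mA; apply.
apply: smallest_sub; first exact: smallest_sigma_algebra.
rewrite -bigcup_seq; apply: bigcup_sub => i _ _ [B mB <-]; rewrite setTI.
have {}mB : (@ocitv R).-sigma.-measurable B by exact: mB.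
have : <<s @RGenOpens.G R >> B by move: mB; rewrite RGenOpens.measurableE.
move: B {mB}; apply: smallest_sub.
  split; rewrite /=.
  - by rewrite preimage_set0; exact: sigma_algebra0.
  - by move=> B sB; rewrite setTD -preimage_setC; exact: sigma_algebraC.
  - by move=> F sF; rewrite preimage_bigcup; exact: sigma_algebra_bigcup.
move=> _ [a [b ->]] /=.
(* A slab in direction [i] is exhausted by boxes whose other sides are the intervals from -n to
   n. *)
rewrite (_ : _ @^-1` _ = \bigcup_n box
   (\row_j if j == i then a else - n%:R) (\row_j if j == i then b else n%:R)); last first.
  apply/seteqP; split => [x|x [n _ /(_ i)]] /=.
    rewrite in_itv/= => xab; have : [set: 'rV[R]_m] x by [].
    rewrite -bigcup_nbox => -[n _ xn]; exists n => // j; rewrite !mxE.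
    by case: eqP => [->//|_]; have := xn j; rewrite !mxE.
  by rewrite !mxE eqxx in_itv.
apply: sigma_algebra_bigcup => n; apply: sub_sigma_algebra.
by exists (\row_j if j == i then a else - n%:R), (\row_j if j == i then b else n%:R).
Qed.

End row_borel.

(** * Integration one coordinate at a time, and an integrable majorant *)

Section row_integral.
Context {R : realType}.
Local Notation mu := (lebesgue_row R).
Local Notation leb := (@lebesgue_measure R).

Lemma row_cons0 m (t : R) (v : 'rV[R]_m) : row_cons (t, v) 0 ord0 = t.
Proof. by have [] := row_consK (t, v). Qed.

Lemma row_cons_lift m (t : R) (v : 'rV[R]_m) j :
  row_cons (t, v) 0 (lift ord0 j) = v 0 j.
Proof. by have [_ /rowP/(_ j)] := row_consK (t, v); rewrite mxE. Qed.

Lemma ge0_integral_row_cons m (f : 'rV[R]_m.+1 -> \bar R) :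
  measurable_fun setT f -> (forall x, 0 <= f x)%E ->
  (\int[mu m.+1]_x f x = \int[leb]_t \int[mu m]_v f (row_cons (t, v)))%E.
Proof.
move=> mf f0.
(* By definition [mu m.+1] is the push-forward of the product measure under [row_cons]. *)
transitivity (\int[pushforward (leb \x mu m)%E (@row_cons R m)]_x f x)%E => //.
rewrite ge0_integral_pushforward//; last exact: measurable_row_cons.
rewrite preimage_setT (fubini_tonelli1 (f \o @row_cons R m))//.
  by apply: measurableT_comp => //; exact: measurable_row_cons.
by move=> p; exact: f0.
Qed.

Lemma integrable_row_cons m (f : 'rV[R]_m.+1 -> \bar R) :
  (mu m.+1).-integrable setT f ->
  (leb \x mu m)%E.-integrable setT (f \o @row_cons R m).
Proof.
move=> /integrableP[mf foo]; apply/integrableP; split.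
  by apply: measurableT_comp => //; exact: measurable_row_cons.
apply: le_lt_trans foo.
rewrite [leRHS](_ : _ = \int[pushforward (leb \x mu m)%E (@row_cons R m)]_x `|f x|)%E//.
rewrite ge0_integral_pushforward//; first exact: measurable_row_cons.
by apply: measurableT_comp.
Qed.

Lemma integral_row_cons m (f : 'rV[R]_m.+1 -> \bar R) :
  (mu m.+1).-integrable setT f ->
  (\int[mu m.+1]_x f x = \int[leb \x mu m]_p f (row_cons p))%E.
Proof.
move=> fi; have /integrableP[mf _] := fi.
transitivity (\int[pushforward (leb \x mu m)%E (@row_cons R m)]_x f x)%E => //.
rewrite integral_pushforward//; first exact: measurable_row_cons.
exact: integrable_row_cons.
Qed.

(** A product of one-variable functions, so that its integral is found coordinate by coordinate. It
    lies above [(1 + dotv x x) ^- m] and hence, up to a constant, above the modulus of every rapidly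
    decreasing function. *)
Definition decay m (x : 'rV[R]_m) : R := \prod_(i < m) (1 + x 0 i ^+ 2)^-1.

Lemma decay_ge0 m (x : 'rV[R]_m) : 0 <= decay x.
Proof. by apply: prodr_ge0 => i _; rewrite invr_ge0 addr_ge0// sqr_ge0. Qed.

Lemma decay_row_cons m t (v : 'rV[R]_m) :
  decay (row_cons (t, v)) = (1 + t ^+ 2)^-1 * decay v.
Proof.
rewrite /decay big_ord_recl !row_cons0; congr (_ * _).
by apply: eq_bigr => j _; rewrite !row_cons_lift.
Qed.

Lemma decay_ge m (x : 'rV[R]_m) : (1 + dotv x x) ^- m <= decay x.
Proof.
rewrite /decay -[X in _ ^- X](card_ord m) -exprVn -prodr_const.
apply: ler_prod => i _; rewrite invr_ge0 (ltW (gt0_dotv _))/=.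
rewrite lef_pV2 ?posrE ?gt0_dotv// ?lerD2l ?sqr_coord_le//.
by rewrite ltr_pwDl// sqr_ge0.
Qed.

Lemma continuous_decay m : continuous (@decay m).
Proof.
apply: rsmooth_continuous.
apply: (@rsmooth_prod _ _ _ _ (fun i (x : 'rV[R]_m) => (1 + x 0 i ^+ 2)^-1)) => i.
apply: (@rsmoothV _ _ (fun x : 'rV[R]_m => 1 + x 0 i ^+ 2)); last first.
  by move=> x; rewrite gt_eqF// ltr_pwDl// sqr_ge0.
apply: (@rsmoothD _ _ (cst 1) (fun x : 'rV[R]_m => x 0 i ^+ 2)); first exact: rsmooth_cst.
under eq_fun do rewrite expr2.
by apply: (@rsmoothM _ _ (fun x : 'rV[R]_m => x 0 i) (fun x => x 0 i)); exact: rsmooth_coord.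
Qed.

Lemma measurable_decay m : measurable_fun setT (@decay m).
Proof. by apply: continuous_row_measurable; exact: continuous_decay. Qed.

Lemma integral_oneDsqrV_lty : (\int[leb]_t ((1 + t ^+ 2)^-1)%:E < +oo)%E.
Proof.
rewrite (_ : (fun t : R => _) = (fun t => ((oneDsqr t)^-1)%:E))//.
rewrite (@ge0_symfun_integralT _ (fun t => (oneDsqr t)^-1)).
- rewrite (_ : [set x | _] = `[0%R, +oo[%classic) ?integral0y_oneDsqr ?ltry//.
  by apply/seteqP; split => x /=; rewrite in_itv/= andbT.
- by move=> x; rewrite invr_ge0 addr_ge0// sqr_ge0.
- exact: continuous_oneDsqrV.
- by move=> x /=; rewrite /oneDsqr sqrrN.
Qed.

Lemma integral_decay_lty m : (\int[mu m]_x (decay x)%:E < +oo)%E.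
Proof.
elim: m => [|m IHm].
  rewrite integral_dirac//.
    by rewrite diracT mul1e ltry.
  by apply/measurable_EFinP; exact: measurable_decay.
rewrite ge0_integral_row_cons; last 2 first.
  by apply/measurable_EFinP; exact: measurable_decay.
  by move=> x; rewrite lee_fin decay_ge0.
under eq_integral => t _.
  under eq_integral do rewrite decay_row_cons EFinM.
  rewrite ge0_integralZl//; last 3 first.
  - by apply/measurable_EFinP; exact: measurable_decay.
  - by move=> x _; rewrite lee_fin decay_ge0.
  - by rewrite lee_fin invr_ge0 addr_ge0// sqr_ge0.
  over.
have s0 (t : R) : (0 <= ((1 + t ^+ 2)^-1)%:E)%E.
  by rewrite lee_fin invr_ge0 addr_ge0// sqr_ge0.
have d0 : (0 <= \int[mu m]_x (decay x)%:E)%E.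
  by apply: integral_ge0 => x _; rewrite lee_fin decay_ge0.
have ms : measurable_fun setT (fun t : R => ((1 + t ^+ 2)^-1)%:E).
  apply/measurable_EFinP; apply: continuous_measurable_fun.
  exact: (@continuous_oneDsqrV R).
rewrite ge0_integralZr// lte_mul_pinfty//; first exact: integral_ge0.
by rewrite ge0_fin_numE ?integral_oneDsqrV_lty// integral_ge0.
Qed.

Lemma integrable_decay m : (mu m).-integrable setT (EFin \o @decay m).
Proof.
apply/integrableP; split.
  by apply/measurable_EFinP; exact: measurable_decay.
under eq_integral do rewrite /= ger0_norm ?decay_ge0//.
exact: integral_decay_lty.
Qed.

Lemma integrable_le_decay m (f : 'rV[R]_m -> R) (C : R) :
  measurable_fun setT f -> (forall x, `|f x| <= C * decay x) ->
  (mu m).-integrable setT (EFin \o f).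
Proof.
move=> mf fC.
have := @integrableZl _ _ _ (mu m) setT measurableT C _ (integrable_decay m).
apply: le_integrable => //; first exact/measurable_EFinP.
move=> x _; rewrite /= lee_fin (le_trans (fC x))// normrM.
rewrite (ger0_norm (decay_ge0 x)) ler_wpM2r ?decay_ge0//.
exact: ler_norm.
Qed.

Lemma rapid_le_decay m (f : 'rV[R]_m -> R) : rapid f ->
  exists C : R, forall x, `|f x| <= C * decay x.
Proof.
move=> /(_ m)[C fC]; exists C => x.
have C0 : 0 <= C.
  by apply: le_trans (fC x); rewrite mulr_ge0// exprn_ge0// ltW// gt0_dotv.
rewrite (le_trans _ (ler_wpM2l C0 (decay_ge x)))//.
by rewrite ler_pdivlMr ?exprn_gt0 ?gt0_dotv// mulrC.
Qed.

Lemma rapid_integrable m (f : 'rV[R]_m -> R) : measurable_fun setT f -> rapid f ->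
  (mu m).-integrable setT (EFin \o f).
Proof.
by move=> mf /rapid_le_decay[C fC]; exact: integrable_le_decay fC.
Qed.

End row_integral.

(** * Vanishing integrals of derivatives, and total mass of the normal density *)

Section row_ftc.
Context {R : realType}.
Local Notation mu := (lebesgue_row R).
Local Notation leb := (@lebesgue_measure R).

Lemma oneDsqrV_integrable (C : R) :
  leb.-integrable setT (fun t : R => (C * (1 + t ^+ 2)^-1)%:E).
Proof.
have ms : measurable_fun setT (fun t : R => (1 + t ^+ 2)^-1).
  by apply: continuous_measurable_fun; exact: (@continuous_oneDsqrV R).
under eq_fun do rewrite EFinM.
apply: integrableZl => //; apply/integrableP; split; first exact/measurable_EFinP.
under eq_integral.
  move=> t _; rewrite gee0_abs; last by rewrite lee_fin invr_ge0 addr_ge0// sqr_ge0.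
  over.
exact: integral_oneDsqrV_lty.
Qed.

(** By dominated convergence the integral is the limit of those over the intervals from -(n+1) to
    n+1. The fundamental theorem turns these into boundary values of [f], which tend to 0. *)
Lemma integral_derivative_eq0 (f g : R -> R) (C : R) : continuous g ->
  (forall t : R, is_derive t 1 f (g t)) ->
  (forall t, `|f t| <= C * (1 + t ^+ 2)^-1) ->
  (forall t, `|g t| <= C * (1 + t ^+ 2)^-1) ->
  (\int[leb]_t (g t)%:E = 0)%E.
Proof.
move=> cg fg fC gC.
have C0 : 0 <= C.
  by have := le_trans (normr_ge0 _) (fC 0); rewrite expr0n addr0 invr1 mulr1.
have cf : continuous f.
  move=> t; apply: differentiable_continuous.
  by apply/derivable1_diffP; have [] := fg t.
have mg : measurable_fun setT g by exact: continuous_measurable_fun.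
pose I n : set R := `[- n.+1%:R, n.+1%:R]%classic.
pose g_ n (t : R) := ((g \_ (I n)) t)%:E.
have [_ _] : [/\ leb.-integrable setT (EFin \o g),
    [sequence (\int[leb]_t `|g_ n t - (g t)%:E|)%E]_n @ \oo --> 0%E &
    [sequence (\int[leb]_t g_ n t)%E]_n @ \oo --> (\int[leb]_t (g t)%:E)%E].
  apply: (@dominated_convergence _ _ _ leb setT measurableT g_ (EFin \o g)
      (fun t => (C * (1 + t ^+ 2)^-1)%:E)) => //.
  - move=> n; apply/measurable_EFinP.
    apply/(measurable_restrictT _ _).1; first exact: measurable_itv.
    exact: measurable_funTS.
  - exact/measurable_EFinP.
  - apply: aeW => t _; apply: cvg_near_cst.
    exists (Num.truncn `|t|) => // n /= tn; rewrite /g_ patchE mem_set//.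
    rewrite /I/= in_itv/= -ler_norml (le_trans (ltW (truncnS_gt _)))//.
    by rewrite ler_nat.
  - exact: oneDsqrV_integrable.
  - apply: aeW => t n _; rewrite /g_ patchE lee_fin.
    by case: ifPn => // _; rewrite normr0 (le_trans _ (fC t)).
have gE n : (\int[leb]_t g_ n t)%E = (f n.+1%:R - f (- n.+1%:R))%:E.
  transitivity (\int[leb]_(t in I n) (g t)%:E)%E.
    by rewrite [RHS]integral_mkcond restrict_EFin.
  rewrite (@continuous_FTC2 _ g f)//.
  - by rewrite gtrN.
  - exact: continuous_subspaceT.
  - split => [t _||]; first by have [] := fg t.
    + by apply: cvg_at_right_filter; exact: cf.
    + by apply: cvg_at_left_filter; exact: cf.
  - by move=> t _; rewrite derive1E; have [_] := fg t.
rewrite (_ : [sequence _]_n = EFin \o (fun n => f n.+1%:R - f (- n.+1%:R))); last first.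
  by apply/funext => n /=; rewrite gE.
move=> h1.
have h2 : (f n.+1%:R - f (- n.+1%:R)) @[n --> \oo] --> (0 : R).
  have aux n : n.+1%:R <= 1 + n.+1%:R * n.+1%:R :> R.
    have : 1 <= n.+1%:R :> R by rewrite ler1n.
    by move: (n.+1%:R : R) => x; nra.
  apply/norm_cvg0P.
  (* Since n+1 <= 1 + (n+1)^2, each of the two boundary values is at most C/(n+1). *)
  apply: (@squeeze_cvgr _ _ _ _ (cst 0) (fun n => C *+ 2 * harmonic n)).
  - near=> n; rewrite normr_ge0/= (le_trans (ler_normB _ _))//.
    rewrite mulrnAl mulr2n lerD// (le_trans (fC _))// ?sqrrN ler_wpM2l//.
      by rewrite lef_pV2 ?posrE// ?ltr_wpDr// ?sqr_ge0// expr2 aux.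
    by rewrite lef_pV2 ?posrE// ?ltr_wpDr// ?sqr_ge0// expr2 aux.
  - exact: cvg_cst.
  - rewrite -(mulr0 (C *+ 2)); apply: cvgMr; exact: cvg_harmonic.
apply: (@cvg_unique _ _ (EFin \o (fun n => f n.+1%:R - f (- n.+1%:R)) @ \oo)) => //.
by apply/fine_cvgP; split; [exact: nearW|].
Unshelve. all: by end_near. Qed.

Lemma ball_row_cons m (t t' e : R) (v v' : 'rV[R]_m) : 0 < e -> ball t e t' ->
  (0 < e -> ball v e v') -> ball (row_cons (t, v)) e (row_cons (t', v')).
Proof.
move=> e0 tt' vv'; split => // i j; rewrite ord1.
case: (unliftP ord0 j) => [k ->|->]; last by rewrite !row_cons0.
by rewrite !row_cons_lift; have [_] := vv' e0; exact.
Qed.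

Lemma row_cons_continuous_r m (t : R) :
  continuous (fun v : 'rV[R]_m => row_cons (t, v)).
Proof.
move=> v A /nbhs_ballP[e /= e0 eA]; apply/nbhs_ballP; exists e => //= v' vv'.
by apply: eA; apply: ball_row_cons => //; exact: ballxx.
Qed.

Lemma row_cons_continuous_l m (v : 'rV[R]_m) :
  continuous (fun t : R => row_cons (t, v)).
Proof.
move=> t A /nbhs_ballP[e /= e0 eA]; apply/nbhs_ballP; exists e => //= t' tt'.
by apply: eA; apply: ball_row_cons => // ?; exact: ballxx.
Qed.

Lemma row_cons_delta0 m (h t : R) (v : 'rV[R]_m) :
  h *: 'e_ord0 + row_cons (t, v) = row_cons (h + t, v).
Proof.
apply/rowP => j; rewrite [LHS]mxE [X in X + _]mxE [X in _ * X]mxE.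
case: (unliftP ord0 j) => [k ->|->]; last by rewrite !row_cons0 !eqxx mulr1.
by rewrite !row_cons_lift mulr0 add0r.
Qed.

Lemma row_cons_delta_lift m i (h t : R) (v : 'rV[R]_m) :
  h *: 'e_(lift ord0 i) + row_cons (t, v) = row_cons (t, h *: 'e_i + v).
Proof.
apply/rowP => j; rewrite [LHS]mxE [X in X + _]mxE [X in _ * X]mxE.
case: (unliftP ord0 j) => [k ->|->]; last first.
  by rewrite !row_cons0 mulr0 add0r.
by rewrite !row_cons_lift !mxE eqxx/= (inj_eq lift_inj).
Qed.

(** Fubini puts the differentiated variable inside. If it is the first coordinate, the inner
    integral is one-dimensional; otherwise the first coordinate is frozen at [t] and the induction
    hypothesis applies, with the constant multiplied by [(1 + t ^+ 2)^-1] because [decay]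
    factorises. *)
Lemma integral_partial_eq0 m (i : 'I_m) (f g : 'rV[R]_m -> R) (C : R) :
  continuous g -> (forall x, is_derive x 'e_i f (g x)) ->
  (forall x, `|f x| <= C * decay x) -> (forall x, `|g x| <= C * decay x) ->
  (\int[mu m]_x (g x)%:E = 0)%E.
Proof.
elim: m i f g C => [[]//|m IHm] i f g C cg fg fC gC.
have gi : (mu m.+1).-integrable setT (EFin \o g).
  by apply: integrable_le_decay gC; exact: continuous_row_measurable.
rewrite integral_row_cons//.
have gi' := integrable_row_cons gi.
case: (unliftP ord0 i) fg => [j ->|->] fg.
- rewrite -integral12_prod_meas1//.
  apply: integral0_eq => t _; rewrite /fubini_F/=.
  apply: (IHm j (fun v => f (row_cons (t, v))) _ (C * (1 + t ^+ 2)^-1)).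
  + by move=> v; apply: continuous_comp; [exact: row_cons_continuous_r|exact: cg].
  + move=> v; have := fg (row_cons (t, v)) => -[df <-].
    by apply: DeriveDef; rewrite /derivable /derive;
      under eq_fun do rewrite /= -row_cons_delta_lift.
  + by move=> v; rewrite -mulrA -decay_row_cons.
  + by move=> v; rewrite -mulrA -decay_row_cons.
- rewrite -integral21_prod_meas1//.
  apply: integral0_eq => v _; rewrite /fubini_G/=.
  apply: (@integral_derivative_eq0 (fun t => f (row_cons (t, v))) _ (C * decay v)).
  + by move=> t; apply: continuous_comp; [exact: row_cons_continuous_l|exact: cg].
  + move=> t; have := fg (row_cons (t, v)) => -[df <-].
    have E h : h *: 1 + t = h + t by rewrite [_ *: _]mulr1.
    by apply: DeriveDef; rewrite /derivable /derive;
      under eq_fun do rewrite /= E -row_cons_delta0.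
  + by move=> t; rewrite mulrAC -mulrA -decay_row_cons.
  + by move=> t; rewrite mulrAC -mulrA -decay_row_cons.
Qed.

Lemma integral_normal_row m (c : 'rV[R]_m) (s : R) : s != 0 ->
  (\int[mu m]_x (\prod_(i < m) normal_pdf (c 0 i) s (x 0 i))%:E = 1)%E.
Proof.
move=> s0.
have mprod k (c' : 'rV[R]_k) : measurable_fun setT
    (fun x : 'rV[R]_k => (\prod_(i < k) normal_pdf (c' 0 i) s (x 0 i))%:E).
  apply/measurable_EFinP; apply: measurable_prod => i _.
  apply: measurableT_comp; first exact: measurable_normal_pdf.
  exact: measurable_row_coord.
have ge0 k (c' x : 'rV[R]_k) : 0 <= \prod_(i < k) normal_pdf (c' 0 i) s (x 0 i).
  by apply: prodr_ge0 => i _; exact: normal_pdf_ge0.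
elim: m c => [|m IHm] c.
  rewrite integral_dirac//; last exact: mprod.
  by rewrite diracT mul1e big_ord0.
rewrite ge0_integral_row_cons//; last by move=> x; rewrite lee_fin.
pose c' := \row_j c 0 (lift ord0 j).
under eq_integral => t _.
  under eq_integral => v _.
    rewrite big_ord_recl row_cons0.
    rewrite (eq_bigr (fun i => normal_pdf (c' 0 i) s (v 0 i))); last first.
      by move=> i _; rewrite row_cons_lift /c' mxE.
    rewrite EFinM; over.
  rewrite ge0_integralZl//; last 3 first.
  - exact: mprod.
  - by move=> v _; rewrite lee_fin; exact: ge0.
  - by rewrite lee_fin normal_pdf_ge0.
  rewrite IHm mule1; over.
exact: integral_normal_pdf.
Qed.

End row_ftc.

(** * Taylor bounds for sine and cosine *)

Section trig.
Context {R : realType}.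

Lemma mean_value (f df : R -> R) (a b : R) :
  (forall x : R, is_derive x 1 f (df x)) ->
  exists2 c, `|c - a| <= `|b - a| & f b - f a = df c * (b - a).
Proof.
move=> fdf.
have cf x y : {within `[x, y], continuous f}.
  apply: continuous_subspaceT => z; apply: differentiable_continuous.
  by apply/derivable1_diffP; have [] := fdf z.
have [ab|ba] := leP a b.
  have [c cab E] := MVT_segment ab (fun x _ => fdf x) (cf _ _).
  exists c => //; move: cab; rewrite in_itv/= => /andP[ac cb].
  by rewrite !ger0_norm ?subr_ge0// lerD2r.
have [c cab E] := MVT_segment (ltW ba) (fun x _ => fdf x) (cf _ _).
exists c; last by rewrite -opprB E -mulrN opprB.
move: cab; rewrite in_itv/= => /andP[bc ca].
by rewrite distrC [leRHS]distrC !ger0_norm ?subr_ge0// ?(ltW ba)// lerD2l lerN2.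
Qed.

Lemma sin_lipschitz (x y : R) : `|sin x - sin y| <= `|x - y|.
Proof.
have [c _ ->] := @mean_value sin cos y x _.
by rewrite normrM ler_piMl// ler_norml cos_geN1 cos_le1.
Qed.

Lemma cos_lipschitz (x y : R) : `|cos x - cos y| <= `|x - y|.
Proof.
have [c _ ->] := @mean_value cos (fun x => - sin x) y x _.
by rewrite normrM normrN ler_piMl// ler_norml sin_geN1 sin_le1.
Qed.

(** The linear term is removed before the mean value theorem is applied. The derivative is then a
    difference [sin a - sin c], at most [|b|] in modulus because sine is 1-Lipschitz. *)
Lemma cos_taylor (a b : R) : `|cos (a + b) - cos a + b * sin a| <= b ^+ 2.
Proof.
pose f t := cos t + t * sin a.
have df (t : R) : is_derive t 1 f (- sin t + sin a).
  by apply: is_derive_eq; rewrite /GRing.scale/= mulr0 add0r mulr1.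
have [c ca E] := @mean_value f _ a (a + b) df.
rewrite [X in `|X|](_ : _ = f (a + b) - f a); last by rewrite /f; ring.
rewrite E (addrC a) addrK normrM -[leRHS]real_normK ?num_real// expr2 ler_wpM2r//.
rewrite addrC (le_trans (sin_lipschitz _ _))// distrC (le_trans ca)//.
by rewrite (addrC a) addrK.
Qed.

Lemma sin_taylor (a b : R) : `|sin (a + b) - sin a - b * cos a| <= b ^+ 2.
Proof.
pose f t := sin t - t * cos a.
have df (t : R) : is_derive t 1 f (cos t - cos a).
  by apply: is_derive_eq; rewrite /GRing.scale/= mulr0 add0r mulr1.
have [c ca E] := @mean_value f _ a (a + b) df.
rewrite [X in `|X|](_ : _ = f (a + b) - f a); last by rewrite /f; ring.
rewrite E (addrC a) addrK normrM -[leRHS]real_normK ?num_real// expr2 ler_wpM2r//.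
rewrite (le_trans (cos_lipschitz _ _))// (le_trans ca)//.
by rewrite (addrC a) addrK.
Qed.

End trig.

Section Rintegral_sum.
Context d (T : measurableType d) (R : realType) (mu : {measure set T -> \bar R}).

Lemma integrable_EFinZl (c : R) (f : T -> R) :
  mu.-integrable setT (EFin \o f) -> mu.-integrable setT (fun x => (c * f x)%:E).
Proof.
by move=> fi; under eq_fun do rewrite EFinM; exact: (@integrableZl _ _ _ mu _ _ c (EFin \o f)).
Qed.

Lemma Rintegral_sum (I : Type) (s : seq I) (f : I -> T -> R) :
  (forall i, mu.-integrable setT (EFin \o f i)) ->
  \int[mu]_x (\sum_(i <- s) f i x) = \sum_(i <- s) \int[mu]_x f i x.
Proof.
move=> fi; elim: s => [|i s IHs].
  rewrite big_nil; under eq_Rintegral do rewrite big_nil.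
  by rewrite /Rintegral integral0_eq.
rewrite big_cons -IHs -RintegralD//.
  by apply: eq_Rintegral => x _; rewrite big_cons.
elim: s {IHs} => [|j s IHs].
  rewrite (_ : _ \o _ = cst 0%E); first exact: integrable0.
  by apply/funext => x; rewrite /= big_nil.
rewrite (_ : _ \o _ = (EFin \o f j) \+ (fun x => (\sum_(i <- s) f i x)%:E))%E.
  exact: integrableD.
by apply/funext => x; rewrite /= big_cons EFinD.
Qed.

End Rintegral_sum.

(** * Fourier transform and inversion *)

Section trig_transform.
Context {R : realType} {m : nat}.
Local Notation mu := (lebesgue_row R m).
Implicit Types (f g : 'rV[R]_m -> R) (x xi h : 'rV[R]_m).

(** For real [g] the integral of exp(-i x . xi) g(x) is [cos_transform g xi - i sin_transform g
    xi]. *)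
Definition cos_transform g xi : R := \int[mu]_x (cos (dotv x xi) * g x).
Definition sin_transform g xi : R := \int[mu]_x (sin (dotv x xi) * g x).

Lemma rapid_norm g : rapid g -> rapid (fun x => `|g x|).
Proof. by move=> rg k; have [C gC] := rg k; exists C => x; rewrite normr_id. Qed.

Lemma rapid_le f g : (forall x, `|f x| <= `|g x|) -> rapid g -> rapid f.
Proof.
move=> fg rg k; have [C gC] := rg k; exists C => x; apply: le_trans (gC x).
by rewrite ler_wpM2l ?exprn_ge0// ltW// gt0_dotv.
Qed.

Lemma rapid_weightX k g : rapid g -> rapid ((fun x => (1 + dotv x x) ^+ k) * g).
Proof.
apply: (@rapidM_poly _ _ _ _ k 1) => x.
by rewrite mul1r ger0_norm// exprn_ge0// ltW// gt0_dotv.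
Qed.

Lemma integrable_rapid g : continuous g -> rapid g -> mu.-integrable setT (EFin \o g).
Proof. by move=> cg; apply: rapid_integrable; exact: continuous_row_measurable. Qed.

Lemma rschwartz_continuous g : rschwartz g -> continuous g.
Proof. by move=> /rschwartz_rsmooth/rsmooth_continuous. Qed.

Lemma continuous_cos_dotv xi : continuous (fun x : 'rV[R]_m => cos (dotv x xi)).
Proof.
move=> x; apply: continuous_comp; last exact: continuous_cos.
by rewrite (_ : (fun y => _) = dotv xi); [exact: dotv_continuous|apply/funext => y; rewrite dotvC].
Qed.

Lemma continuous_sin_dotv xi : continuous (fun x : 'rV[R]_m => sin (dotv x xi)).
Proof.
move=> x; apply: continuous_comp; last exact: continuous_sin.
by rewrite (_ : (fun y => _) = dotv xi); [exact: dotv_continuous|apply/funext => y; rewrite dotvC].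
Qed.

Lemma normr_cos_le1 (t : R) : `|cos t| <= 1.
Proof. by rewrite ler_norml cos_geN1 cos_le1. Qed.

Lemma normr_sin_le1 (t : R) : `|sin t| <= 1.
Proof. by rewrite ler_norml sin_geN1 sin_le1. Qed.

Lemma rapidM_bounded f g : (forall x, `|f x| <= 1) -> rapid g -> rapid (f * g).
Proof.
move=> f1; apply: rapid_le => x.
by rewrite [(f * g) x]/(f x * g x) normrM ler_piMl.
Qed.

Lemma integrable_bounded f g : continuous f -> (forall x, `|f x| <= 1) ->
  continuous g -> rapid g -> mu.-integrable setT (fun x => (f x * g x)%:E).
Proof.
move=> cf f1 cg rg; apply: (@integrable_rapid (f * g)).
  by move=> x; apply: continuousM; [exact: cf|exact: cg].
exact: rapidM_bounded.
Qed.

Lemma integrable_cos g xi : rschwartz g ->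
  mu.-integrable setT (fun x => (cos (dotv x xi) * g x)%:E).
Proof.
move=> sg; apply: integrable_bounded.
- exact: continuous_cos_dotv.
- by move=> x; exact: normr_cos_le1.
- exact: rschwartz_continuous.
- exact: rschwartz_rapid.
Qed.

Lemma integrable_sin g xi : rschwartz g ->
  mu.-integrable setT (fun x => (sin (dotv x xi) * g x)%:E).
Proof.
move=> sg; apply: integrable_bounded.
- exact: continuous_sin_dotv.
- by move=> x; exact: normr_sin_le1.
- exact: rschwartz_continuous.
- exact: rschwartz_rapid.
Qed.

Lemma cos_transformD f g : rschwartz f -> rschwartz g ->
  cos_transform (f + g) = cos_transform f + cos_transform g.
Proof.
move=> sf sg; apply/funext => xi; rewrite /cos_transform.
rewrite -[RHS]/(cos_transform f xi + cos_transform g xi) -RintegralD//; last 2 first.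
- exact: integrable_cos.
- exact: integrable_cos.
by apply: eq_Rintegral => x _; rewrite -mulrDr.
Qed.

Lemma sin_transformD f g : rschwartz f -> rschwartz g ->
  sin_transform (f + g) = sin_transform f + sin_transform g.
Proof.
move=> sf sg; apply/funext => xi; rewrite /sin_transform.
rewrite -[RHS]/(sin_transform f xi + sin_transform g xi) -RintegralD//; last 2 first.
- exact: integrable_sin.
- exact: integrable_sin.
by apply: eq_Rintegral => x _; rewrite -mulrDr.
Qed.

Lemma cos_transformZ (c : R) g : rschwartz g ->
  cos_transform (c *: g) = c *: cos_transform g.
Proof.
move=> sg; apply/funext => xi; rewrite -[RHS]/(c * cos_transform g xi) -RintegralZl//.
  by apply: eq_Rintegral => x _; rewrite -[(c *: g) x]/(c * g x) mulrCA.
exact: integrable_cos.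
Qed.

Lemma sin_transformZ (c : R) g : rschwartz g ->
  sin_transform (c *: g) = c *: sin_transform g.
Proof.
move=> sg; apply/funext => xi; rewrite -[RHS]/(c * sin_transform g xi) -RintegralZl//.
  by apply: eq_Rintegral => x _; rewrite -[(c *: g) x]/(c * g x) mulrCA.
exact: integrable_sin.
Qed.

Lemma dotv_le_weight x h : `|dotv x h| <= m%:R * `|h| * (1 + dotv x x).
Proof.
rewrite /dotv (le_trans (ler_norm_sum _ _ _))//.
rewrite (@le_trans _ _ (\sum_(i < m) `|h| * (1 + dotv x x)))//.
  apply: ler_sum => i _; rewrite normrM mulrC ler_pM//.
    exact: coord_le_norm.
  exact: coord_le.
by rewrite sumr_const card_ord -[leLHS]mulr_natl mulrA.
Qed.

(** Here [s] plays the derivative of [c]; the lemma is used for the pairs (cos, -sin) and (sin,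
    cos). Integrating the Taylor remainder against [g] leaves an error quadratic in [h], because (x
    . h)^2 is at most m^2 |h|^2 (1 + |x|^2)^2 and [g] decays rapidly. *)
Lemma trig_transform_quadratic (c s : R -> R) g xi :
  (forall a b, `|c (a + b) - c a - b * s a| <= b ^+ 2) ->
  (forall k, rschwartz k -> forall xi, mu.-integrable setT (fun x => (c (dotv x xi) * k x)%:E)) ->
  (forall k, rschwartz k -> forall xi, mu.-integrable setT (fun x => (s (dotv x xi) * k x)%:E)) ->
  rschwartz g ->
  differentiable (fun xi => \int[mu]_x (c (dotv x xi) * g x)) xi /\
  forall i, 'D_('e_i) (fun xi => \int[mu]_x (c (dotv x xi) * g x)) xi =
    \int[mu]_x (s (dotv x xi) * ((fun x => x 0 i : R) * g) x).
Proof.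
move=> taylor ci si sg.
pose a : 'rV[R]_m := \row_i \int[mu]_x (s (dotv x xi) * ((fun x => x 0 i : R) * g) x).
have ai i : a 0 i = \int[mu]_x (s (dotv x xi) * ((fun x => x 0 i : R) * g) x).
  by rewrite mxE.
have wg : rapid ((fun x => (1 + dotv x x) ^+ 2) * (fun x => `|g x|)).
  by apply: rapid_weightX; apply: rapid_norm; exact: rschwartz_rapid.
have wgi : mu.-integrable setT (fun x => ((1 + dotv x x) ^+ 2 * `|g x|)%:E).
  apply: (@integrable_rapid ((fun x => (1 + dotv x x) ^+ 2) * (fun x => `|g x|))) => //.
  move=> x; apply: (@continuousM _ _ (fun x => (1 + dotv x x) ^+ 2) (fun x => `|g x|)).
    exact: (rsmooth_continuous (rsmooth_weightX 2)).
  by apply: continuous_comp; [exact: rschwartz_continuous|exact: norm_continuous].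
have [|df dD] := @differentiable_quadratic _ _
    (fun xi => \int[mu]_x (c (dotv x xi) * g x)) xi a
    (m%:R ^+ 2 * \int[mu]_x ((1 + dotv x x) ^+ 2 * `|g x|)); last first.
- by split => // i; rewrite dD dotv_delta ai.
move=> h.
have aE : dotv a h = \int[mu]_x (s (dotv x xi) * (dotv x h * g x)).
  rewrite /dotv.
  transitivity (\sum_(i < m) \int[mu]_x (h 0 i * (s (dotv x xi) * ((fun x => x 0 i : R) * g) x))).
    apply: eq_bigr => i _; rewrite ai RintegralZl//; first exact: mulrC.
    by apply: si; exact: rschwartz_coordM.
  rewrite -Rintegral_sum; last first.
    by move=> i; apply: integrable_EFinZl; apply: si; exact: rschwartz_coordM.
  apply: eq_Rintegral => x _.
  rewrite mulr_suml mulr_sumr; apply: eq_bigr => i _.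
  rewrite -[((fun x => x 0 i : R) * g) x]/(x 0 i * g x); ring.
have dotgi : mu.-integrable setT (fun x => (s (dotv x xi) * (dotv x h * g x))%:E).
  rewrite [X in mu.-integrable _ X](_ : _ = fun x =>
      (\sum_(i < m) (h 0 i * (s (dotv x xi) * ((fun x => x 0 i : R) * g) x))%:E)%E).
    apply: integrable_sum => // i _.
    by apply: integrable_EFinZl; apply: si; exact: rschwartz_coordM.
  apply/funext => x; rewrite sumEFin; congr EFin.
  rewrite /dotv mulr_suml mulr_sumr; apply: eq_bigr => i _.
  rewrite -[((fun x => x 0 i : R) * g) x]/(x 0 i * g x); ring.
rewrite aE -RintegralB//; last 2 first.
- exact: ci.
- exact: ci.
rewrite -RintegralB//; last first.
  by rewrite (_ : _ \o _ = (fun x => (c (dotv x (xi + h)) * g x)%:E - (c (dotv x xi) * g x)%:E)%E)//;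
    apply: integrableB => //; exact: ci.
have Bi : mu.-integrable setT (EFin \o (fun x =>
    c (dotv x (xi + h)) * g x - c (dotv x xi) * g x - s (dotv x xi) * (dotv x h * g x))).
  rewrite (_ : _ \o _ = (fun x => (c (dotv x (xi + h)) * g x)%:E - (c (dotv x xi) * g x)%:E -
    (s (dotv x xi) * (dotv x h * g x))%:E)%E)//.
  by apply: integrableB => //; apply: integrableB => //; exact: ci.
rewrite (le_trans (le_normr_Rintegral _ Bi))//.
rewrite mulrAC -RintegralZl//.
apply: le_Rintegral => //.
- exact: (integrable_norm Bi).
- exact: integrable_EFinZl.
move=> x _.
rewrite [X in `|X|](_ : _ =
  (c (dotv x xi + dotv x h) - c (dotv x xi) - dotv x h * s (dotv x xi)) * g x); last first.
  by rewrite dotvDr; ring.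
rewrite normrM mulrA ler_wpM2r// (le_trans (taylor _ _))//.
rewrite -[dotv x h ^+ 2]real_normK ?num_real// -!exprMn.
rewrite ler_pXn2r ?nnegrE ?dotv_le_weight//.
by apply: mulr_ge0; [exact: mulr_ge0|exact/ltW/gt0_dotv].
Qed.

Lemma cos_transform_differentiable g xi : rschwartz g ->
  differentiable (cos_transform g) xi.
Proof.
move=> sg; have [||||] // := @trig_transform_quadratic cos (fun t => - sin t) g xi.
- by move=> a b; rewrite mulrN opprK; exact: cos_taylor.
- by move=> h sh xi'; exact: integrable_cos.
- move=> h sh xi'; under eq_fun do rewrite mulNr EFinN.
  by apply: integrableN; exact: integrable_sin.
Qed.

Lemma sin_transform_differentiable g xi : rschwartz g ->
  differentiable (sin_transform g) xi.
Proof.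
move=> sg; have [||||] // := @trig_transform_quadratic sin cos g xi.
- by move=> a b; exact: sin_taylor.
- by move=> h sh xi'; exact: integrable_sin.
- by move=> h sh xi'; exact: integrable_cos.
Qed.

Lemma rpartial_cos_transform i g : rschwartz g ->
  rpartial i (cos_transform g) = - sin_transform ((fun x => x 0 i : R) * g).
Proof.
move=> sg; apply/funext => xi.
have [||||_ /(_ i)] := @trig_transform_quadratic cos (fun t => - sin t) g xi.
- by move=> a b; rewrite mulrN opprK; exact: cos_taylor.
- by move=> h sh xi'; exact: integrable_cos.
- move=> h sh xi'; under eq_fun do rewrite mulNr EFinN.
  by apply: integrableN; exact: integrable_sin.
- by [].
rewrite -[X in _ -> X]/(_ = - sin_transform _ xi) => D; rewrite [LHS]D -mulN1r -RintegralZl//.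
  by apply: eq_Rintegral => x _; rewrite mulN1r mulNr.
by apply: integrable_sin; exact: rschwartz_coordM.
Qed.

Lemma rpartial_sin_transform i g : rschwartz g ->
  rpartial i (sin_transform g) = cos_transform ((fun x => x 0 i : R) * g).
Proof.
move=> sg; apply/funext => xi.
have [||||_ /(_ i)] := @trig_transform_quadratic sin cos g xi => //.
- by move=> a b; exact: sin_taylor.
- by move=> h sh xi'; exact: integrable_sin.
- by move=> h sh xi'; exact: integrable_cos.
Qed.

End trig_transform.

(** * Stability of Schwartz functions under the transforms, and adjointness *)

Section transform_schwartz.
Context {R : realType} {m : nat}.
Local Notation mu := (lebesgue_row R m).
Implicit Types (f g : 'rV[R]_m -> R) (x xi : 'rV[R]_m).

Lemma trig_derive (c s : R -> R) xi x :
  (forall a b, `|c (a + b) - c a - b * s a| <= b ^+ 2) ->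
  differentiable (fun x => c (dotv x xi)) x /\
  forall i, 'D_('e_i) (fun x => c (dotv x xi)) x = xi 0 i * s (dotv x xi).
Proof.
move=> taylor.
have [h|df dD] := @differentiable_quadratic _ _ (fun x => c (dotv x xi)) x
    (s (dotv x xi) *: xi) ((m%:R * `|xi|) ^+ 2); last first.
  by split => // i; rewrite dD dotv_delta mxE mulrC.
rewrite dotvZl dotvDl (dotvC xi) mulrC (le_trans (taylor _ _))//.
rewrite -[dotv h xi ^+ 2]real_normK ?num_real// -exprMn ler_pXn2r ?nnegrE ?mulr_ge0//.
by rewrite dotvC dotv_le_norm.
Qed.

(** Integration by parts: [G] is the i-th partial derivative of [F], so its integral is 0. *)
Lemma trig_parts (c s : R -> R) i g xi :
  (forall a b, `|c (a + b) - c a - b * s a| <= b ^+ 2) ->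
  continuous c -> (forall t, `|c t| <= 1) ->
  continuous s -> (forall t, `|s t| <= 1) -> rschwartz g ->
  xi 0 i * \int[mu]_x (s (dotv x xi) * g x) =
  - \int[mu]_x (c (dotv x xi) * rpartial i g x).
Proof.
move=> taylor cc c1 cs s1 sg.
have cdot (k : R -> R) : continuous k -> continuous (fun x : 'rV[R]_m => k (dotv x xi)).
  move=> ck x; apply: continuous_comp; last exact: ck.
  rewrite (_ : (fun y => _) = dotv xi); first exact: dotv_continuous.
  by apply/funext => y; rewrite dotvC.
have cg := rschwartz_continuous sg; have rg := rschwartz_rapid sg.
have sg' := rschwartz_rpartial i sg.
have cg' := rschwartz_continuous sg'; have rg' := rschwartz_rapid sg'.
have si : mu.-integrable setT (fun x => (s (dotv x xi) * g x)%:E).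
  by apply: (@integrable_bounded _ _ (fun x => s (dotv x xi))) => //; exact: cdot.
have ci : mu.-integrable setT (fun x => (c (dotv x xi) * rpartial i g x)%:E).
  by apply: (@integrable_bounded _ _ (fun x => c (dotv x xi))) => //; exact: cdot.
apply/eqP; rewrite -subr_eq0 opprK -RintegralZl// -RintegralD//; last first.
  exact: integrable_EFinZl.
pose F := (fun x : 'rV[R]_m => c (dotv x xi)) * g.
pose G := (xi 0 i *: ((fun x : 'rV[R]_m => s (dotv x xi)) * g)) +
  ((fun x : 'rV[R]_m => c (dotv x xi)) * rpartial i g).
have rF : rapid F by exact: rapidM_bounded.
have rG : rapid G by apply: rapidD; [apply: rapidZ|]; exact: rapidM_bounded.
have [C1 FC] := rapid_le_decay rF; have [C2 GC] := rapid_le_decay rG.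
have D0 := @decay_ge0 R m.
rewrite /Rintegral (_ : (\int[mu]_x _)%E = 0%E)//.
apply: (@integral_partial_eq0 R m i F G (`|C1| + `|C2|)).
- move=> x; rewrite /G; apply: (@continuousD _ _ _ (xi 0 i *: ((fun x : 'rV[R]_m => s (dotv x xi)) * g))).
    apply: continuousZr; apply: (@continuousM _ _ (fun x => s (dotv x xi)) g); [exact: cdot|exact: cg].
  by apply: (@continuousM _ _ (fun x => c (dotv x xi))); [exact: cdot|exact: cg'].
- move=> x; have [df dD] := trig_derive xi x taylor.
  apply: DeriveDef.
    apply: derivableM; first exact: diff_derivable.
    exact: rsmooth_derivable (rschwartz_rsmooth sg) _ _.
  rewrite deriveM; last 2 first.
  + exact: diff_derivable.
  + exact: rsmooth_derivable (rschwartz_rsmooth sg) _ _.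
  rewrite dD /G -[RHS]/(xi 0 i * (s (dotv x xi) * g x) + c (dotv x xi) * rpartial i g x).
  by rewrite /GRing.scale/= addrC [g x * _]mulrC mulrA.
- by move=> x; rewrite (le_trans (FC x))// ler_wpM2r// (le_trans (ler_norm _))// lerDl.
- by move=> x; rewrite (le_trans (GC x))// ler_wpM2r// (le_trans (ler_norm _))// lerDr.
Qed.

Lemma coord_cos_transform i g xi : rschwartz g ->
  xi 0 i * cos_transform g xi = - sin_transform (rpartial i g) xi.
Proof.
move=> sg; apply: (@trig_parts sin cos) => //.
- exact: sin_taylor.
- exact: continuous_sin.
- exact: normr_sin_le1.
- exact: continuous_cos.
- exact: normr_cos_le1.
Qed.

Lemma coord_sin_transform i g xi : rschwartz g ->
  xi 0 i * sin_transform g xi = cos_transform (rpartial i g) xi.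
Proof.
move=> sg; apply: oppr_inj.
have := @trig_parts cos (fun t => - sin t) i g xi _ _ _ _ _ sg.
move=> <-.
- rewrite -mulrN; congr (_ * _); rewrite -mulN1r -RintegralZl//.
    by apply: eq_Rintegral => x _; rewrite mulN1r mulNr.
  exact: integrable_sin.
- by move=> a b; rewrite mulrN opprK; exact: cos_taylor.
- exact: continuous_cos.
- exact: normr_cos_le1.
- by move=> t; apply: continuousN; exact: continuous_sin.
- by move=> t; rewrite normrN; exact: normr_sin_le1.
Qed.

(** Its symbol is the weight [1 + dotv xi xi]: each application to [g] buys one more power of decay
    for the transform. *)
Definition one_minus_laplacian g : 'rV[R]_m -> R :=
  g - \sum_(i < m) rpartial i (rpartial i g).

Lemma rschwartz0 : rschwartz (0 : 'rV[R]_m -> R).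
Proof. exact: (compact_rschwartz compact0 (@rsmooth_cst _ _ 0)). Qed.

Lemma rschwartz_sum (I : Type) (s : seq I) (F : I -> 'rV[R]_m -> R) :
  (forall i, rschwartz (F i)) -> rschwartz (\sum_(i <- s) F i).
Proof.
move=> sF; elim/big_ind : _ => //; first exact: rschwartz0.
by move=> f g; exact: rschwartzD.
Qed.

Lemma rschwartz_one_minus_laplacian g : rschwartz g -> rschwartz (one_minus_laplacian g).
Proof.
move=> sg; apply: rschwartzD => //; apply: rschwartzN; apply: rschwartz_sum => i.
by do 2! apply: rschwartz_rpartial.
Qed.

Lemma cos_transform_sum (s : seq 'I_m) (F : 'I_m -> 'rV[R]_m -> R) :
  (forall i, rschwartz (F i)) ->
  cos_transform (\sum_(i <- s) F i) = \sum_(i <- s) cos_transform (F i).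
Proof.
move=> sF; elim: s => [|i s IHs]; last first.
  by rewrite !big_cons cos_transformD// ?IHs//; exact: rschwartz_sum.
rewrite !big_nil -(scale0r (0 : 'rV[R]_m -> R)) cos_transformZ ?scale0r//.
exact: rschwartz0.
Qed.

Lemma sin_transform_sum (s : seq 'I_m) (F : 'I_m -> 'rV[R]_m -> R) :
  (forall i, rschwartz (F i)) ->
  sin_transform (\sum_(i <- s) F i) = \sum_(i <- s) sin_transform (F i).
Proof.
move=> sF; elim: s => [|i s IHs]; last first.
  by rewrite !big_cons sin_transformD// ?IHs//; exact: rschwartz_sum.
rewrite !big_nil -(scale0r (0 : 'rV[R]_m -> R)) sin_transformZ ?scale0r//.
exact: rschwartz0.
Qed.

Lemma weight_cos_transform g xi : rschwartz g ->
  (1 + dotv xi xi) * cos_transform g xi = cos_transform (one_minus_laplacian g) xi.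
Proof.
move=> sg; have sg2 i : rschwartz (rpartial i (rpartial i g)).
  by do 2! apply: rschwartz_rpartial.
rewrite /one_minus_laplacian -scaleN1r cos_transformD//; last first.
  by apply: rschwartzZ; exact: rschwartz_sum.
rewrite cos_transformZ; last exact: rschwartz_sum.
rewrite cos_transform_sum// -[RHS]/(_ xi + (- 1) * _) fct_sumE mulN1r mulrDl mul1r.
congr (_ + _); rewrite /dotv mulr_suml -sumrN; apply: eq_bigr => i _.
rewrite -mulrA coord_cos_transform// mulrN coord_sin_transform//.
exact: rschwartz_rpartial.
Qed.

Lemma weight_sin_transform g xi : rschwartz g ->
  (1 + dotv xi xi) * sin_transform g xi = sin_transform (one_minus_laplacian g) xi.
Proof.
move=> sg; have sg2 i : rschwartz (rpartial i (rpartial i g)).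
  by do 2! apply: rschwartz_rpartial.
rewrite /one_minus_laplacian -scaleN1r sin_transformD//; last first.
  by apply: rschwartzZ; exact: rschwartz_sum.
rewrite sin_transformZ; last exact: rschwartz_sum.
rewrite sin_transform_sum// -[RHS]/(_ xi + (- 1) * _) fct_sumE mulN1r mulrDl mul1r.
congr (_ + _); rewrite /dotv mulr_suml -sumrN; apply: eq_bigr => i _.
rewrite -mulrA coord_sin_transform// coord_cos_transform//.
exact: rschwartz_rpartial.
Qed.

Lemma rschwartz_integrable g : rschwartz g -> mu.-integrable setT (EFin \o g).
Proof.
by move=> sg; apply: integrable_rapid; [exact: rschwartz_continuous|exact: rschwartz_rapid].
Qed.

Lemma cos_transform_le g xi : rschwartz g ->
  `|cos_transform g xi| <= \int[mu]_x `|g x|.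
Proof.
move=> sg; have ci := integrable_cos xi sg.
rewrite (le_trans (le_normr_Rintegral _ ci))//; apply: le_Rintegral => //.
- exact: (integrable_norm ci).
- exact: (integrable_norm (rschwartz_integrable sg)).
- by move=> x _; rewrite normrM ler_piMl// normr_cos_le1.
Qed.

Lemma sin_transform_le g xi : rschwartz g ->
  `|sin_transform g xi| <= \int[mu]_x `|g x|.
Proof.
move=> sg; have ci := integrable_sin xi sg.
rewrite (le_trans (le_normr_Rintegral _ ci))//; apply: le_Rintegral => //.
- exact: (integrable_norm ci).
- exact: (integrable_norm (rschwartz_integrable sg)).
- by move=> x _; rewrite normrM ler_piMl// normr_sin_le1.
Qed.

Lemma rapid_cos_transform g : rschwartz g -> rapid (cos_transform g).
Proof.
move=> sg k; elim: k g sg => [|k IHk] g sg.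
  by exists (\int[mu]_x `|g x|) => xi; rewrite expr0 mul1r cos_transform_le.
have [C hC] := IHk _ (rschwartz_one_minus_laplacian sg); exists C => xi.
rewrite exprSr -mulrA -[1 + dotv xi xi in X in _ * X]ger0_norm ?(ltW (gt0_dotv _))//.
by rewrite -normrM weight_cos_transform.
Qed.

Lemma rapid_sin_transform g : rschwartz g -> rapid (sin_transform g).
Proof.
move=> sg k; elim: k g sg => [|k IHk] g sg.
  by exists (\int[mu]_x `|g x|) => xi; rewrite expr0 mul1r sin_transform_le.
have [C hC] := IHk _ (rschwartz_one_minus_laplacian sg); exists C => xi.
rewrite exprSr -mulrA -[1 + dotv xi xi in X in _ * X]ger0_norm ?(ltW (gt0_dotv _))//.
by rewrite -normrM weight_sin_transform.
Qed.

(** The two kinds of transform are treated together, since a partial derivative turns one kind into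
    the other. *)
Lemma rschwartz_transform f : (exists2 g, rschwartz g &
  (f = cos_transform g \/ f = sin_transform g)) -> rschwartz f.
Proof.
move=> Pf; refine (rschwartz_coind (P := fun f => exists2 g, rschwartz g &
  (f = cos_transform g \/ f = sin_transform g)) _ _ _ Pf);
  [move=> h [g sg [->|->]] xi|move=> h i [g sg [->|->]]|move=> h [g sg [->|->]]].
- exact: cos_transform_differentiable.
- exact: sin_transform_differentiable.
- exists (-1 *: ((fun x => x 0 i : R) * g)); first exact/rschwartzZ/rschwartz_coordM.
  right; rewrite rpartial_cos_transform// sin_transformZ ?scaleN1r//.
  exact: rschwartz_coordM.
- exists ((fun x => x 0 i : R) * g); first exact: rschwartz_coordM.
  by left; rewrite rpartial_sin_transform.
- exact: rapid_cos_transform.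
- exact: rapid_sin_transform.
Qed.

Lemma rschwartz_cos_transform g : rschwartz g -> rschwartz (cos_transform g).
Proof. by move=> sg; apply: rschwartz_transform; exists g => //; left. Qed.

Lemma rschwartz_sin_transform g : rschwartz g -> rschwartz (sin_transform g).
Proof. by move=> sg; apply: rschwartz_transform; exists g => //; right. Qed.

(** As the kernel is bounded by 1, the integrand is dominated by |f(x)| |g(xi)|, which is integrable
    on the product space. *)
Lemma fubini_kernel (k : 'rV[R]_m * 'rV[R]_m -> R) f g :
  measurable_fun setT k -> (forall p, `|k p| <= 1) ->
  mu.-integrable setT (EFin \o f) -> mu.-integrable setT (EFin \o g) ->
  \int[mu]_xi ((\int[mu]_x (k (x, xi) * f x)) * g xi) =
  \int[mu]_x ((\int[mu]_xi (k (x, xi) * g xi)) * f x).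
Proof.
move=> mk k1 fi gi.
have mf : measurable_fun setT f by apply/measurable_EFinP; exact: measurable_int fi.
have mg : measurable_fun setT g by apply/measurable_EFinP; exact: measurable_int gi.
pose F (p : 'rV[R]_m * 'rV[R]_m) : \bar R := (k p * f p.1 * g p.2)%:E.
have mF : measurable_fun setT F.
  apply/measurable_EFinP; apply: measurable_funM; last exact: measurableT_comp.
  by apply: measurable_funM => //; exact: measurableT_comp.
have kfi xi : mu.-integrable setT (fun x => (k (x, xi) * f x)%:E).
  apply: le_integrable fi => //.
    apply/measurable_EFinP; apply: measurable_funM => //.
    by apply: measurableT_comp => //; exact: pair2_measurable.
  by move=> x _; rewrite /= lee_fin normrM ler_piMl.
have kgi x : mu.-integrable setT (fun xi => (k (x, xi) * g xi)%:E).
  apply: le_integrable gi => //.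
    apply/measurable_EFinP; apply: measurable_funM => //.
    by apply: measurableT_comp => //; exact: pair1_measurable.
  by move=> xi _; rewrite /= lee_fin normrM ler_piMl.
have Fi : (mu \x mu)%E.-integrable setT F.
  apply/integrable12ltyP => //.
  apply: (@le_lt_trans _ _ (\int[mu]_x (`|f x|%:E * \int[mu]_xi `|g xi|%:E))%E).
    apply: ge0_le_integral => //.
    - by move=> x _; exact: integral_ge0.
    - apply: (@measurable_fun_fubini_tonelli_F _ _ _ _ _ mu (abse \o F)).
        exact: measurableT_comp.
      by move=> p; exact: abse_ge0.
    - apply: emeasurable_funM => //; apply/measurable_EFinP.
      exact: measurableT_comp.
    - move=> x _; rewrite -ge0_integralZl//; last first.
        by apply/measurable_EFinP; exact: measurableT_comp.
      apply: ge0_le_integral => //.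
      + apply: measurableT_comp => //; apply: (measurableT_comp mF).
        exact: pair1_measurable.
      + apply: emeasurable_funM => //; apply/measurable_EFinP.
        exact: measurableT_comp.
      + by move=> xi _; rewrite /F /= -EFinM lee_fin !normrM -mulrA ler_piMl.
  have gfin : (\int[mu]_xi `|g xi|%:E)%E \is a fin_num.
    rewrite ge0_fin_numE ?integral_ge0//.
    by have /integrableP[_] := gi.
  rewrite ge0_integralZr//; last 2 first.
  - by apply/measurable_EFinP; exact: measurableT_comp.
  - exact: integral_ge0.
  rewrite -(fineK gfin) lte_mul_pinfty//.
  - exact: integral_ge0.
  - rewrite ge0_fin_numE ?integral_ge0//.
    by have /integrableP[_] := fi.
  - by rewrite ltry.
have := Fubini Fi; rewrite /fubini_F /fubini_G => E.
rewrite /Rintegral; congr fine; transitivity (\int[mu]_y \int[mu]_x F (x, y))%E.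
  apply: eq_integral => xi _; rewrite /F/=.
  rewrite EFinM /Rintegral fineK; last exact: integrable_fin_num.
  rewrite -integralZr//; by apply: eq_integral => x _; rewrite -EFinM.
rewrite -E; apply: eq_integral => x _; rewrite /F/=.
rewrite EFinM /Rintegral fineK; last exact: integrable_fin_num.
by rewrite -integralZr//; apply: eq_integral => xi _; rewrite -EFinM mulrAC.
Qed.

Lemma measurable_dotv : measurable_fun setT (fun p : 'rV[R]_m * 'rV[R]_m => dotv p.1 p.2).
Proof.
rewrite /dotv; apply: measurable_sum => i; apply: measurable_funM.
  by apply: (@measurableT_comp _ _ _ _ _ _ (fun x : 'rV[R]_m => x 0 i)) => //;
    exact: measurable_row_coord.
by apply: (@measurableT_comp _ _ _ _ _ _ (fun x : 'rV[R]_m => x 0 i)) => //;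
  exact: measurable_row_coord.
Qed.

Lemma measurable_cos_dotv :
  measurable_fun setT (fun p : 'rV[R]_m * 'rV[R]_m => cos (dotv p.1 p.2)).
Proof.
apply: measurableT_comp; last exact: measurable_dotv.
by apply: continuous_measurable_fun; exact: continuous_cos.
Qed.

Lemma measurable_sin_dotv :
  measurable_fun setT (fun p : 'rV[R]_m * 'rV[R]_m => sin (dotv p.1 p.2)).
Proof.
apply: measurableT_comp; last exact: measurable_dotv.
by apply: continuous_measurable_fun; exact: continuous_sin.
Qed.

Lemma cos_transform_adjoint f g : rschwartz f -> rschwartz g ->
  \int[mu]_xi (cos_transform f xi * g xi) = \int[mu]_x (f x * cos_transform g x).
Proof.
move=> sf sg.
rewrite (@fubini_kernel (fun p => cos (dotv p.1 p.2)))//; last 4 first.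
- exact: measurable_cos_dotv.
- by move=> p; exact: normr_cos_le1.
- exact: rschwartz_integrable.
- exact: rschwartz_integrable.
apply: eq_Rintegral => x _; rewrite mulrC; congr (_ * _).
by apply: eq_Rintegral => xi _ /=; rewrite dotvC.
Qed.

Lemma sin_transform_adjoint f g : rschwartz f -> rschwartz g ->
  \int[mu]_xi (sin_transform f xi * g xi) = \int[mu]_x (f x * sin_transform g x).
Proof.
move=> sf sg.
rewrite (@fubini_kernel (fun p => sin (dotv p.1 p.2)))//; last 4 first.
- exact: measurable_sin_dotv.
- by move=> p; exact: normr_sin_le1.
- exact: rschwartz_integrable.
- exact: rschwartz_integrable.
apply: eq_Rintegral => x _; rewrite mulrC; congr (_ * _).
by apply: eq_Rintegral => xi _ /=; rewrite dotvC.
Qed.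

End transform_schwartz.

(** * Directional derivatives and Lipschitz bounds *)

Section directional.
Context {R : realType} {m : nat}.
Implicit Types (f g : 'rV[R]_m -> R) (x y v : 'rV[R]_m).

Lemma derive_rpartial f x v : differentiable f x ->
  'D_v f x = \sum_(i < m) v 0 i * rpartial i f x.
Proof.
move=> df; rewrite deriveE// [v in LHS]row_sum_delta linear_sum.
by apply: eq_bigr => i _; rewrite linearZ/= /rpartial deriveE.
Qed.

Lemma is_derive_line f x v (t : R) : (forall y, differentiable f y) ->
  is_derive t 1 (fun t => f (x + t *: v)) (\sum_(i < m) v 0 i * rpartial i f (x + t *: v)).
Proof.
move=> df; rewrite -derive_rpartial//.
have E (h : R) : h *: v + (x + t *: v) = x + (h *: 1 + t) *: v.
  by rewrite [h *: 1]mulr1 scalerDl addrCA.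
have dv : derivable f (x + t *: v) v by exact: diff_derivable.
by apply: DeriveDef; rewrite /derivable /derive; under eq_fun do rewrite /= -E.
Qed.

Lemma rschwartz_lipschitz g : rschwartz g ->
  exists2 C : R, 0 <= C & forall x y, `|g y - g x| <= C * `|y - x|.
Proof.
move=> sg.
have /choice[C gC] i : exists C : R, forall x, `|rpartial i g x| <= C.
  have [C gC] := rschwartz_rapid (rschwartz_rpartial i sg) 0%N.
  by exists C => x; have := gC x; rewrite expr0 mul1r.
have C0 i : 0 <= C i by exact: le_trans (gC i 0).
exists (\sum_i C i); first exact: sumr_ge0.
move=> x y.
have df z : differentiable g z by exact: rsmooth_differentiable (rschwartz_rsmooth sg) z.
have [c _] := mean_value 0 1 (fun t => is_derive_line x (y - x) t df).
rewrite scale1r scale0r addr0 (addrC x) subrK subr0 mulr1 => ->.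
rewrite (le_trans (ler_norm_sum _ _ _))// mulr_suml ler_sum// => i _.
by rewrite normrM mulrC ler_pM// coord_le_norm.
Qed.

Lemma norm_sqr_le_dotv x : `|x| ^+ 2 <= dotv x x.
Proof.
rewrite [`|x|]/Num.Def.normr/=; have [->|/mx_norm_neq0[[i j] ->]] := eqVneq (mx_norm x) 0.
  by rewrite expr0n dotv_ge0.
by rewrite ord1 real_normK ?num_real// sqr_coord_le.
Qed.

End directional.

(** * Gaussians and their transforms *)

Section gaussian.
Context {R : realType} {m : nat}.
Local Notation mu := (lebesgue_row R m).
Implicit Types (f g : 'rV[R]_m -> R) (x y xi : 'rV[R]_m) (s : R).

(** The exponent is scaled as in the normal density of deviation [s], which supplies the total mass;
    the transform then has the same form with [s^-1]. *)
Definition gaussian s x : R := expR (- dotv x x / (s ^+ 2 *+ 2)).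

Lemma gaussian_ge0 s x : 0 <= gaussian s x.
Proof. exact: expR_ge0. Qed.

Lemma gaussian_le1 s x : gaussian s x <= 1.
Proof.
by rewrite /gaussian expR_le1 mulNr oppr_le0 divr_ge0 ?dotv_ge0// mulrn_wge0// sqr_ge0.
Qed.

Lemma gaussian_differentiable s x : differentiable (gaussian s) x.
Proof.
rewrite /gaussian (_ : (fun _ => _) = expR \o
   (- (s ^+ 2 *+ 2)^-1 *: ((fun x : 'rV[R]_m => 1 + dotv x x) - cst 1))); last first.
  apply/funext => y; rewrite [in RHS]/=; congr expR.
  by rewrite -[RHS]/(- (s ^+ 2 *+ 2)^-1 * (1 + dotv y y - 1)); ring.
apply: differentiable_comp; last by apply/derivable1_diffP.
apply: differentiableZ; apply: differentiableB => //.
exact: rsmooth_differentiable rsmooth_weight x.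
Qed.

Lemma rpartial_dotv i x : 'D_('e_i) (fun x => dotv x x) x = 2 * x 0 i.
Proof.
have [h|_ ->] := @differentiable_quadratic _ _ (fun x => dotv x x) x (2 *: x) m%:R.
  rewrite dotvDl !dotvDr dotvZl (dotvC h x) [X in `|X|](_ : _ = dotv h h); last by ring.
  by rewrite expr2 mulrA dotv_le_norm.
by rewrite dotv_delta mxE.
Qed.

Lemma rpartial_gaussian i s : s != 0 ->
  rpartial i (gaussian s) = - s ^- 2 *: ((fun x => x 0 i : R) * gaussian s).
Proof.
move=> s0; apply/funext => x.
pose q x : R := - (s ^+ 2 *+ 2)^-1 * dotv x x.
have dd : differentiable (fun x : 'rV[R]_m => dotv x x) x.
  have [h|//] := @differentiable_quadratic _ _ (fun x => dotv x x) x (2 *: x) m%:R.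
  rewrite dotvDl !dotvDr dotvZl (dotvC h x) [X in `|X|](_ : _ = dotv h h); last by ring.
  by rewrite expr2 mulrA dotv_le_norm.
have dq : differentiable q x by exact: differentiableZ.
have -> : gaussian s = expR \o q.
  by apply/funext => y; rewrite -[RHS]/(expR (q y)) /gaussian /q; congr expR; ring.
rewrite /rpartial deriveE; last by apply: differentiable_comp => //; exact/derivable1_diffP.
rewrite diff_comp//; last exact/derivable1_diffP.
rewrite /= diff1E; last exact/derivable1_diffP.
rewrite derive1E derive_val -deriveE// /q.
have -> : 'D_('e_i) (fun x : 'rV[R]_m => - (s ^+ 2 *+ 2)^-1 * dotv x x) x =
    - (s ^+ 2 *+ 2)^-1 * (2 * x 0 i).
  rewrite -rpartial_dotv; apply: (@deriveZ _ _ _ (fun x => dotv x x)).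
  exact: diff_derivable.
rewrite -[RHS]/(- s ^- 2 * (x 0 i * expR (q x))) -[LHS]/(_ * expR (q x)) mulrA.
by field.
Qed.

(** Polynomial multiples of the Gaussian, generated by the operations that its derivatives bring
    in. *)
Inductive gaussian_span s : ('rV[R]_m -> R) -> Prop :=
| gaussian_span0 : gaussian_span s (gaussian s)
| gaussian_spanM i f : gaussian_span s f -> gaussian_span s ((fun x => x 0 i : R) * f)
| gaussian_spanZ c f : gaussian_span s f -> gaussian_span s (c *: f)
| gaussian_spanD f g : gaussian_span s f -> gaussian_span s g -> gaussian_span s (f + g).

Lemma rapid_gaussian s : s != 0 -> rapid (gaussian s).
Proof.
move=> s0 k; pose a : R := (s ^+ 2 *+ 2)^-1.
have a0 : 0 < a by rewrite invr_gt0 pmulrn_lgt0// exprn_even_gt0.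
(* From [t ^+ k <= k! * expR t] at [t = a * (1 + dotv x x)]; the factor [expR a] makes up for the 1
   in the weight. *)
exists (k`!%:R * a ^- k * expR a) => x.
rewrite ger0_norm ?gaussian_ge0//.
have -> : gaussian s x = expR a / expR (a * (1 + dotv x x)).
  by rewrite -expRB /gaussian -/a; congr expR; ring.
rewrite mulrA ler_pdivrMr ?expR_gt0// [leRHS]mulrAC ler_wpM2r ?expR_ge0//.
rewrite [leRHS]mulrAC ler_pdivlMr ?exprn_gt0// -exprMn mulrC.
by apply: exprn_le_expR; rewrite mulr_ge0 ?(ltW a0) ?(ltW (gt0_dotv x)).
Qed.

Lemma rschwartz_gaussian s : s != 0 -> rschwartz (gaussian s).
Proof.
move=> s0.
have dG f : gaussian_span s f -> forall x, differentiable f x.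
  elim => [x|i {}f _ df x|c {}f _ df x|{}f g _ df _ dg x].
  - exact: gaussian_differentiable.
  - by apply: differentiableM => //; exact: differentiable_coord.
  - exact: differentiableZ.
  - exact: differentiableD.
refine (rschwartz_coind (P := gaussian_span s) _ _ _ (gaussian_span0 s)) => //.
- move=> f i; elim => [|j {}f sf IHf|c {}f sf IHf|{}f g sf IHf sg IHg].
  + by rewrite rpartial_gaussian//; apply: gaussian_spanZ; apply: gaussian_spanM;
      exact: gaussian_span0.
  + rewrite (_ : rpartial i _ = (fun x => x 0 j : R) * rpartial i f + (j == i)%:R *: f).
      by apply: gaussian_spanD; [exact: gaussian_spanM|exact: gaussian_spanZ].
    apply/funext => x; rewrite /rpartial deriveM; last 2 first.
    * exact/diff_derivable/differentiable_coord.
    * exact/diff_derivable/dG.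
    have := congr1 (fun F => F x) (@rpartial_coord R m i j); rewrite /rpartial => ->.
    by rewrite -[RHS]/(x 0 j * _ + _ * f x) /GRing.scale/= [f x * _]mulrC.
  + rewrite (_ : rpartial i _ = c *: rpartial i f); first exact: gaussian_spanZ.
    by apply/funext => x; apply: deriveZ; exact/diff_derivable/dG.
  + rewrite (_ : rpartial i _ = rpartial i f + rpartial i g).
      exact: gaussian_spanD.
    by apply/funext => x; apply: deriveD; exact/diff_derivable/dG.
- move=> f; elim => [|j {}f sf IHf|c {}f sf IHf|{}f g sf IHf sg IHg].
  + exact: rapid_gaussian.
  + by apply: (@rapidM_poly _ _ _ _ 1 1) => // x; rewrite mul1r expr1 coord_le.
  + exact: rapidZ.
  + exact: rapidD.
Qed.

(** Along the ray through [x] the function f(t x) exp(s^2 |x|^2 t^2 / 2) has derivative 0, so its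
    values at t = 0 and t = 1 agree. *)
Lemma gaussian_ode s f : (forall x, differentiable f x) ->
  (forall i x, rpartial i f x = - (s ^+ 2 * x 0 i) * f x) ->
  forall x, f x = f 0 * expR (- (s ^+ 2 * dotv x x) / 2).
Proof.
move=> df fE x.
pose q (t : R) : R := s ^+ 2 * dotv x x / 2 * t ^+ 2.
pose F (t : R) : R := f (0 + t *: x) * expR (q t).
have dF (t : R) : is_derive t 1 F 0.
  have d1 := is_derive_line 0 x t df.
  have dq : is_derive t 1 q (s ^+ 2 * dotv x x * t).
    by apply: is_derive_eq; rewrite /GRing.scale/=; field.
  have d2 : is_derive t 1 (expR \o q) (expR (q t) * (s ^+ 2 * dotv x x * t)).
    exact: is_derive1_comp.
  have := @is_deriveM _ _ _ _ _ _ _ _ d1 d2; move/is_derive_eq; apply.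
  rewrite (_ : \sum_(i < m) _ = - (s ^+ 2 * t * dotv x x) * f (0 + t *: x)); last first.
    rewrite /dotv mulr_sumr -sumrN mulr_suml; apply: eq_bigr => i _.
    by rewrite fE add0r mxE; ring.
  by rewrite /GRing.scale/=; ring.
have [c _] := mean_value 0 1 dF.
rewrite mul0r /F /q scale1r scale0r add0r addr0 expr0n mulr0 expR0 mulr1 expr1n mulr1.
move=> /eqP; rewrite subr_eq0 => /eqP <-.
by rewrite -mulrA -expRD mulNr addrN expR0 mulr1.
Qed.

Lemma prod_normal_pdf s x y : s != 0 ->
  \prod_(i < m) normal_pdf (x 0 i) s (y 0 i) = normal_peak s ^+ m * gaussian s (y - x).
Proof.
move=> s0; under eq_bigr do rewrite normal_pdfE//.
rewrite big_split prodr_const card_ord; congr (_ * _).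
rewrite /normal_fun -expR_sum /gaussian; congr expR.
rewrite /dotv -sumrN mulr_suml; apply: eq_bigr => i _.
by rewrite !mxE expr2.
Qed.

Lemma integrable_prod_normal_pdf s x : s != 0 ->
  mu.-integrable setT (fun y => (\prod_(i < m) normal_pdf (x 0 i) s (y 0 i))%:E).
Proof.
move=> s0; have ge0 (y : 'rV[R]_m) : 0 <= \prod_(i < m) normal_pdf (x 0 i) s (y 0 i).
  by apply: prodr_ge0 => i _; exact: normal_pdf_ge0.
apply/integrableP; split.
  apply/measurable_EFinP; apply: measurable_prod => i _.
  apply: measurableT_comp; first exact: measurable_normal_pdf.
  exact: measurable_row_coord.
under eq_integral do rewrite /= ger0_norm ?ge0//.
by rewrite integral_normal_row// ltry.
Qed.

Lemma gaussianE s x y : s != 0 -> gaussian s (y - x) =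
  normal_peak s ^- m * \prod_(i < m) normal_pdf (x 0 i) s (y 0 i).
Proof.
move=> s0; rewrite prod_normal_pdf// mulKf// expf_neq0// gt_eqF//.
exact: normal_peak_gt0.
Qed.

Lemma integrable_gaussian s x : s != 0 ->
  mu.-integrable setT (fun y => (gaussian s (y - x))%:E).
Proof.
move=> s0; under eq_fun do rewrite gaussianE//.
by apply: integrable_EFinZl; exact: integrable_prod_normal_pdf.
Qed.

Lemma integral_gaussian s x : s != 0 ->
  \int[mu]_y gaussian s (y - x) = normal_peak s ^- m.
Proof.
move=> s0; under eq_Rintegral do rewrite gaussianE//.
rewrite RintegralZl//; last exact: integrable_prod_normal_pdf.
by rewrite /Rintegral integral_normal_row// mulr1.
Qed.

(** Differentiating the transform brings down x_i, and x_i times the Gaussian is -s^2 times its i-th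
    derivative, which integration by parts turns into a factor y_i. So the transform solves the
    equation of [gaussian_ode], and its value at 0 is the total mass. *)
Lemma cos_transform_gaussian s y : s != 0 ->
  cos_transform (gaussian s) y = normal_peak s ^- m * gaussian s^-1 y.
Proof.
move=> s0; have sG := rschwartz_gaussian s0.
have h i x : rpartial i (cos_transform (gaussian s)) x =
    - (s ^+ 2 * x 0 i) * cos_transform (gaussian s) x.
  rewrite rpartial_cos_transform// mulNr -mulrA coord_cos_transform//.
  rewrite rpartial_gaussian// sin_transformZ; last exact: rschwartz_coordM.
  rewrite -[LHS]/(- sin_transform _ x) -[RHS]/(- (s ^+ 2 * - (- s ^- 2 * sin_transform _ x))).
  by congr (- _); field.
rewrite (gaussian_ode (fun x => cos_transform_differentiable x sG) h).
congr (_ * _).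
  rewrite -(@integral_gaussian s 0)//; apply: eq_Rintegral => x _.
  by rewrite subr0 /dotv big1 ?cos0 ?mul1r// => i _; rewrite mxE mulr0.
by rewrite /gaussian; congr expR; field.
Qed.

Lemma sin_transform_gaussian s y : s != 0 -> sin_transform (gaussian s) y = 0.
Proof.
move=> s0; have sG := rschwartz_gaussian s0.
have h i x : rpartial i (sin_transform (gaussian s)) x =
    - (s ^+ 2 * x 0 i) * sin_transform (gaussian s) x.
  rewrite rpartial_sin_transform// mulNr -mulrA coord_sin_transform//.
  rewrite rpartial_gaussian// cos_transformZ; last exact: rschwartz_coordM.
  rewrite -[RHS]/(- (s ^+ 2 * (- s ^- 2 * cos_transform _ x))).
  by field.
rewrite (gaussian_ode (fun x => sin_transform_differentiable x sG) h).
rewrite [X in X * _](_ : _ = 0) ?mul0r// /sin_transform /Rintegral integral0_eq// => x _.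
by rewrite /dotv big1 ?sin0 ?mul0r// => i _; rewrite mxE mulr0.
Qed.

End gaussian.

(** * Fourier inversion by Gaussian regularisation *)

Section inversion.
Context {R : realType} {m : nat}.
Local Notation mu := (lebesgue_row R m).
Implicit Types (f g : 'rV[R]_m -> R) (x y xi : 'rV[R]_m) (s : R).

(** With u = |x|/s, completing a square gives u <= 1 + u^2/4 <= exp(u^2/4). Absorbing this
    exponential widens the Gaussian from [s] to [s * Num.sqrt 2]. *)
Lemma norm_gaussian_le s x : 0 < s ->
  `|x| * gaussian s x <= s * gaussian (s * Num.sqrt 2) x.
Proof.
move=> s0; set u := `|x| / s.
have -> : `|x| = s * u by rewrite /u mulrC divfK// gt_eqF.
have ue : u <= expR (dotv x x / (s ^+ 2 *+ 4)).
  apply: (@le_trans _ _ (1 + u ^+ 2 / 4)).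
    by rewrite -subr_ge0 (_ : _ - _ = (u / 2 - 1) ^+ 2) ?sqr_ge0//; field.
  rewrite (le_trans (expR_ge1Dx _))// ler_expR /u expr_div_n -mulrA -invfM mulr_natr.
  by rewrite ler_wpM2r ?invr_ge0 ?norm_sqr_le_dotv// mulrn_wge0// sqr_ge0.
rewrite -mulrA ler_wpM2l ?(ltW s0)//.
have -> : gaussian (s * Num.sqrt 2) x = expR (dotv x x / (s ^+ 2 *+ 4)) * gaussian s x.
  rewrite /gaussian -expRD exprMn sqr_sqrtr//; congr expR.
  by field; rewrite gt_eqF.
by rewrite ler_wpM2r// gaussian_ge0.
Qed.

Lemma normal_peak_sqrt2 s : 0 < s ->
  normal_peak s / normal_peak (s * Num.sqrt 2) = Num.sqrt 2.
Proof.
move=> s0; rewrite /normal_peak invrK exprMn sqr_sqrtr//.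
have -> : s ^+ 2 * 2 * pi *+ 2 = 2 * (s ^+ 2 * pi *+ 2) by ring.
rewrite sqrtrM// mulrC -mulrA mulfV ?mulr1//.
by rewrite sqrtr_eq0 -ltNge mulrn_wgt0// mulr_gt0 ?pi_gt0// exprn_gt0.
Qed.

(** The normalised Gaussians of width s = 1/(n+1) form an approximate identity. For a [C]-Lipschitz
    [g] the error is at most [C] times the mean of |y - x|, hence at most [C * s * Num.sqrt 2 ^+ m];
    the power of [Num.sqrt 2] is the ratio of the two normalisations. *)
Lemma gaussian_average g x : rschwartz g ->
  (normal_peak n.+1%:R^-1 ^+ m * \int[mu]_y (gaussian n.+1%:R^-1 (y - x) * g y))
    @[n --> \oo] --> g x.
Proof.
move=> sg; have [C C0 gC] := rschwartz_lipschitz sg.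
have cvg0 : (C * Num.sqrt 2 ^+ m * @harmonic R n) @[n --> \oo] --> (0 : R).
  rewrite -(mulr0 (C * Num.sqrt 2 ^+ m)); apply: cvgMr; exact: cvg_harmonic.
apply/cvgrPdist_le => e e0.
have /cvgr0_norm_le/(_ e e0) := cvg0; apply: filterS => n ne.
set s : R := n.+1%:R^-1; have s0 : 0 < s by rewrite invr_gt0.
have sn0 : s != 0 by rewrite gt_eqF.
have p0 : 0 < normal_peak s by exact: normal_peak_gt0.
have G := @integrable_gaussian R m s x sn0.
have Gg : mu.-integrable setT (fun y => (gaussian s (y - x) * g y)%:E).
  have [D gD] := rschwartz_rapid sg 0%N.
  have := integrable_EFinZl D G; apply: le_integrable => //.
    apply/measurable_EFinP; apply: measurable_funM.
      by apply/measurable_EFinP; exact: measurable_int G.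
    by apply: continuous_row_measurable; exact: rschwartz_continuous.
  move=> y _; rewrite /= lee_fin normrM mulrC normrM ler_wpM2r//.
  by have := gD y; rewrite expr0 mul1r => /le_trans; apply; exact: ler_norm.
have Gx : mu.-integrable setT (fun y => (g x * gaussian s (y - x))%:E).
  exact: integrable_EFinZl.
rewrite (_ : _ - _ = normal_peak s ^+ m *
    \int[mu]_y (g x * gaussian s (y - x) - gaussian s (y - x) * g y)); last first.
  rewrite RintegralB// mulrBr RintegralZl// integral_gaussian// mulrCA divff ?mulr1//.
  by rewrite expf_neq0// gt_eqF.
rewrite normrM (ger0_norm (exprn_ge0 _ (ltW p0))).
have D : mu.-integrable setT (EFin \o (fun y => g x * gaussian s (y - x) - gaussian s (y - x) * g y)).
  by rewrite (_ : _ \o _ = (fun y => (g x * gaussian s (y - x))%:E - (gaussian s (y - x) * g y)%:E)%E)//;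
    exact: integrableB.
have s20 : s * Num.sqrt 2 != 0 by rewrite mulf_neq0// sqrtr_eq0 -ltNge.
apply: (@le_trans _ _ (normal_peak s ^+ m *
    \int[mu]_y (C * s * gaussian (s * Num.sqrt 2) (y - x)))).
  rewrite ler_wpM2l ?(exprn_ge0 _ (ltW p0))// (le_trans (le_normr_Rintegral _ D))//.
  apply: le_Rintegral => //.
  - exact: (integrable_norm D).
  - by apply: integrable_EFinZl; exact: integrable_gaussian.
  move=> y _; rewrite (mulrC (g x)) -mulrBr normrM (ger0_norm (gaussian_ge0 _ _)).
  rewrite distrC mulrC (le_trans (ler_wpM2r (gaussian_ge0 _ _) (gC x y)))//.
  by rewrite -!mulrA ler_wpM2l// norm_gaussian_le.
rewrite RintegralZl//; last exact: integrable_gaussian.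
rewrite integral_gaussian// mulrCA -exprVn -exprMn normal_peak_sqrt2//.
apply: le_trans ne; rewrite mulrAC; apply: le_trans (ler_norm _).
by rewrite /harmonic/= -/s.
Qed.

(** Gaussians of growing width are at most 1 and tend to 1 pointwise, so [|g|] is a dominating
    function. *)
Lemma gaussian_regularization g : mu.-integrable setT (EFin \o g) ->
  (\int[mu]_xi (g xi * gaussian n.+1%:R xi)) @[n --> \oo] --> \int[mu]_xi g xi.
Proof.
move=> gi; have mg : measurable_fun setT g by apply/measurable_EFinP; exact: measurable_int gi.
have mG (n : nat) : measurable_fun setT (fun xi => g xi * gaussian n.+1%:R xi).
  apply: measurable_funM => //; apply: continuous_row_measurable.
  by apply: rschwartz_continuous; exact: rschwartz_gaussian.
have [||_ _ h] := @dominated_convergence _ _ _ mu setT measurableT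
  (fun n xi => (g xi * gaussian n.+1%:R xi)%:E) (EFin \o g) (fun xi => `|g xi|%:E)
  (fun n => (measurable_EFinP _ _).2 (mG n)) ((measurable_EFinP _ _).2 mg)
  _ (integrable_norm gi) _.
- apply: aeW => /= xi.
  move=> _; apply/fine_cvgP; split; first exact: nearW.
  suff : (g xi * gaussian n.+1%:R xi) @[n --> \oo] --> g xi * 1 by rewrite mulr1.
  apply: cvgMr.
  apply: (@squeeze_cvgr _ _ _ _ (fun n => 1 - dotv xi xi * harmonic n) (cst 1)).
  - near=> n; rewrite gaussian_le1 andbT (le_trans _ (expR_ge1Dx _))//.
    rewrite lerD2l mulNr lerN2 ler_wpM2l ?dotv_ge0// /harmonic/=.
    have : 1 <= n.+1%:R :> R by rewrite ler1n.
    move: (n.+1%:R : R) => t t1.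
    rewrite lef_pV2 ?posrE ?mulrn_wgt0 ?exprn_gt0 ?(lt_le_trans ltr01)//.
    by rewrite mulr2n; nra.
  - rewrite -[X in _ --> X]subr0 -(mulr0 (dotv xi xi)); apply: cvgB.
      exact: cvg_cst.
    apply: cvgMr; exact: cvg_harmonic.
  - exact: cvg_cst.
- apply: aeW => xi n _; rewrite lee_fin normrM ler_piMr//.
  by rewrite ger0_norm ?gaussian_ge0 ?gaussian_le1.
- apply: fine_cvg; rewrite fineK; first exact: h.
  exact: (integrable_fin_num measurableT gi).
Unshelve. all: by end_near. Qed.

Lemma cos_shift_transform g x xi : rschwartz g ->
  \int[mu]_y (cos (dotv (y - x) xi) * g y) =
  cos (dotv x xi) * cos_transform g xi + sin (dotv x xi) * sin_transform g xi.
Proof.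
move=> sg; have ci := integrable_cos xi sg; have si := integrable_sin xi sg.
rewrite -!RintegralZl// -RintegralD//; try exact: integrable_EFinZl.
apply: eq_Rintegral => y _; rewrite -scaleN1r dotvDl dotvZl mulN1r cosB; ring.
Qed.

Lemma sin_shift_transform g x xi : rschwartz g ->
  \int[mu]_y (sin (dotv (y - x) xi) * g y) =
  cos (dotv x xi) * sin_transform g xi - sin (dotv x xi) * cos_transform g xi.
Proof.
move=> sg; have ci := integrable_cos xi sg; have si := integrable_sin xi sg.
rewrite -!RintegralZl// -RintegralB//; try exact: integrable_EFinZl.
apply: eq_Rintegral => y _; rewrite -scaleN1r dotvDl dotvZl mulN1r sinB; ring.
Qed.

Lemma integrable_shift_transform (b : bool) g x : rschwartz g ->
  mu.-integrable setT (fun xi =>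
    (\int[mu]_y ((if b then cos else sin) (dotv (y - x) xi) * g y))%:E).
Proof.
move=> sg.
have cx h : rschwartz h -> mu.-integrable setT (fun xi => (cos (dotv x xi) * h xi)%:E).
  by move=> sh; under eq_fun do rewrite dotvC; exact: integrable_cos.
have sx h : rschwartz h -> mu.-integrable setT (fun xi => (sin (dotv x xi) * h xi)%:E).
  by move=> sh; under eq_fun do rewrite dotvC; exact: integrable_sin.
have sC := rschwartz_cos_transform sg; have sS := rschwartz_sin_transform sg.
case: b.
- under eq_fun do rewrite cos_shift_transform// EFinD.
  by apply: integrableD => //; [exact: cx|exact: sx].
- under eq_fun do rewrite sin_shift_transform// EFinB.
  by apply: integrableB => //; [exact: cx|exact: sx].
Qed.

(** The Boolean selects cosine or sine. Exchanging the integrals lets the kernel act on the Gaussian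
    first, where its effect is known in closed form. *)
Lemma regularized_kernel (b : bool) g x s : s != 0 -> rschwartz g ->
  \int[mu]_xi ((\int[mu]_y ((if b then cos else sin) (dotv (y - x) xi) * g y)) * gaussian s xi) =
  \int[mu]_y ((if b then cos_transform (gaussian s) (y - x)
               else sin_transform (gaussian s) (y - x)) * g y).
Proof.
move=> s0 sg.
rewrite (@fubini_kernel _ _ (fun p => (if b then cos else sin) (dotv (p.1 - x) p.2)))//.
- apply: eq_Rintegral => y _; congr (_ * _); case: b;
    by apply: eq_Rintegral => xi _; rewrite /= dotvC.
- rewrite (_ : (fun _ => _) = (if b then cos else sin) \o
      (fun p : 'rV[R]_m * 'rV[R]_m => dotv p.1 p.2 - dotv x p.2)); last first.
    by apply/funext => p /=; rewrite -scaleN1r dotvDl dotvZl mulN1r.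
  apply: measurableT_comp.
    by case: b; apply: continuous_measurable_fun; [exact: continuous_cos|exact: continuous_sin].
  apply: measurable_funB; first exact: measurable_dotv.
  apply: (@measurableT_comp _ _ _ _ _ _ (dotv x)) => //.
  by apply: continuous_row_measurable; exact: dotv_continuous.
- by move=> p; case: b; [exact: normr_cos_le1|exact: normr_sin_le1].
- exact: rschwartz_integrable.
- by apply: rschwartz_integrable; exact: rschwartz_gaussian.
Qed.

(** The source of the factor [(2 * pi) ^+ m] in the inversion formula. *)
Lemma normal_peakV s : 0 < s -> (normal_peak s)^-1 = 2 * pi * normal_peak s^-1.
Proof.
move=> s0; rewrite /normal_peak invrK.
have p0 : 0 < pi :> R by exact: pi_gt0.
have E (t : R) : 0 < t -> Num.sqrt (t ^+ 2 * pi *+ 2) = t * Num.sqrt (2 * pi).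
  move=> t0; rewrite (_ : _ *+ 2 = t ^+ 2 * (2 * pi)); last by ring.
  by rewrite sqrtrM ?sqr_ge0// sqrtr_sqr gtr0_norm.
rewrite !E ?invr_gt0//.
have q0 : 0 < 2 * pi :> R by rewrite mulr_gt0.
have : Num.sqrt (2 * pi) ^+ 2 = 2 * pi :> R by exact: sqr_sqrtr (ltW q0).
have : Num.sqrt (2 * pi) != 0 :> R by rewrite sqrtr_eq0 -ltNge.
move: (Num.sqrt _) => q qn0 <-.
by field; rewrite qn0 gt_eqF.
Qed.

(** By the addition formula the left side is the iterated integral of cos((y - x) . xi) g(y), first
    in y and then in xi. With a Gaussian factor in xi the order can be exchanged, which gives (2
    pi)^m times a Gaussian average of [g]. Letting the width grow, the two evaluations of the limit
    must coincide. *)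
Lemma cos_inversion g x : rschwartz g ->
  cos_transform (cos_transform g) x + sin_transform (sin_transform g) x =
  (2 * pi) ^+ m * g x.
Proof.
move=> sg.
have sC := rschwartz_cos_transform sg; have sS := rschwartz_sin_transform sg.
transitivity (\int[mu]_xi (\int[mu]_y (cos (dotv (y - x) xi) * g y))).
  rewrite -RintegralD//; [|exact: integrable_cos|exact: integrable_sin].
  by apply: eq_Rintegral => xi _; rewrite cos_shift_transform// (dotvC x).
have h1 := gaussian_regularization (integrable_shift_transform true x sg).
apply: (@cvg_unique R (@Rhausdorff R) _ _ _ _ h1).
have h2 : ((2 * pi) ^+ m * (normal_peak n.+1%:R^-1 ^+ m *
   \int[mu]_y (gaussian n.+1%:R^-1 (y - x) * g y))) @[n --> \oo] --> (2 * pi) ^+ m * g x.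
  by apply: cvgMr; exact: gaussian_average.
apply: cvg_trans h2; apply: near_eq_cvg; near=> n.
rewrite (@regularized_kernel true)//=.
rewrite mulrA -exprMn -normal_peakV// -RintegralZl//.
  apply: eq_Rintegral => y _; rewrite cos_transform_gaussian//.
  by rewrite mulrA exprVn.
have sG : (n.+1%:R : R) != 0 by [].
have := rschwartz_integrable sg; apply: le_integrable => //.
  apply/measurable_EFinP; apply: measurable_funM.
    apply/measurable_EFinP; apply: measurable_int; apply: integrable_gaussian.
    by rewrite invr_neq0.
  by apply: continuous_row_measurable; exact: rschwartz_continuous.
by move=> y _; rewrite /= lee_fin normrM ler_piMl// ger0_norm ?gaussian_ge0 ?gaussian_le1.
Unshelve. all: by end_near. Qed.

(** The odd counterpart of [cos_inversion]: here all regularised integrals are 0, because a Gaussian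
    has zero sine transform. *)
Lemma sin_inversion g x : rschwartz g ->
  cos_transform (sin_transform g) x = sin_transform (cos_transform g) x.
Proof.
move=> sg.
have sC := rschwartz_cos_transform sg; have sS := rschwartz_sin_transform sg.
apply/eqP; rewrite -subr_eq0; apply/eqP.
transitivity (\int[mu]_xi (\int[mu]_y (sin (dotv (y - x) xi) * g y))).
  rewrite -RintegralB//; [|exact: integrable_cos|exact: integrable_sin].
  by apply: eq_Rintegral => xi _; rewrite sin_shift_transform// (dotvC x).
have h1 := gaussian_regularization (integrable_shift_transform false x sg).
apply: (@cvg_unique R (@Rhausdorff R) _ _ _ _ h1).
apply: cvg_near_cst; near=> n.
rewrite (@regularized_kernel false)//= /Rintegral integral0_eq// => y _.
by rewrite sin_transform_gaussian// mul0r.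
Unshelve. all: by end_near. Qed.

End inversion.

(** * The complex Fourier transform on Schwartz functions *)

Section complex_fourier.
Context {R : realType} {m : nat}.
Local Notation mu := (lebesgue_row R m).
Local Notation cRe := (@complex.Re R).
Local Notation cIm := (@complex.Im R).
Implicit Types (f g : 'rV[R]_m -> R[i]) (x xi : 'rV[R]_m).

Let k : R := Num.sqrt (2 * pi) ^- m.

Lemma Re_fourier f : schwartz f -> cRe \o fourier f =
  k *: (cos_transform (cRe \o f) + sin_transform (cIm \o f)).
Proof.
move=> /schwartzP[sr si]; apply/funext => xi.
rewrite -[RHS]/(k * (cos_transform _ xi + sin_transform _ xi)) /fourier /cintegral /=.
rewrite mul0r subr0 -/k -RintegralD//; [|exact: integrable_cos|exact: integrable_sin].
congr (_ * _); apply: eq_Rintegral => x _ /=.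
by case: (f x) => a b /=; rewrite mulNr opprK.
Qed.

Lemma Im_fourier f : schwartz f -> cIm \o fourier f =
  k *: (cos_transform (cIm \o f) - sin_transform (cRe \o f)).
Proof.
move=> /schwartzP[sr si]; apply/funext => xi.
rewrite -[RHS]/(k * (cos_transform _ xi - sin_transform _ xi)) /fourier /cintegral /=.
rewrite mul0r addr0 -/k -RintegralB//; [|exact: integrable_cos|exact: integrable_sin].
congr (_ * _); apply: eq_Rintegral => x _ /=.
by case: (f x) => a b /=; rewrite mulNr.
Qed.

Lemma schwartz_fourier f : schwartz f -> schwartz (fourier f).
Proof.
move=> sf; have /schwartzP[sr si] := sf; apply/schwartzP.
rewrite Re_fourier// Im_fourier//; split; apply: rschwartzZ; apply: rschwartzD;
  try apply: rschwartzN; by [exact: rschwartz_cos_transform|exact: rschwartz_sin_transform].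
Qed.

Lemma fourier_surjective f : schwartz f -> exists2 g, schwartz g & fourier g = f.
Proof.
move=> /schwartzP[sa sb]; set a := cRe \o f in sa; set b := cIm \o f in sb.
have sCa := rschwartz_cos_transform sa; have sSa := rschwartz_sin_transform sa.
have sCb := rschwartz_cos_transform sb; have sSb := rschwartz_sin_transform sb.
(* [p + i q] is the inverse transform of [a + i b], that is, the normalised integral with kernel
   exp(+ i x . xi). *)
pose p := k *: (cos_transform a - sin_transform b).
pose q := k *: (cos_transform b + sin_transform a).
have sSb' : rschwartz (- sin_transform b) by exact: rschwartzN.
have sg : schwartz (fun x => (p x +i* q x)%C).
  by apply/schwartzP; split; apply: rschwartzZ; exact: rschwartzD.
exists (fun x => (p x +i* q x)%C) => //.
have k2 : k * k * (2 * pi) ^+ m = 1.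
  rewrite /k -expr2 -exprVn -exprM mulnC exprM -exprMn exprVn sqr_sqrtr.
    by rewrite mulVf ?expr1n// gt_eqF// mulr_gt0// pi_gt0.
  by rewrite mulr_ge0// pi_ge0.
have Cp : cos_transform p = k *: (cos_transform (cos_transform a) - cos_transform (sin_transform b)).
  rewrite /p cos_transformZ ?cos_transformD//; last exact: rschwartzD.
  by rewrite -[in LHS]scaleN1r cos_transformZ// scaleN1r.
have Sp : sin_transform p = k *: (sin_transform (cos_transform a) - sin_transform (sin_transform b)).
  rewrite /p sin_transformZ ?sin_transformD//; last exact: rschwartzD.
  by rewrite -[in LHS]scaleN1r sin_transformZ// scaleN1r.
have Cq : cos_transform q = k *: (cos_transform (cos_transform b) + cos_transform (sin_transform a)).
  by rewrite /q cos_transformZ ?cos_transformD//; exact: rschwartzD.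
have Sq : sin_transform q = k *: (sin_transform (cos_transform b) + sin_transform (sin_transform a)).
  by rewrite /q sin_transformZ ?sin_transformD//; exact: rschwartzD.
apply/funext => x; apply/eqP; rewrite eq_complex; apply/andP; split; apply/eqP.
- rewrite -[LHS]/((cRe \o fourier _) x) Re_fourier// -[RHS]/(a x).
  rewrite -[LHS]/(k * (cos_transform p x + sin_transform q x)) Cp Sq.
  rewrite -[LHS]/(k * (k * (cos_transform (cos_transform a) x - cos_transform (sin_transform b) x) +
    k * (sin_transform (cos_transform b) x + sin_transform (sin_transform a) x))).
  rewrite sin_inversion// -[RHS]mul1r -k2 -mulrA -cos_inversion//; ring.
- rewrite -[LHS]/((cIm \o fourier _) x) Im_fourier// -[RHS]/(b x).
  rewrite -[LHS]/(k * (cos_transform q x - sin_transform p x)) Cq Sp.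
  rewrite -[LHS]/(k * (k * (cos_transform (cos_transform b) x + cos_transform (sin_transform a) x) -
    k * (sin_transform (cos_transform a) x - sin_transform (sin_transform b) x))).
  rewrite sin_inversion// -[RHS]mul1r -k2 -mulrA -cos_inversion//; ring.
Qed.

Lemma rschwartz_mul_integrable (f g : 'rV[R]_m -> R) : rschwartz f -> rschwartz g ->
  mu.-integrable setT (fun x => (f x * g x)%:E).
Proof.
move=> sf sg; have [C fC] := rschwartz_rapid sf 0%N.
apply: (@integrable_rapid _ _ (f * g)).
  by move=> x; apply: continuousM; exact: rschwartz_continuous.
apply: (@rapidM_poly _ _ _ _ 0 C); last exact: rschwartz_rapid.
by move=> x; rewrite expr0 mulr1; have := fC x; rewrite expr0 mul1r.
Qed.

Lemma fourier_adjoint f g : schwartz f -> schwartz g ->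
  cintegral (fun x => f x * fourier g x) = cintegral (fun x => fourier f x * g x).
Proof.
move=> sf sg; have /schwartzP[sa sb] := sf; have /schwartzP[sp sq] := sg.
have rF := Re_fourier sf; have iF := Im_fourier sf.
have rG := Re_fourier sg; have iG := Im_fourier sg.
move: rF iF rG iG sa sb sp sq.
set a := cRe \o f; set b := cIm \o f; set p := cRe \o g; set q := cIm \o g.
move=> rF iF rG iG sa sb sp sq.
have rf x : cRe (fourier f x) = k * (cos_transform a x + sin_transform b x).
  exact: (congr1 (fun F => F x) rF).
have if_ x : cIm (fourier f x) = k * (cos_transform b x - sin_transform a x).
  exact: (congr1 (fun F => F x) iF).
have rg x : cRe (fourier g x) = k * (cos_transform p x + sin_transform q x).
  exact: (congr1 (fun F => F x) rG).
have ig x : cIm (fourier g x) = k * (cos_transform q x - sin_transform p x).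
  exact: (congr1 (fun F => F x) iG).
have ReM (z w : R[i]) : cRe (z * w) = cRe z * cRe w - cIm z * cIm w by case: z w => ? ? [].
have ImM (z w : R[i]) : cIm (z * w) = cRe z * cIm w + cIm z * cRe w by case: z w => ? ? [].
(* The real and the imaginary part of either pairing is a combination of four real integrals, to
   which the adjointness of the cosine and sine transforms applies term by term. *)
have I4 (f1 g1 f2 g2 f3 g3 f4 g4 : 'rV[R]_m -> R) (e1 e2 e3 e4 : R) :
  rschwartz f1 -> rschwartz g1 -> rschwartz f2 -> rschwartz g2 ->
  rschwartz f3 -> rschwartz g3 -> rschwartz f4 -> rschwartz g4 ->
  \int[mu]_x (e1 * (f1 x * g1 x) + e2 * (f2 x * g2 x) + e3 * (f3 x * g3 x) + e4 * (f4 x * g4 x)) =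
  e1 * \int[mu]_x (f1 x * g1 x) + e2 * \int[mu]_x (f2 x * g2 x) +
  e3 * \int[mu]_x (f3 x * g3 x) + e4 * \int[mu]_x (f4 x * g4 x).
  move=> sf1 sg1 sf2 sg2 sf3 sg3 sf4 sg4.
  have i1 := rschwartz_mul_integrable sf1 sg1; have i2 := rschwartz_mul_integrable sf2 sg2.
  have i3 := rschwartz_mul_integrable sf3 sg3; have i4 := rschwartz_mul_integrable sf4 sg4.
  have j1 := integrable_EFinZl e1 i1; have j2 := integrable_EFinZl e2 i2.
  have j3 := integrable_EFinZl e3 i3; have j4 := integrable_EFinZl e4 i4.
  have j12 : mu.-integrable setT (fun x => (e1 * (f1 x * g1 x) + e2 * (f2 x * g2 x))%:E).
    by under eq_fun do rewrite EFinD; exact: integrableD.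
  have j123 : mu.-integrable setT (fun x => (e1 * (f1 x * g1 x) + e2 * (f2 x * g2 x) + e3 * (f3 x * g3 x))%:E).
    by under eq_fun do rewrite EFinD; exact: integrableD.
  by rewrite !RintegralD// !RintegralZl.
have [Ca Sa] := (rschwartz_cos_transform sa, rschwartz_sin_transform sa).
have [Cb Sb] := (rschwartz_cos_transform sb, rschwartz_sin_transform sb).
have [Cp Sp] := (rschwartz_cos_transform sp, rschwartz_sin_transform sp).
have [Cq Sq] := (rschwartz_cos_transform sq, rschwartz_sin_transform sq).
have adj := (@cos_transform_adjoint R m, @sin_transform_adjoint R m).
rewrite /cintegral; congr (_ +i* _)%C.
- transitivity (\int[mu]_x (k * (a x * cos_transform p x) + k * (a x * sin_transform q x) +
      (- k) * (b x * cos_transform q x) + k * (b x * sin_transform p x))).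
    apply: eq_Rintegral => x _; rewrite ReM rg ig -/(a x) -/(b x); ring.
  rewrite I4// -!adj// -I4//; apply: eq_Rintegral => x _.
  rewrite ReM rf if_ -/(p x) -/(q x); ring.
- transitivity (\int[mu]_x (k * (a x * cos_transform q x) + (- k) * (a x * sin_transform p x) +
      k * (b x * cos_transform p x) + k * (b x * sin_transform q x))).
    apply: eq_Rintegral => x _; rewrite ImM rg ig -/(a x) -/(b x); ring.
  rewrite I4// -!adj// -I4//; apply: eq_Rintegral => x _.
  rewrite ImM rf if_ -/(p x) -/(q x); ring.
Qed.

End complex_fourier.

(** * Test functions determine a locally integrable function *)

Section test_functions.
Context {R : realType} {m : nat}.
Local Notation mu := (lebesgue_row R m).
Implicit Types (h phi : 'rV[R]_m -> R) (lo hi x : 'rV[R]_m).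

Definition locally_integrable h := forall K, compact K ->
  mu.-integrable K (EFin \o h).

Definition closed_box lo hi : set 'rV[R]_m :=
  [set x | forall i, x 0 i \in `[lo 0 i, hi 0 i]].

Lemma compact_closed_box lo hi : compact (closed_box lo hi).
Proof.
by apply: (@rV_compact _ _ (fun i => `[lo 0 i, hi 0 i]%classic)) => i;
  exact: segment_compact.
Qed.

Lemma box_closed_box lo hi : box lo hi `<=` closed_box lo hi.
Proof.
by move=> x xb i; rewrite in_itv/=; have /andP[/ltW -> /ltW ->] := xb i.
Qed.

Lemma integrable_box h lo hi : locally_integrable h ->
  mu.-integrable (box lo hi) (EFin \o h).
Proof.
move=> hl; apply: (integrableS _ _ _ (hl _ (@compact_closed_box lo hi))).
- exact: compact_row_measurable (@compact_closed_box lo hi).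
- exact: measurable_box.
- exact: box_closed_box.
Qed.

Lemma locally_integrable_measurable h : locally_integrable h -> measurable_fun setT h.
Proof.
move=> hl; rewrite -bigcup_nbox; apply/measurable_fun_bigcup.
  by move=> n; exact: measurable_box.
by move=> n; apply/measurable_EFinP; exact: measurable_int (integrable_box _ _ hl).
Qed.

Lemma locally_integrable_mul h phi K : locally_integrable h -> compact K ->
  continuous phi -> (forall x, ~ K x -> phi x = 0) ->
  mu.-integrable setT (fun x => (h x * phi x)%:E).
Proof.
move=> hl cK cphi phi0; have mK := compact_row_measurable cK.
have cpt : compact (phi @` K).
  by apply: continuous_compact => //; exact: continuous_subspaceT.
have [M [_ /(_ (M + 1))]] := compact_bounded cpt.
rewrite ltrDl ltr01 => /(_ erefl) KM.
have mh := locally_integrable_measurable hl.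
have hK : mu.-integrable setT (EFin \o (h \_ K)).
  by rewrite -restrict_EFin; apply/(integrable_mkcond _ mK); exact: hl.
have := integrable_EFinZl (M + 1) hK; apply: le_integrable => //.
  apply/measurable_EFinP; apply: measurable_funM => //.
  exact: continuous_row_measurable.
move=> x _; rewrite /= lee_fin patchE; have [xK|xK] := boolP (x \in K); last first.
  by rewrite phi0 ?mulr0 ?normr0// => Kx; rewrite mem_set in xK.
rewrite !normrM mulrC ler_wpM2r//; apply: le_trans (ler_norm _).
by apply: KM; exists x => //; exact: set_mem.
Qed.

Definition test_zero h := forall phi K, rsmooth phi -> compact K ->
  (forall x, ~ K x -> phi x = 0) -> \int[mu]_x (h x * phi x) = 0.

(** The bumps converge to the indicator of the box and stay below that of the closed box, on which
    [|h|] is integrable; dominated convergence concludes. *)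
Lemma test_zero_box h lo hi : locally_integrable h -> test_zero h ->
  (\int[mu]_(x in box lo hi) (h x)%:E = 0)%E.
Proof.
move=> hl h0; have mh := locally_integrable_measurable hl.
have cK := @compact_closed_box lo hi; have mK := compact_row_measurable cK.
have hK : mu.-integrable setT (EFin \o (h \_ (closed_box lo hi))).
  by rewrite -restrict_EFin; apply/(integrable_mkcond _ mK); exact: hl.
pose f n x := (h x * box_bump n%:R lo hi x)%:E.
have bo n x : ~ closed_box lo hi x -> box_bump n%:R lo hi x = 0.
  by move=> xc; apply: box_bump_eq0 => // /box_closed_box.
have fi n : mu.-integrable setT (f n).
  apply: (locally_integrable_mul hl cK); last exact: bo.
  by apply: rsmooth_continuous; exact: rsmooth_box_bump.
have [|||_ _ cv] := @dominated_convergence _ _ _ mu setT measurableT f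
  (EFin \o (h \_ (box lo hi))) (fun x => `|(h \_ (closed_box lo hi)) x|%:E)
  (fun n => measurable_int _ (fi n)) _ _ (integrable_norm hK) _.
- apply/measurable_EFinP; apply/(measurable_restrictT _ _).1; first exact: measurable_box.
  exact: measurable_funTS.
- apply: aeW => x _; apply/fine_cvgP; split; first exact: nearW.
  have -> : (h \_ (box lo hi)) x = h x * \1_(box lo hi) x.
    by rewrite patchE indicE; case: ifP; rewrite (mulr1, mulr0).
  by apply: cvgMr; exact: cvg_box_bump.
- apply: aeW => x n _; rewrite /f lee_fin patchE.
  have [xK|xK] := boolP (x \in closed_box lo hi); last first.
    by rewrite bo ?mulr0 ?normr0// => Kx; rewrite mem_set in xK.
  by rewrite normrM ler_piMr// ger0_norm ?box_bump_ge0 ?box_bump_le1.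
rewrite integral_mkcond restrict_EFin.
move: cv; rewrite (_ : [sequence _]_n = cst 0%E).
  by move=> /(cvg_unique (@ereal_hausdorff R)) => /(_ _ (cvg_cst _)).
apply/funext => n /=; rewrite -(fineK (integrable_fin_num measurableT (fi n))).
congr EFin; apply: (h0 (box_bump n%:R lo hi) (closed_box lo hi)) => //.
  exact: rsmooth_box_bump.
exact: bo.
Qed.

(** Dynkin's argument from boxes to all measurable sets. The intersection with a bounded box keeps
    [h] integrable, so that the signed integral is additive on complements and countable disjoint
    unions. *)
Lemma test_zero_nbox h n A : locally_integrable h -> test_zero h -> measurable A ->
  (\int[mu]_(x in A `&` nbox n) (h x)%:E = 0)%E.
Proof.
move=> hl h0; rewrite [X in X A -> _]measurable_boxes.
have mB : measurable (nbox n : set 'rV[R]_m) by exact: measurable_box.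
have hB : mu.-integrable (nbox n) (EFin \o h) by exact: integrable_box.
have mh := locally_integrable_measurable hl.
have B0 : (\int[mu]_(x in nbox n) (h x)%:E = 0)%E by exact: test_zero_box.
move: A; apply: (dynkin_induction (P := fun A => (\int[mu]_(x in A `&` nbox n) (h x)%:E = 0)%E)).
- exact: measurable_boxes.
- exact: boxes_setI.
- by rewrite setTI.
- move=> _ [lo [hi ->]].
  have [lo' [hi' ->]] : boxes (box lo hi `&` nbox n : set 'rV[R]_m).
    by apply: boxes_setI; [exists lo, hi|exists (const_mx (- n%:R)), (const_mx n%:R)].
  exact: test_zero_box.
- move=> S mS S0.
  move: B0; rewrite -[X in (\int[mu]_(x in X) _)%E](setIidr (@subsetT _ (nbox n))).
  rewrite -(setUv S) setIUl integral_setU//.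
  + by rewrite S0 add0e.
  + exact: measurableI.
  + by apply: measurableI => //; exact: measurableC.
  + by apply/measurable_EFinP; exact: measurable_funTS.
  + by apply/disj_setPS => x [[Sx _] [nSx _]].
- move=> F mF tF F0; rewrite setI_bigcupl integral_bigcup.
  + by rewrite eseries0// => i _ _; exact: F0.
  + by apply/trivIsetP => i j _ _ ij; rewrite setIACA setIid;
      move/trivIsetP : tF => /(_ _ _ I I ij) ->; rewrite set0I.
  + by move=> k; exact: measurableI.
  + apply: (integrableS _ _ _ hB) => //.
      by apply: bigcupT_measurable => k; exact: measurableI.
    by move=> x [k _ []].
Qed.

(** The fundamental lemma of the calculus of variations, on which the uniqueness of Fourier
    densities rests. *)
Lemma test_zero_ae h : locally_integrable h -> test_zero h ->
  {ae mu, forall x, h x = 0}.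
Proof.
move=> hl h0.
have hn n : ae_eq mu (nbox n) (EFin \o h) (cst 0%E).
  apply: integral_ae_eq.
  - exact: measurable_box.
  - exact: integrable_box.
  - exact: measurable_cst.
  - move=> E EB mE; rewrite integral0 -(setIidl EB).
    exact: test_zero_nbox.
have : {ae mu, forall x n, nbox n x -> (h x)%:E = 0%E}.
  by apply/ae_foralln => n; exact: hn.
apply: filterS => x hx.
have : [set: 'rV[R]_m] x by []. rewrite -bigcup_nbox => -[n _ xn].
by have [] := hx n xn.
Qed.

End test_functions.

Section integrable_EFin.
Context d (T : measurableType d) (R : realType) (mu : {measure set T -> \bar R}).
Implicit Types f g : T -> R.

Lemma integrable_EFinD f g : mu.-integrable setT (EFin \o f) ->
  mu.-integrable setT (EFin \o g) -> mu.-integrable setT (fun x => (f x + g x)%:E).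
Proof. by move=> fi gi; exact: (integrableD measurableT fi gi). Qed.

Lemma integrable_EFinB f g : mu.-integrable setT (EFin \o f) ->
  mu.-integrable setT (EFin \o g) -> mu.-integrable setT (fun x => (f x - g x)%:E).
Proof. by move=> fi gi; exact: (integrableB measurableT fi gi). Qed.

End integrable_EFin.

(** * Distributions and Sobolev spaces *)

Section complex_integral.
Context {R : realType} {m : nat}.
Local Notation mu := (lebesgue_row R m).
Local Notation cRe := (@complex.Re R).
Local Notation cIm := (@complex.Im R).
Local Notation cabs := (@ComplexField.Normc.normc R).
Implicit Types (f g : 'rV[R]_m -> R[i]) (x xi : 'rV[R]_m) (c : R[i]).

Lemma ReM (z w : R[i]) : cRe (z * w) = cRe z * cRe w - cIm z * cIm w.
Proof. by case: z w => ? ? []. Qed.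

Lemma ImM (z w : R[i]) : cIm (z * w) = cRe z * cIm w + cIm z * cRe w.
Proof. by case: z w => ? ? []. Qed.

Lemma ReD (z w : R[i]) : cRe (z + w) = cRe z + cRe w.
Proof. by case: z w => ? ? []. Qed.

Lemma ImD (z w : R[i]) : cIm (z + w) = cIm z + cIm w.
Proof. by case: z w => ? ? []. Qed.

Definition cintegrable f := mu.-integrable setT (EFin \o (cRe \o f)) /\
  mu.-integrable setT (EFin \o (cIm \o f)).

Lemma cintegral_lin c f g : cintegrable f -> cintegrable g ->
  cintegral (fun x => c * f x + g x) = c * cintegral f + cintegral g.
Proof.
move=> [fr fi] [gr gi]; apply/eqP; rewrite eq_complex /cintegral.
rewrite ReD ReM ImD ImM /=.
have Z (r : R) (h : 'rV[R]_m -> R) : mu.-integrable setT (EFin \o h) ->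
  mu.-integrable setT (fun x => (r * h x)%:E) by exact: integrable_EFinZl.
apply/andP; split; apply/eqP.
- rewrite -!RintegralZl//.
  rewrite -RintegralB//; [|exact: Z|exact: Z].
  rewrite -RintegralD//; last first.
    by apply: integrable_EFinB; exact: Z.
  by apply: eq_Rintegral => x _; rewrite ReD ReM.
- rewrite -!RintegralZl//.
  rewrite -RintegralD//; [|exact: Z|exact: Z].
  rewrite -RintegralD//; last first.
    by apply: integrable_EFinD; exact: Z.
  by apply: eq_Rintegral => x _; rewrite ImD ImM.
Qed.

Lemma schwartz_mul_cintegrable f g : schwartz f -> schwartz g ->
  cintegrable (fun x => f x * g x).
Proof.
move=> /schwartzP[fr fi] /schwartzP[gr gi]; split.
- rewrite (_ : _ \o _ = (fun x => (cRe (f x) * cRe (g x))%:E - (cIm (f x) * cIm (g x))%:E)%E).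
    by apply: integrableB => //; exact: rschwartz_mul_integrable.
  by apply/funext => x /=; rewrite ReM.
- rewrite (_ : _ \o _ = (fun x => (cRe (f x) * cIm (g x))%:E + (cIm (f x) * cRe (g x))%:E)%E).
    by apply: integrableD => //; exact: rschwartz_mul_integrable.
  by apply/funext => x /=; rewrite ImM.
Qed.

Lemma schwartzE u f : schwartz f -> patch (fun=> 0) (@schwartz R m) u f = u f :> R[i].
Proof. by move=> sf; rewrite /patch mem_set. Qed.

Lemma distr_ofE f g : schwartz g -> distr_of f g = cintegral (fun x => f x * g x).
Proof. exact: schwartzE. Qed.

Lemma distr_of_out f g : ~ schwartz g -> distr_of f g = 0.
Proof.
by move=> ng; rewrite /distr_of /patch memNset.
Qed.

Lemma distr_of_lin c f g : schwartz f -> schwartz g ->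
  distr_of (c *: f + g) = c *: distr_of f + distr_of g.
Proof.
move=> sf sg; apply/funext => h; rewrite -[RHS]/(c * distr_of f h + distr_of g h).
have [sh|nsh] := pselect (schwartz h); last first.
  by rewrite !distr_of_out// mulr0 addr0.
rewrite !distr_ofE// -cintegral_lin; [|exact: schwartz_mul_cintegrable..].
by congr cintegral; apply/funext => x; rewrite mulrA -mulrDl.
Qed.

Lemma schwartz_sup f (x : 'rV[R]_m) : schwartz f ->
  cabs (f x) <= fine (schwartz_seminorm 0 f).
Proof.
move=> sf; have := (schwartz_seminorm_le 0 f (fine (schwartz_seminorm 0 f))).2.
rewrite fineK ?schwartz_seminorm_fin// => /(_ (lexx _) [::] x erefl).
by rewrite expr0 mul1r.
Qed.

Lemma tempered_distr_of f : schwartz f -> tempered (distr_of f).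
Proof.
move=> sf; split.
- move=> c g h sg sh; rewrite !distr_ofE//; last exact: schwartz_lin.
  rewrite -cintegral_lin; [|exact: schwartz_mul_cintegrable..].
  by congr cintegral; apply/funext => x; rewrite mulrDr mulrCA.
- have /schwartzP[fr fi] := sf.
  have i1 := integrable_norm (rschwartz_integrable fr).
  have i2 := integrable_norm (rschwartz_integrable fi).
  pose M : R := \int[mu]_x (`|cRe (f x)| + `|cIm (f x)|).
  have iM : mu.-integrable setT (fun x => (`|cRe (f x)| + `|cIm (f x)|)%:E).
    exact: integrable_EFinD.
  (* Order 0: only the supremum of [g] enters. The real and the imaginary part of the pairing each
     contribute one [M]. *)
  exists 0%N, (2 * M) => g sg; rewrite distr_ofE//.
  rewrite -(fineK (schwartz_seminorm_fin 0 sg)) -EFinM lee_fin.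
  set S := fine _; rewrite (le_trans (cabs_le _))// mulr2n mulrDl mul1r mulrDl.
  have [ir ii] := schwartz_mul_cintegrable sf sg.
  have bnd (h : 'rV[R]_m -> R) : mu.-integrable setT (EFin \o h) ->
      (forall x, `|h x| <= (`|cRe (f x)| + `|cIm (f x)|) * S) ->
      `|\int[mu]_x h x| <= M * S.
    move=> hi hS; rewrite (le_trans (le_normr_Rintegral _ hi))// mulrC -RintegralZl//.
    apply: le_Rintegral => //; first exact: (integrable_norm hi).
      exact: integrable_EFinZl.
    by move=> x _; rewrite mulrC hS.
  rewrite lerD//; apply: bnd => // x /=.
  + rewrite ReM (le_trans (ler_normB _ _))// !normrM mulrDl lerD// ler_wpM2l//.
      exact: le_trans (normRe_le_cabs _) (schwartz_sup x sg).
    exact: le_trans (normIm_le_cabs _) (schwartz_sup x sg).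
  + rewrite ImM (le_trans (ler_normD _ _))// !normrM mulrDl lerD// ler_wpM2l//.
      exact: le_trans (normIm_le_cabs _) (schwartz_sup x sg).
    exact: le_trans (normRe_le_cabs _) (schwartz_sup x sg).
- by move=> g nsg; exact: distr_of_out.
Qed.

Local Notation functional := (('rV[R]_m -> R[i]) -> R[i]).

Lemma tempered_comb c (u v : functional) : tempered u -> tempered v ->
  tempered (c *: u + v).
Proof.
move=> [ul [ku [Mu uM]] u0] [vl [kv [Mv vM]] v0]; split.
- move=> d f g sf sg.
  rewrite -[LHS]/(c * u (d *: f + g) + v (d *: f + g)) ul// vl//.
  rewrite -[RHS]/(d * (c * u f + v f) + (c * u g + v g)); ring.
- exists (maxn ku kv), (cabs c * `|Mu| + `|Mv|) => f sf.
  have fin k := schwartz_seminorm_fin k sf.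
  have mono k : (k <= maxn ku kv)%N ->
      fine (schwartz_seminorm k f) <= fine (schwartz_seminorm (maxn ku kv) f).
    by move=> kk; apply: fine_le => //; exact: schwartz_seminorm_homo.
  rewrite -(fineK (fin _)) -EFinM lee_fin.
  have := uM f sf; have := vM f sf; rewrite -(fineK (fin ku)) -(fineK (fin kv)) -!EFinM !lee_fin.
  move=> hv hu; apply: (le_trans (complex.le_normcD (c * u f) (v f))).
  rewrite ComplexField.Normc.normcM mulrDl.
  have S0 k : 0 <= fine (schwartz_seminorm k f) by rewrite fine_ge0// schwartz_seminorm_ge0.
  rewrite lerD//.
    rewrite -mulrA ler_wpM2l ?cabs_ge0// (le_trans hu)//.
    by rewrite (le_trans (ler_wpM2r (S0 _) (ler_norm _)))// ler_wpM2l// mono// leq_maxl.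
  rewrite (le_trans hv)//.
  by rewrite (le_trans (ler_wpM2r (S0 _) (ler_norm _)))// ler_wpM2l// mono// leq_maxr.
- by move=> f nsf; rewrite -[LHS]/(c * u f + v f) u0// v0// mulr0 addr0.
Qed.

Lemma fourier_density_fourier f : schwartz f -> fourier_density (distr_of f) (fourier f).
Proof.
move=> sf; have /schwartzP[fr fi] := schwartz_fourier sf; split.
  move=> K cK; have mK := compact_row_measurable cK.
  split; apply: (integrableS measurableT mK (@subsetT _ _)); exact: rschwartz_integrable.
apply/funext => g; have [sg|nsg] := pselect (schwartz g); last first.
  by rewrite distr_of_out// /distr_fourier /patch memNset.
rewrite distr_ofE// /distr_fourier /patch mem_set//=.
by rewrite distr_ofE ?fourier_adjoint//; exact: schwartz_fourier.
Qed.

(** Testing against real functions separates real from imaginary parts, and [test_zero_ae] applies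
    to the difference of each. *)
Lemma fourier_density_ae (u : functional) f g :
  fourier_density u f -> fourier_density u g -> {ae mu, forall x, f x = g x}.
Proof.
move=> [lf fE] [lg gE].
have sub (h k : 'rV[R]_m -> R) : locally_integrable h -> locally_integrable k ->
    (forall phi K, rsmooth phi -> compact K -> (forall x, ~ K x -> phi x = 0) ->
      \int[mu]_x (h x * phi x) = \int[mu]_x (k x * phi x)) ->
    {ae mu, forall x, h x - k x = 0}.
  move=> lh lk hk; apply: (@test_zero_ae _ _ (fun x => h x - k x)).
    move=> K cK; have mK := compact_row_measurable cK.
    rewrite (_ : _ \o _ = (fun x => (h x)%:E - (k x)%:E)%E)//.
    by apply: integrableB => //; [exact: lh|exact: lk].
  move=> phi K sphi cK phi0; under eq_Rintegral do rewrite mulrBl.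
  have cphi := rsmooth_continuous sphi.
  rewrite RintegralB//; try exact: (locally_integrable_mul _ cK cphi phi0).
  by rewrite (hk phi K)// subrr.
have E (phi : 'rV[R]_m -> R) K : rsmooth phi -> compact K -> (forall x, ~ K x -> phi x = 0) ->
    cintegral (fun x => f x * (phi x)%:C%C) = cintegral (fun x => g x * (phi x)%:C%C).
  move=> sphi cK phi0; have sp : schwartz (fun x => (phi x)%:C%C).
    apply/schwartzP; split; first exact: compact_rschwartz cK sphi phi0.
    exact: (@rschwartz0 R m).
  by rewrite -!distr_ofE// -fE -gE.
have R0 : {ae mu, forall x, cRe (f x) - cRe (g x) = 0}.
  apply: sub => [K cK|K cK|phi K sphi cK phi0].
  - by have [] := lf K cK.
  - by have [] := lg K cK.
  - have := congr1 cRe (E phi K sphi cK phi0); rewrite /cintegral/=.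
    under eq_Rintegral do rewrite ReM /= mulr0 subr0.
    by under [X in _ = X -> _]eq_Rintegral do rewrite ReM /= mulr0 subr0.
have I0 : {ae mu, forall x, cIm (f x) - cIm (g x) = 0}.
  apply: sub => [K cK|K cK|phi K sphi cK phi0].
  - by have [] := lf K cK.
  - by have [] := lg K cK.
  - have := congr1 cIm (E phi K sphi cK phi0); rewrite /cintegral/=.
    under eq_Rintegral do rewrite ImM /= mulr0 add0r.
    by under [X in _ = X -> _]eq_Rintegral do rewrite ImM /= mulr0 add0r.
apply: filterS2 R0 I0 => x /eqP r0 /eqP i0; apply/eqP.
by rewrite eq_complex -subr_eq0 r0 -subr_eq0 i0.
Qed.

End complex_integral.

(** The optimisation in [t] behind Cauchy-Schwarz, isolated because it also serves for integrals and
    for approximate orthogonality. For positive [X] and [A] the choice is [t = X / A]; for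
    [A = 0 < P] the choice [t = P / X] gives the contradiction 2X <= X. *)
Lemma le_sqrtM_amgm (R : rcfType) (X A P : R) : 0 <= A -> 0 <= P ->
  (forall t, 0 < t -> 2 * X <= t * A + t^-1 * P) -> X <= Num.sqrt A * Num.sqrt P.
Proof.
move=> A0 P0 XAP; have [X0|X0] := leP X 0.
  by rewrite (le_trans X0)// mulr_ge0// sqrtr_ge0.
suff XX : X ^+ 2 <= A * P by rewrite -sqrtrM// -[leLHS](ger0_norm (ltW X0)) -sqrtr_sqr ler_wsqrtr.
have [A_eq0|A_neq0] := eqVneq A 0.
  have [P_eq0|P_neq0] := eqVneq P 0.
    by have := XAP 1 ltr01; rewrite A_eq0 P_eq0 !mulr0 addr0; lra.
  have Pgt0 : 0 < P by rewrite lt_def P_neq0.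
  have := XAP (P / X) (divr_gt0 Pgt0 X0); rewrite A_eq0 mulr0 add0r invf_div divfK//.
  lra.
have Agt0 : 0 < A by rewrite lt_def A_neq0.
have := XAP (X / A) (divr_gt0 X0 Agt0); rewrite invf_div divfK// => h.
have {}h : X <= A / X * P by lra.
by rewrite mulrAC ler_pdivlMr// -expr2 in h.
Qed.

(** * Weighted square-integrable functions and their pairing with Schwartz functions *)

Section weighted_l2.
Context {R : realType} {m : nat} (s : R).
Local Notation mu := (lebesgue_row R m).
Implicit Types (a b p : 'rV[R]_m -> R) (x xi : 'rV[R]_m).

Definition sobolev_weight xi : R := (1 + dotv xi xi) `^ s.
Arguments sobolev_weight : simpl never.
Local Notation w := sobolev_weight.

Lemma weight_gt0 xi : 0 < w xi.
Proof. by rewrite powR_gt0// gt0_dotv. Qed.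

Lemma measurable_weight : measurable_fun setT w.
Proof.
apply: (@measurableT_comp _ _ _ _ _ _ (fun t : R => t `^ s)).
  exact: measurable_powR.
apply: continuous_row_measurable; exact: continuous_weight.
Qed.

(** Lets Schwartz functions enter both the weighted space and its dual, whatever the sign of [s]. *)
Lemma weight_le : exists N, forall xi, w xi <= (1 + dotv xi xi) ^+ N /\
  (w xi)^-1 <= (1 + dotv xi xi) ^+ N.
Proof.
exists (Num.truncn `|s|).+1 => xi; have d1 := ge1_dotv xi.
have sN : `|s| <= (Num.truncn `|s|).+1%:R by rewrite ltW// truncnS_gt.
rewrite -powR_mulrn ?(ltW (gt0_dotv xi))// /sobolev_weight -powRN; split; apply: ler_powR => //.
  exact: le_trans (ler_norm _) sN.
by apply: le_trans sN; rewrite -normrN ler_norm.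
Qed.

Definition l2 a := measurable_fun setT a /\
  mu.-integrable setT (fun xi => (w xi * a xi ^+ 2)%:E).

Definition ip a b : R := \int[mu]_xi (w xi * (a xi * b xi)).

Lemma ipC a b : ip a b = ip b a.
Proof. by apply: eq_Rintegral => xi _; rewrite (mulrC (a xi)). Qed.

Lemma l2_mul a b : l2 a -> l2 b -> mu.-integrable setT (fun xi => (w xi * (a xi * b xi))%:E).
Proof.
move=> [ma ia] [mb ib]; have := integrable_EFinD ia ib; apply: le_integrable => //.
  apply/measurable_EFinP; apply: measurable_funM; first exact: measurable_weight.
  exact: measurable_funM.
move=> xi _; rewrite /= lee_fin normrM (ger0_norm (ltW (weight_gt0 _))).
rewrite -mulrDr [leRHS]normrM (ger0_norm (ltW (weight_gt0 _))).
rewrite ler_wpM2l ?(ltW (weight_gt0 _))//.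
rewrite [leRHS]ger0_norm ?addr_ge0 ?sqr_ge0//.
have := sqr_ge0 (`|a xi| - `|b xi|); rewrite sqrrB !real_normK ?num_real// -normrM.
move: `|_| => t.
have := sqr_ge0 (a xi); have := sqr_ge0 (b xi); move: (_ ^+ 2) (_ ^+ 2) => u v.
by rewrite mulr2n; lra.
Qed.

Lemma l2_comb (c : R) a b : l2 a -> l2 b -> l2 (fun xi => c * a xi + b xi).
Proof.
move=> la lb; have [ma ia] := la; have [mb ib] := lb; split.
  by apply: measurable_funD => //; exact: measurable_funM.
have iab := l2_mul la lb.
rewrite (_ : (fun _ => _) = fun xi => (c ^+ 2 * (w xi * a xi ^+ 2) +
    2 * c * (w xi * (a xi * b xi)) + w xi * b xi ^+ 2)%:E).
  apply: integrable_EFinD => //; apply: integrable_EFinD; exact: integrable_EFinZl.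
by apply/funext => xi; congr EFin; ring.
Qed.

Lemma ip_comb (c : R) a b d : l2 a -> l2 b -> l2 d ->
  ip (fun xi => c * a xi + b xi) d = c * ip a d + ip b d.
Proof.
move=> la lb ld; have ad := l2_mul la ld; have bd := l2_mul lb ld.
rewrite /ip -RintegralZl// -RintegralD//; last exact: integrable_EFinZl.
by apply: eq_Rintegral => xi _; ring.
Qed.

Lemma ip_ge0 a : 0 <= ip a a.
Proof.
apply: Rintegral_ge0 => xi _; rewrite mulr_ge0 ?(ltW (weight_gt0 _))//.
by rewrite -expr2 sqr_ge0.
Qed.

Lemma ip_ae a a' b : l2 a -> l2 a' -> l2 b -> {ae mu, forall xi, a xi = a' xi} ->
  ip a b = ip a' b.
Proof.
move=> la la' lb aa'; rewrite /ip /Rintegral; congr fine; apply: ae_eq_integral => //.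
- exact: measurable_int (l2_mul la lb).
- exact: measurable_int (l2_mul la' lb).
- by apply: filterS aa' => xi -> _.
Qed.

Lemma l2_ae a a' : measurable_fun setT a' -> l2 a ->
  {ae mu, forall xi, a xi = a' xi} -> l2 a'.
Proof.
move=> ma' [ma /integrableP[mi ai]] aa'; split => //.
have mi' : measurable_fun setT (fun xi => (w xi * a' xi ^+ 2)%:E).
  apply/measurable_EFinP; apply: measurable_funM; first exact: measurable_weight.
  exact: measurable_funX.
apply/integrableP; split => //; apply: le_lt_trans ai.
rewrite le_eqVlt; apply/orP; left; apply/eqP; apply: ge0_ae_eq_integral => //.
- exact: measurableT_comp.
- exact: measurableT_comp.
- by apply: filterS aa' => xi -> _.
Qed.

Lemma rapid_l2 a : continuous a -> rapid a -> l2 a.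
Proof.
move=> ca ra; have ma := continuous_row_measurable ca; split=> //.
have [N wN] := weight_le; apply: rapid_integrable.
  apply: measurable_funM; first exact: measurable_weight.
  exact: measurable_funX.
have [C aC] := ra 0%N.
apply: (@rapidM_poly _ _ w (fun xi => a xi ^+ 2) N 1).
  by move=> xi; rewrite mul1r ger0_norm ?(ltW (weight_gt0 _))//; have [] := wN xi.
apply: (@rapidM_poly _ _ a a 0 C) => // xi.
by rewrite expr0 mulr1; have := aC xi; rewrite expr0 mul1r.
Qed.

Lemma weightV_test p : rschwartz p ->
  mu.-integrable setT (fun xi => ((w xi)^-1 * p xi ^+ 2)%:E).
Proof.
move=> sp; have cp := rschwartz_continuous sp; have rp := rschwartz_rapid sp.
have [N wN] := weight_le; apply: rapid_integrable.
  apply: measurable_funM; last by apply: measurable_funX; exact: continuous_row_measurable.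
  under eq_fun do rewrite /sobolev_weight -powRN.
  apply: (@measurableT_comp _ _ _ _ _ _ (fun t : R => t `^ (- s))).
    exact: measurable_powR.
  by apply: continuous_row_measurable; exact: continuous_weight.
have [C aC] := rp 0%N.
apply: (@rapidM_poly _ _ (fun xi => (w xi)^-1) (fun xi => p xi ^+ 2) N 1).
  by move=> xi; rewrite mul1r ger0_norm ?invr_ge0 ?(ltW (weight_gt0 _))//; have [] := wN xi.
apply: (@rapidM_poly _ _ p p 0 C) => // xi.
by rewrite expr0 mulr1; have := aC xi; rewrite expr0 mul1r.
Qed.

(** The difference of the two sides is [(t * u)^-1 * (t * u * |a| - |p|) ^+ 2]. *)
Lemma amgm_weight (t u a p : R) : 0 < t -> 0 < u ->
  2 * `|a * p| <= t * (u * a ^+ 2) + t^-1 * (u^-1 * p ^+ 2).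
Proof.
move=> t0 u0; have tu0 : 0 < t * u by exact: mulr_gt0.
rewrite -[a ^+ 2]real_normK ?num_real// -[p ^+ 2]real_normK ?num_real// normrM.
move: `|a| `|p| => {}a {}p; rewrite -subr_ge0.
rewrite (_ : _ - _ = (t * u)^-1 * (t * u * a - p) ^+ 2).
  by rewrite mulr_ge0 ?sqr_ge0// invr_ge0 ltW.
by field; rewrite !gt_eqF.
Qed.

Lemma l2_test a p : l2 a -> rschwartz p -> mu.-integrable setT (fun xi => (a xi * p xi)%:E).
Proof.
move=> [ma ia] sp; have := integrable_EFinD ia (weightV_test sp).
apply: le_integrable => //.
  apply/measurable_EFinP; apply: measurable_funM => //.
  by apply: continuous_row_measurable; exact: rschwartz_continuous.
move=> xi _; rewrite /= lee_fin.
rewrite [leRHS]ger0_norm; last first.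
  by rewrite addr_ge0// mulr_ge0 ?sqr_ge0 ?invr_ge0 ?(ltW (weight_gt0 _)).
have := amgm_weight (a xi) (p xi) ltr01 (weight_gt0 xi); rewrite invr1 !mul1r.
by have := normr_ge0 (a xi * p xi); lra.
Qed.

(** Integrating [amgm_weight] for every [t] and optimising gives the duality between the weights [w]
    and [w^-1]. *)
Lemma l2_test_le a p : l2 a -> rschwartz p -> `|\int[mu]_xi (a xi * p xi)| <=
  Num.sqrt (ip a a) * Num.sqrt (\int[mu]_xi ((w xi)^-1 * p xi ^+ 2)).
Proof.
move=> la sp; have [ma ia] := la; have ip_ := weightV_test sp; have iap := l2_test la sp.
apply: le_sqrtM_amgm; first exact: ip_ge0.
  by apply: Rintegral_ge0 => xi _; rewrite mulr_ge0 ?sqr_ge0 ?invr_ge0 ?(ltW (weight_gt0 _)).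
move=> t t0; apply: (@le_trans _ _ (2 * \int[mu]_xi `|a xi * p xi|)).
  by rewrite ler_wpM2l// le_normr_Rintegral.
have iN := integrable_norm iap.
have ia' : mu.-integrable setT (fun xi => (w xi * (a xi * a xi))%:E) by exact: l2_mul.
rewrite /ip -!RintegralZl// -RintegralD//; last 2 first.
- exact: integrable_EFinZl.
- exact: integrable_EFinZl.
apply: le_Rintegral => //.
- exact: integrable_EFinZl.
- by apply: integrable_EFinD; exact: integrable_EFinZl.
- by move=> xi _; rewrite -expr2; exact: amgm_weight (weight_gt0 xi).
Qed.

End weighted_l2.

(** * H^s as an inner product space *)

Section sobolev_space.
Context {R : realType} {m : nat} (s : R).
Local Notation mu := (lebesgue_row R m).
Local Notation cRe := (@complex.Re R).
Local Notation cIm := (@complex.Im R).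
Local Notation cabs := (@ComplexField.Normc.normc R).
Local Notation functional := (('rV[R]_m -> R[i]) -> R[i]).
Local Notation w := (@sobolev_weight R m s).
Implicit Types (u v z : functional) (f g phi : 'rV[R]_m -> R[i]) (c : R[i]).

Definition cl2 g := l2 s (cRe \o g) /\ l2 s (cIm \o g).

Lemma cl2_comb c f g : cl2 f -> cl2 g -> cl2 (fun x => c * f x + g x).
Proof.
move=> [fr fi] [gr gi]; split.
- rewrite (_ : _ \o _ = (fun x => cRe c * cRe (f x) + (- cIm c * cIm (f x) + cRe (g x)))).
    by apply: l2_comb => //; exact: l2_comb.
  by apply/funext => x /=; rewrite ReD ReM; ring.
- rewrite (_ : _ \o _ = (fun x => cRe c * cIm (f x) + (cIm c * cRe (f x) + cIm (g x)))).
    by apply: l2_comb => //; exact: l2_comb.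
  by apply/funext => x /=; rewrite ImD ImM; ring.
Qed.

Lemma cl2_test g phi : cl2 g -> schwartz phi -> cintegrable (fun x => g x * phi x).
Proof.
move=> [gr gi] /schwartzP[pr pi_]; split.
- rewrite (_ : _ \o _ = (fun x => (cRe (g x) * cRe (phi x) - cIm (g x) * cIm (phi x))%:E)).
    exact: integrable_EFinB (l2_test gr pr) (l2_test gi pi_).
  by apply/funext => x /=; rewrite ReM.
- rewrite (_ : _ \o _ = (fun x => (cRe (g x) * cIm (phi x) + cIm (g x) * cRe (phi x))%:E)).
    exact: integrable_EFinD (l2_test gr pi_) (l2_test gi pr).
  by apply/funext => x /=; rewrite ImM.
Qed.

Lemma clocally_integrable_measurable g : clocally_integrable g ->
  measurable_fun setT (cRe \o g) /\ measurable_fun setT (cIm \o g).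
Proof.
by move=> lg; split; apply: locally_integrable_measurable => K cK; have [] := lg K cK.
Qed.

Lemma energyE g : cl2 g -> (\int[mu]_xi (w xi * cabs (g xi) ^+ 2)%:E =
  (ip s (cRe \o g) (cRe \o g) + ip s (cIm \o g) (cIm \o g))%:E)%E.
Proof.
move=> [gr gi]; have ir := l2_mul gr gr; have ii := l2_mul gi gi.
rewrite /ip EFinD /Rintegral !fineK; try exact: integrable_fin_num.
rewrite -integralD//; apply: eq_integral => xi _ /=.
by rewrite -EFinD cabs_sqr mulrDr -!expr2.
Qed.

Lemma energy_lty_cl2 g : clocally_integrable g ->
  (\int[mu]_xi (w xi * cabs (g xi) ^+ 2)%:E < +oo)%E -> cl2 g.
Proof.
move=> /clocally_integrable_measurable[mr mi] fin.
have mw := @measurable_weight R m s; have w0 xi := ltW (@weight_gt0 R m s xi).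
have sub (a : 'rV[R]_m -> R) : measurable_fun setT a ->
    (forall xi, a xi ^+ 2 <= cabs (g xi) ^+ 2) -> l2 s a.
  move=> ma ag; split=> //.
  have mwa : measurable_fun setT (fun xi => w xi * a xi ^+ 2).
    by apply: measurable_funM => //; exact: measurable_funX.
  apply/integrableP; split; first exact/measurable_EFinP.
  apply: le_lt_trans fin; apply: ge0_le_integral => //.
  - by apply: measurableT_comp => //; exact/measurable_EFinP.
  - apply/measurable_EFinP; apply: measurable_funM => //.
    under eq_fun do rewrite cabs_sqr.
    by apply: measurable_funD; exact: measurable_funX.
  - move=> xi _; rewrite /= lee_fin normrM (ger0_norm (w0 xi)) ler_wpM2l//.
    by rewrite ger0_norm ?sqr_ge0.
by split; apply: sub => // xi /=; rewrite cabs_sqr (lerDl, lerDr) sqr_ge0.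
Qed.

Lemma sobolevP u : sobolev s u -> [/\ tempered u, fourier_density u (fourier_fun u) &
  cl2 (fourier_fun u)].
Proof.
move=> [tu [g gd] fin].
have ud : fourier_density u (fourier_fun u) by exact: (xgetPex _ (ex_intro _ g gd)).
by split => //; have [lu _] := ud; exact: energy_lty_cl2.
Qed.

(** Nothing explicit is known about the density chosen by [fourier_fun], so membership is verified
    on any convenient density and transferred by uniqueness almost everywhere. *)
Lemma sobolev_intro u g : tempered u -> fourier_density u g -> cl2 g ->
  sobolev s u /\ {ae mu, forall x, fourier_fun u x = g x}.
Proof.
move=> tu ug [gr gi].
have ud : fourier_density u (fourier_fun u) by exact: (xgetPex _ (ex_intro _ g ug)).
have uae := fourier_density_ae ud ug.
split=> //; split => //; first by exists g.
have [mr mi] : measurable_fun setT (cRe \o fourier_fun u) /\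
    measurable_fun setT (cIm \o fourier_fun u).
  by apply: clocally_integrable_measurable; have [] := ud.
have ul2 : cl2 (fourier_fun u).
  split; [apply: (l2_ae _ gr) => //|apply: (l2_ae _ gi) => //];
  by apply: filterS uae => x /= ->.
by rewrite /sobolev_energy energyE// ltry.
Qed.

Lemma fourier_density_comb c u v f g :
  fourier_density u f -> fourier_density v g -> cl2 f -> cl2 g ->
  fourier_density (c *: u + v) (fun x => c * f x + g x).
Proof.
move=> [lf fE] [lg gE] l2f l2g; split.
- move=> K cK; have [fr fi] := lf K cK; have [gr gi] := lg K cK.
  have mK := compact_row_measurable cK; split.
  + rewrite (_ : _ \o _ = (fun x => (cRe c)%:E * (cRe (f x))%:E -
        (cIm c)%:E * (cIm (f x))%:E + (cRe (g x))%:E)%E).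
      apply: integrableD => //; apply: integrableB => //; exact: integrableZl.
    by apply/funext => x /=; rewrite ReD ReM.
  + rewrite (_ : _ \o _ = (fun x => (cRe c)%:E * (cIm (f x))%:E +
        (cIm c)%:E * (cRe (f x))%:E + (cIm (g x))%:E)%E).
      apply: integrableD => //; apply: integrableD => //; exact: integrableZl.
    by apply/funext => x /=; rewrite ImD ImM.
- apply/funext => phi; have [sp|nsp] := pselect (schwartz phi); last first.
    by rewrite distr_of_out// /distr_fourier /patch memNset.
  have uE : u (fourier phi) = cintegral (fun x => f x * phi x).
    by have := congr1 (fun F => F phi) fE; rewrite distr_ofE// /distr_fourier /patch mem_set.
  have vE : v (fourier phi) = cintegral (fun x => g x * phi x).
    by have := congr1 (fun F => F phi) gE; rewrite distr_ofE// /distr_fourier /patch mem_set.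
  rewrite distr_ofE// /distr_fourier /patch mem_set//=.
  rewrite -[LHS]/(c * u (fourier phi) + v (fourier phi)) uE vE.
  rewrite -cintegral_lin; [|exact: cl2_test|exact: cl2_test].
  by congr cintegral; apply/funext => x; rewrite mulrDl mulrA.
Qed.

Lemma sobolev_comb c u v : sobolev s u -> sobolev s v ->
  sobolev s (c *: u + v) /\
  {ae mu, forall x, fourier_fun (c *: u + v) x = c * fourier_fun u x + fourier_fun v x}.
Proof.
move=> /sobolevP[tu du lu] /sobolevP[tv dv lv]; apply: sobolev_intro.
- exact: tempered_comb.
- exact: fourier_density_comb.
- exact: cl2_comb.
Qed.

Lemma sobolev_distr_of phi : schwartz phi -> sobolev s (distr_of phi).
Proof.
move=> sp; have /schwartzP[fr fi] := schwartz_fourier sp.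
have [//|||//] := @sobolev_intro (distr_of phi) (fourier phi).
- exact: tempered_distr_of.
- exact: fourier_density_fourier.
- by split; apply: rapid_l2; (exact: rschwartz_continuous || exact: rschwartz_rapid).
Qed.

Lemma distr_of0 : distr_of (0 : 'rV[R]_m -> R[i]) = 0.
Proof.
have s0 := @schwartz0 R m.
by have := distr_of_lin (-1) s0 s0; rewrite scaler0 addr0 scaleN1r addNr.
Qed.

Lemma sobolev0 : sobolev s (0 : functional).
Proof. by rewrite -distr_of0; apply: sobolev_distr_of; exact: schwartz0. Qed.

(** The real part of the Hermitian product; the complex structure re-enters through
    [sobolev_ipi]. *)
Definition sobolev_ip u v : R :=
  ip s (cRe \o fourier_fun u) (cRe \o fourier_fun v) +
  ip s (cIm \o fourier_fun u) (cIm \o fourier_fun v).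

Lemma sobolev_ipC u v : sobolev_ip u v = sobolev_ip v u.
Proof. by rewrite /sobolev_ip !(@ipC _ _ _ (_ \o fourier_fun u)). Qed.

Lemma sobolev_ip_ge0 u : 0 <= sobolev_ip u u.
Proof. by rewrite addr_ge0// ip_ge0. Qed.

Lemma sobolev_normE u : sobolev s u -> sobolev_norm s u = Num.sqrt (sobolev_ip u u).
Proof. by move=> /sobolevP[_ _ lu]; rewrite /sobolev_norm /sobolev_energy energyE. Qed.

Lemma sobolev_ip_ae u z g : sobolev s u -> sobolev s z -> cl2 g ->
  {ae mu, forall x, fourier_fun u x = g x} ->
  sobolev_ip u z = ip s (cRe \o g) (cRe \o fourier_fun z) + ip s (cIm \o g) (cIm \o fourier_fun z).
Proof.
move=> /sobolevP[_ _ [ur ui]] /sobolevP[_ _ [zr zi]] [gr gi] ug; congr (_ + _).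
- by apply: ip_ae => //; apply: filterS ug => x /= ->.
- by apply: ip_ae => //; apply: filterS ug => x /= ->.
Qed.

Lemma sobolev_ip_comb (r : R) u v z : sobolev s u -> sobolev s v -> sobolev s z ->
  sobolev_ip (r%:C%C *: u + v) z = r * sobolev_ip u z + sobolev_ip v z.
Proof.
move=> su sv sz; have [suv uvE] := sobolev_comb r%:C%C su sv.
have [_ _ lu] := sobolevP su; have [_ _ lv] := sobolevP sv; have [_ _ [zr zi]] := sobolevP sz.
rewrite (sobolev_ip_ae suv sz (cl2_comb _ lu lv) uvE).
have [ur ui] := lu; have [vr vi] := lv.
rewrite (_ : cRe \o _ = fun x => r * (cRe \o fourier_fun u) x + (cRe \o fourier_fun v) x); last first.
  by apply/funext => x /=; rewrite ReD ReM/= mul0r subr0.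
rewrite (_ : cIm \o _ = fun x => r * (cIm \o fourier_fun u) x + (cIm \o fourier_fun v) x); last first.
  by apply/funext => x /=; rewrite ImD ImM/= mul0r addr0.
by rewrite !ip_comb// /sobolev_ip; ring.
Qed.

Lemma l2Z (r : R) (a : 'rV[R]_m -> R) : l2 s a -> l2 s (fun x => r * a x).
Proof.
move=> la; rewrite (_ : (fun _ => _) = fun x => (r - 1) * a x + a x); first exact: l2_comb.
by apply/funext => x; ring.
Qed.

Lemma fourier_fun0 : {ae mu, forall x, fourier_fun (0 : functional) x = 0}.
Proof.
have [_ d0 _] := sobolevP sobolev0; apply: fourier_density_ae d0 _; split.
  by move=> K cK; split; exact: integrable0.
apply/funext => phi; rewrite [RHS](congr1 (fun F => F phi) distr_of0).
by rewrite /distr_fourier /patch; case: ifP.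
Qed.

(** Multiplication by i exchanges the real and imaginary parts of the density up to a sign, almost
    everywhere. *)
Lemma sobolev_ipi u : sobolev s u ->
  sobolev_ip ('i%C *: u) ('i%C *: u) = sobolev_ip u u.
Proof.
move=> su; have [] := sobolev_comb 'i%C su sobolev0; rewrite addr0 => si iE.
have [_ _ [ur ui]] := sobolevP su; have [_ _ [vr vi]] := sobolevP si.
have iE' : {ae mu, forall x, fourier_fun ('i%C *: u) x = 'i%C * fourier_fun u x}.
  by apply: filterS2 iE fourier_fun0 => x -> ->; rewrite addr0.
have rE : {ae mu, forall x, (cRe \o fourier_fun ('i%C *: u)) x = -1 * (cIm \o fourier_fun u) x}.
  by apply: filterS iE' => x /= ->; rewrite ReM/= mul0r mul1r add0r mulN1r.
have imE : {ae mu, forall x, (cIm \o fourier_fun ('i%C *: u)) x = 1 * (cRe \o fourier_fun u) x}.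
  by apply: filterS iE' => x /= ->; rewrite ImM/= mul0r add0r.
rewrite /sobolev_ip addrC; congr (_ + _).
- have l1 := l2Z 1 ur.
  rewrite (ip_ae vi l1 vi imE) ipC (ip_ae vi l1 l1 imE).
  by apply: eq_Rintegral => x _; ring.
- have l1 := l2Z (-1) ui.
  rewrite (ip_ae vr l1 vr rE) ipC (ip_ae vr l1 l1 rE).
  by apply: eq_Rintegral => x _; ring.
Qed.

Lemma eval_bounded phi : schwartz phi -> exists2 C : R, 0 <= C &
  forall u, sobolev s u -> cabs (u phi) <= C * sobolev_norm s u.
Proof.
move=> sphi; have [psi spsi <-] := fourier_surjective sphi.
have /schwartzP[sp sq] := spsi.
pose D (p : 'rV[R]_m -> R) : R := Num.sqrt (\int[mu]_xi ((w xi)^-1 * p xi ^+ 2)).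
have D0 p : 0 <= D p by exact: sqrtr_ge0.
(* The pairing expands into four products of real and imaginary parts, in which each of the two
   constants [D] occurs twice. *)
exists (2 * (D (cRe \o psi) + D (cIm \o psi))); first by rewrite mulr_ge0// addr_ge0.
move=> u su; have [_ [_ ud] lu] := sobolevP su; have [ur ui] := lu.
have -> : u (fourier psi) = cintegral (fun x => fourier_fun u x * psi x).
  by have := congr1 (fun F => F psi) ud; rewrite distr_ofE// /distr_fourier /patch mem_set.
rewrite sobolev_normE//; set N := Num.sqrt _.
have bnd (a p : 'rV[R]_m -> R) : l2 s a -> rschwartz p -> ip s a a <= sobolev_ip u u ->
    `|\int[mu]_x (a x * p x)| <= N * D p.
  move=> la sp' au; apply: le_trans (l2_test_le la sp') _.
  by rewrite ler_wpM2r// ler_wsqrtr.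
have ru : ip s (cRe \o fourier_fun u) (cRe \o fourier_fun u) <= sobolev_ip u u.
  by rewrite /sobolev_ip lerDl ip_ge0.
have iu : ip s (cIm \o fourier_fun u) (cIm \o fourier_fun u) <= sobolev_ip u u.
  by rewrite /sobolev_ip lerDr ip_ge0.
apply: le_trans (cabs_le _) _.
have -> : 2 * (D (cRe \o psi) + D (cIm \o psi)) * N =
    (N * D (cRe \o psi) + N * D (cIm \o psi)) + (N * D (cIm \o psi) + N * D (cRe \o psi)).
  by ring.
have i1 := l2_test ur sp; have i2 := l2_test ui sq.
have i3 := l2_test ur sq; have i4 := l2_test ui sp.
rewrite /cintegral; apply: lerD => /=.
- under eq_Rintegral do rewrite ReM.
  by rewrite RintegralB// (le_trans (ler_normB _ _))// lerD//; apply: bnd.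
- under eq_Rintegral do rewrite ImM.
  by rewrite RintegralD// (le_trans (ler_normD _ _))// lerD//; apply: bnd.
Qed.

End sobolev_space.

(** * Weak closedness of closed subspaces *)

Section weak_closure.
Context {R : realType} (E : lmodType R[i]) (H : set E) (nrm : E -> R) (ip : E -> E -> R).
Local Notation cabs := (@ComplexField.Normc.normc R).
Implicit Types (u v w z : E) (W : set E).

(** [ip] stands for the real part of a Hermitian product: linearity is over real scalars, and
    [ips_i] records the complex structure. *)
Record inner_product_space : Prop := InnerProductSpace {
  ips_zero : H 0;
  ips_comb : forall (c : R[i]) u v, H u -> H v -> H (c *: u + v);
  ips_sym : forall u v, ip u v = ip v u;
  ips_lin : forall (r : R) u v z, H u -> H v -> H z ->
    ip (r%:C%C *: u + v) z = r * ip u z + ip v z;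
  ips_ge0 : forall u, 0 <= ip u u;
  ips_i : forall u, H u -> ip ('i%C *: u) ('i%C *: u) = ip u u;
  ips_norm : forall u, H u -> nrm u = Num.sqrt (ip u u) }.

Hypothesis ips : inner_product_space.

Let H0 := ips_zero ips.
Let Hcomb := ips_comb ips.

Lemma ipsZ c u : H u -> H (c *: u).
Proof. by move=> Hu; rewrite -[_ *: _]addr0; exact: Hcomb. Qed.

Lemma ipsD u v : H u -> H v -> H (u + v).
Proof. by move=> Hu Hv; rewrite -[u]scale1r; exact: Hcomb. Qed.

Lemma ipsB u v : H u -> H v -> H (u - v).
Proof. by move=> Hu Hv; rewrite addrC -scaleN1r; exact: Hcomb. Qed.

Lemma ipDl u v z : H u -> H v -> H z -> ip (u + v) z = ip u z + ip v z.
Proof.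
by move=> Hu Hv Hz; have := ips_lin ips 1 Hu Hv Hz; rewrite scale1r mul1r.
Qed.

Lemma ipBl u v z : H u -> H v -> H z -> ip (u - v) z = ip u z - ip v z.
Proof.
move=> Hu Hv Hz; rewrite addrC -scaleN1r.
by have := ips_lin ips (-1) Hv Hu Hz; rewrite rmorphN1 mulN1r => ->; rewrite addrC.
Qed.

Lemma ipBr u v z : H u -> H v -> H z -> ip z (u - v) = ip z u - ip z v.
Proof. by move=> Hu Hv Hz; rewrite !(ips_sym ips z); exact: ipBl. Qed.

Lemma ipDr u v z : H u -> H v -> H z -> ip z (u + v) = ip z u + ip z v.
Proof. by move=> Hu Hv Hz; rewrite !(ips_sym ips z); exact: ipDl. Qed.

Lemma ip0l z : H z -> ip 0 z = 0.
Proof. by move=> Hz; have := ipBl H0 H0 Hz; rewrite subr0 subrr. Qed.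

Lemma ipZl (r : R) u z : H u -> H z -> ip (r%:C%C *: u) z = r * ip u z.
Proof.
by move=> Hu Hz; have := ips_lin ips r Hu H0 Hz; rewrite addr0 ip0l// addr0.
Qed.

Lemma ip_quadratic (r : R) u v : H u -> H v ->
  ip (u + r%:C%C *: v) (u + r%:C%C *: v) = ip u u + 2 * r * ip u v + r ^+ 2 * ip v v.
Proof.
move=> Hu Hv; have Hrv := ipsZ r%:C%C Hv; have Hs := ipsD Hu Hrv.
rewrite (ipDl Hu Hrv Hs) (ipDr Hu Hrv Hu) (ipDr Hu Hrv Hrv) (ips_sym ips u (_ *: v)).
rewrite (ipZl r Hv Hu) (ipZl r Hv Hrv) (ips_sym ips v (_ *: v)) (ipZl r Hv Hv).
by rewrite (ips_sym ips v u); ring.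
Qed.

Lemma ip_cauchy_schwarz u v : H u -> H v ->
  `|ip u v| <= Num.sqrt (ip u u) * Num.sqrt (ip v v).
Proof.
(* [r] is a sign; its two values give the two halves of the bound on the absolute value. *)
move=> Hu Hv; have key (r : R) : `|r| = 1 -> - (r * ip u v) <= Num.sqrt (ip u u) * Num.sqrt (ip v v).
  move=> r1; rewrite mulrC; apply: le_sqrtM_amgm; [exact: ips_ge0 ips _..|move=> t t0].
  have := ips_ge0 ips (v + (t * r)%:C%C *: u); rewrite ip_quadratic// (ips_sym ips v u).
  have -> : (t * r) ^+ 2 = t ^+ 2.
    by rewrite exprMn -[r ^+ 2]real_normK ?num_real// r1 expr1n mulr1.
  move=> h; have : 0 <= t^-1 * (ip v v + 2 * (t * r) * ip u v + t ^+ 2 * ip u u).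
    by rewrite mulr_ge0// invr_ge0 ltW.
  rewrite (_ : t^-1 * _ = t * ip u u + t^-1 * ip v v - 2 * - (ip u v * r)); last first.
    by field; rewrite gt_eqF.
  by rewrite subr_ge0.
rewrite ler_norml; apply/andP; split.
  by rewrite lerNl -[ip u v]mul1r; apply: key; rewrite normr1.
by have := key (-1); rewrite mulN1r opprK; apply; rewrite normrN normr1.
Qed.

Lemma nrm_sqr u : H u -> nrm u ^+ 2 = ip u u.
Proof. by move=> Hu; rewrite (ips_norm ips)// sqr_sqrtr// (ips_ge0 ips). Qed.

Lemma nrm_ge0 u : H u -> 0 <= nrm u.
Proof. by move=> Hu; rewrite (ips_norm ips)// sqrtr_ge0. Qed.

Lemma nrm_ler (u : E) (r : R) : H u -> 0 <= r -> ip u u <= r ^+ 2 -> nrm u <= r.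
Proof. by move=> Hu r0 ur; rewrite -(ler_pXn2r (n := 2))// ?nnegrE ?nrm_ge0// nrm_sqr. Qed.

Lemma nrm_triangle u v : H u -> H v -> nrm (u + v) <= nrm u + nrm v.
Proof.
move=> Hu Hv; apply: nrm_ler; [exact: ipsD|by rewrite addr_ge0// nrm_ge0|].
have := @ip_quadratic 1 u v Hu Hv; rewrite scale1r => ->.
have : ip u v <= nrm u * nrm v.
  by rewrite (le_trans (ler_norm _))// !(ips_norm ips)// ip_cauchy_schwarz.
rewrite sqrrD !nrm_sqr// mulr1 expr1n mul1r mulr2n; lra.
Qed.

Lemma nrm0 : nrm 0 = 0.
Proof. by rewrite (ips_norm ips)// ip0l// sqrtr0. Qed.

Lemma nrmZi u : H u -> nrm ('i%C *: u) = nrm u.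
Proof. by move=> Hu; rewrite !(ips_norm ips)// ?(ips_i ips)//; exact: ipsZ. Qed.

Lemma nrmZr (r : R) u : H u -> nrm (r%:C%C *: u) = `|r| * nrm u.
Proof.
move=> Hu; have Hr := ipsZ r%:C%C Hu.
rewrite !(ips_norm ips)// ipZl// (ips_sym ips) ipZl// mulrA -expr2.
by rewrite sqrtrM ?sqr_ge0// sqrtr_sqr.
Qed.

Lemma nrmZ_le c u : H u -> nrm (c *: u) <= (`|complex.Re c| + `|complex.Im c|) * nrm u.
Proof.
move=> Hu; have -> : c *: u = (complex.Re c)%:C%C *: u + (complex.Im c)%:C%C *: ('i%C *: u).
  rewrite scalerA -scalerDl; congr (_ *: _).
  by case: c => a b; apply/eqP; rewrite eq_complex/=; apply/andP; split; apply/eqP; ring.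
have Hi := ipsZ 'i%C Hu.
apply: le_trans (nrm_triangle (ipsZ _ Hu) (ipsZ _ Hi)) _.
by rewrite !nrmZr// nrmZi// mulrDl.
Qed.

Lemma nrmB u v : H u -> H v -> nrm (u - v) = nrm (v - u).
Proof.
move=> Hu Hv; have N1 : (-1)%:C%C = -1 :> R[i] by rewrite rmorphN1.
rewrite -[u - v]opprB -(scaleN1r (v - u)) -N1 nrmZr; last exact: ipsB.
by rewrite normrN normr1 mul1r.
Qed.

(* The functional is [u |-> lim <u, h_n>] for a minimising sequence [h_n] of the
   distance of [w] to [W]; it exists although [H] is not known to be complete. *)
Lemma separating_functional W w : closed_subspace H nrm W -> H w -> ~ W w ->
  exists l : E -> R, [/\ forall (r : R) u v, H u -> H v -> l (r%:C%C *: u + v) = r * l u + l v,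
    exists M, forall u, H u -> `|l u| <= M * nrm u,
    forall u, W u -> l u = 0 & l w != 0].
Proof.
move=> [WH W0 Wcomb Wclosed] Hw nWw.
pose D := [set ip (w - v) (w - v) | v in W].
have D0 : D !=set0 by exists (ip (w - 0) (w - 0)), 0.
have Dlb : has_lbound D by exists 0 => _ [v _ <-]; exact: ips_ge0.
pose d := inf D.
have dle v : W v -> d <= ip (w - v) (w - v) by move=> Wv; apply: ge_inf => //; exists v.
(* The distance is positive because [W] is closed and [w] lies outside it. *)
have d0 : 0 < d.
  have [e [e0 eW]] : exists e : R, 0 < e /\ forall v, W v -> e <= nrm (w - v).
    apply: contrapT => /forallNP h; apply: nWw; apply: Wclosed => // e e0.
    have /not_andP[//|/existsNP[v /not_implyP[Wv /negP]]] := h e.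
    by rewrite -ltNge => ?; exists v.
  apply: (@lt_le_trans _ _ (e ^+ 2)); first exact: exprn_gt0.
  apply: lb_le_inf => // _ [v Wv <-]; rewrite -nrm_sqr; last exact: ipsB Hw (WH _ Wv).
  by rewrite ler_pXn2r ?nnegrE ?(ltW e0) ?nrm_ge0 ?eW//; exact: ipsB Hw (WH _ Wv).
have /choice[v_ vP] (n : nat) : exists v, W v /\ ip (w - v) (w - v) < d + n.+1%:R^-1.
  have n0 : 0 < n.+1%:R^-1 :> R by rewrite invr_gt0.
  by have [_ [v Wv <-] vd] := inf_adherent n0 (conj D0 Dlb); exists v.
pose h n := w - v_ n.
have Wv n : W (v_ n) by have [] := vP n.
have Hv n : H (v_ n) by exact: WH.
have Hh n : H (h n) by exact: ipsB.
pose e n : R := Num.sqrt (n.+1%:R^-1).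
have e0 n : 0 <= e n by exact: sqrtr_ge0.
(* Approximate orthogonality: moving [v_ n] inside [W] along [z] cannot lower the squared distance
   by more than 1/(n+1). Optimising the length of the move gives the factor [e n]. *)
have orth n z : W z -> `|ip (h n) z| <= e n * nrm z.
  move=> Wz; have Hz := WH _ Wz.
  have key (r : R) : `|r| = 1 -> - (r * ip (h n) z) <= e n * nrm z.
    move=> r1; rewrite (ips_norm ips)// mulrC /e mulrC.
    rewrite (mulrC (Num.sqrt _)); apply: le_sqrtM_amgm; [exact: ips_ge0 ips _|by rewrite invr_ge0|].
    move=> t t0; have Wz' : W (v_ n - (t * r)%:C%C *: z).
      by rewrite -scaleNr addrC; exact: Wcomb.
    have := dle _ Wz'; have [_ /ltW] := vP n.
    rewrite opprB addrCA addrC -/(h n) (ip_quadratic (t * r) (Hh n) Hz) -/(h n).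
    have -> : (t * r) ^+ 2 = t ^+ 2.
      by rewrite exprMn -[r ^+ 2]real_normK ?num_real// r1 expr1n mulr1.
    move: (n.+1%:R^-1) => y h1 h2.
    have : 0 <= t^-1 * (y + 2 * (t * r) * ip (h n) z + t ^+ 2 * ip z z).
      by rewrite mulr_ge0 ?invr_ge0 ?(ltW t0)//; lra.
    rewrite (_ : t^-1 * _ = t * ip z z + t^-1 * y - 2 * - (r * ip (h n) z)); last first.
      by field; rewrite gt_eqF.
    by rewrite subr_ge0.
  rewrite ler_norml; apply/andP; split.
    by rewrite lerNl -[ip _ _]mul1r; apply: key; rewrite normr1.
  by have := key (-1); rewrite mulN1r opprK; apply; rewrite normrN normr1.
have hB n k : h n - h k = v_ k - v_ n by rewrite /h opprB addrC addrA subrK.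
have Wd n k : W (h n - h k).
  by rewrite hB addrC -scaleN1r; exact: Wcomb.
(* [h n - h k] lies in [W], so it is nearly orthogonal to both [h n] and [h k], hence to itself: the
   sequence [h] is Cauchy. *)
have dist n k : nrm (h n - h k) <= e n + e k.
  have Hd : H (h n - h k) by exact: ipsB.
  have [n0|n0] := eqVneq (nrm (h n - h k)) 0; first by rewrite n0 addr_ge0.
  have ngt0 : 0 < nrm (h n - h k) by rewrite lt_def n0 nrm_ge0.
  rewrite -(ler_pM2r ngt0) -expr2 nrm_sqr// {1}ipBl// mulrDl.
  rewrite (le_trans (ler_norm _))// (le_trans (ler_normB _ _))// lerD//; exact: orth.
have e_cvg : e n @[n --> \oo] --> (0 : R).
  rewrite -(@sqrtr0 R); apply: (@cvg_comp _ _ _ (fun n => n.+1%:R^-1 : R) Num.sqrt _ (nbhs (0 : R))).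
    exact: cvg_harmonic.
  exact: sqrt_continuous.
have Hnorm u n k : H u -> `|ip u (h n) - ip u (h k)| <= nrm u * (e n + e k).
  move=> Hu; rewrite -ipBr// (le_trans (ip_cauchy_schwarz Hu _))//; first exact: ipsB.
  by rewrite -!(ips_norm ips)//; [rewrite ler_wpM2l// nrm_ge0|exact: ipsB].
(* The limit is taken among real numbers: [ip u (h n)] is Cauchy for each fixed [u], although [h]
   itself may have no limit in [H]. *)
have cvl u : H u -> cvgn (fun n => ip u (h n)).
  move=> Hu; apply/cauchy_cvgP; apply: cauchy_exP => r r0 /=.
  have M0 : 0 < 2 * (nrm u + 1) by rewrite mulr_gt0// ltr_wpDl// nrm_ge0.
  have /cvgr0_norm_le/(_ (r / (2 * (nrm u + 1)) / 2)) : e n @[n --> \oo] --> (0 : R) by [].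
  rewrite !divr_gt0// => /(_ erefl)[N _ eN].
  have eN' n : (N <= n)%N -> e n <= r / (2 * (nrm u + 1)) / 2.
    by move=> /eN /=; exact: le_trans (ler_norm _).
  exists (ip u (h N)); exists N => // n /= Nn; rewrite /ball/=.
  rewrite (le_lt_trans (Hnorm u N n Hu))//.
  rewrite (@le_lt_trans _ _ (nrm u * (r / (2 * (nrm u + 1)))))//.
    rewrite ler_wpM2l ?nrm_ge0// [leRHS]splitr lerD// eN'//.
  rewrite mulrCA gtr_pMr// ltr_pdivrMr// mul1r.
  by have := nrm_ge0 Hu; lra.
pose l u := limn (fun n => ip u (h n)).
have lcv u : H u -> ip u (h n) @[n --> \oo] --> l u by exact: cvl.
have llin (r : R) u v : H u -> H v -> l (r%:C%C *: u + v) = r * l u + l v.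
  move=> Hu Hv'; apply: (@cvg_unique R (@Rhausdorff R) _ _ _ _ (lcv _ (Hcomb _ Hu Hv'))).
  rewrite /= (_ : (fun n => _) = fun n => r * ip u (h n) + ip v (h n)).
    by apply: cvgD; [apply: cvgMr|]; exact: lcv.
  by apply/funext => n; rewrite (ips_lin ips).
have lW z : W z -> l z = 0.
  move=> Wz; have Hz := WH _ Wz.
  apply: (@cvg_unique R (@Rhausdorff R) _ _ _ _ (lcv _ Hz)).
  apply/norm_cvg0P; apply: (@squeeze_cvgr _ _ _ _ (cst 0) (fun n => e n * nrm z)).
  - by apply: nearW => n /=; rewrite normr_ge0/= (ips_sym ips) orth.
  - exact: cvg_cst.
  - by rewrite -(mul0r (nrm z)); apply: cvgMl.
exists l; split => //.
- have hbd n : Num.sqrt (ip (h n) (h n)) <= Num.sqrt (d + 1).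
    rewrite ler_wsqrtr//; have [_ /ltW] := vP n; move=> /le_trans; apply.
    by rewrite lerD2l invf_le1// ler1n.
  exists (Num.sqrt (d + 1)) => u Hu.
  have bnd n : `|ip u (h n)| <= Num.sqrt (d + 1) * nrm u.
    rewrite (le_trans (ip_cauchy_schwarz Hu (Hh n)))// mulrC (ips_norm ips)//.
    by rewrite ler_wpM2r// sqrtr_ge0.
  rewrite ler_norml; apply/andP; split.
    by apply: limr_ge; [exact: cvl|apply: nearW => n; have := bnd n; rewrite ler_norml => /andP[]].
  by apply: limr_le; [exact: cvl|apply: nearW => n; have := bnd n; rewrite ler_norml => /andP[]].
(* As [v_ N] lies in [W], [l w = l (h N)]. For large N and n, twice [ip (h N) (h n)] is the sum of
   the two squared norms minus that of [h N - h n], hence at least d + d - d, so [l w] is at least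
   d/2. *)
- have /cvgr0_norm_le/(_ (Num.sqrt d / 2)) : e n @[n --> \oo] --> (0 : R) by [].
  rewrite divr_gt0 ?sqrtr_gt0// => /(_ erefl)[N _ eN].
  have eN' n : (N <= n)%N -> e n <= Num.sqrt d / 2.
    by move=> /eN /=; exact: le_trans (ler_norm _).
  have lw : l w = l (h N).
    have := llin (-1) (v_ N) w (Hv N) Hw; rewrite rmorphN1 scaleN1r addrC -/(h N) => ->.
    by rewrite (lW _ (Wv N)) mulr0 add0r.
  rewrite lw gt_eqF//; apply: (@lt_le_trans _ _ (d / 2)); first by rewrite divr_gt0.
  apply: limr_ge; first exact: cvl.
  exists N => // n /= Nn.
  have Hd : H (h N - h n) by exact: ipsB.
  have : ip (h N - h n) (h N - h n) <= d.
    rewrite -nrm_sqr// -[leRHS](@sqr_sqrtr _ d) ?(ltW d0)// ler_pXn2r ?nnegrE ?nrm_ge0 ?sqrtr_ge0//.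
    by rewrite (le_trans (dist N n))// [leRHS]splitr lerD// eN'.
  rewrite (ipBl (Hh N) (Hh n) Hd) (ipBr (Hh N) (Hh n) (Hh N)) (ipBr (Hh N) (Hh n) (Hh n)).
  rewrite (ips_sym ips (h n) (h N)).
  have := dle _ (Wv N); have := dle _ (Wv n); rewrite -/(h N) -/(h n); lra.
Qed.

(** The separating functional [l] is only real-linear, while weak convergence is tested with
    complex-linear ones. [L] is the complex-linear functional with real part [l]; it vanishes on [W]
    because [W] is stable under multiplication by i. *)
Lemma weakly_closed W (w_ : nat -> E) w : closed_subspace H nrm W ->
  (forall k, W (w_ k)) -> weakly_converges H nrm w_ w -> W w.
Proof.
move=> cW Ww [Hw_ Hw cvw]; apply: contrapT => nWw.
have [WH W0 Wcomb _] := cW.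
have [l [llin [M lM] lW lw]] := separating_functional cW Hw nWw.
have Hi u : H u -> H ('i%C *: u) by exact: ipsZ.
pose L u : R[i] := (l u -i* l ('i%C *: u))%C.
have lE (a b : R) u v : H u -> H v ->
    l ((a +i* b)%C *: u + v) = a * l u + b * l ('i%C *: u) + l v.
  move=> Hu Hv.
  rewrite (_ : (a +i* b)%C *: u = a%:C%C *: u + b%:C%C *: ('i%C *: u)); last first.
    rewrite scalerA -scalerDl; congr (_ *: _).
    by apply/eqP; rewrite eq_complex/=; apply/andP; split; apply/eqP; ring.
  by rewrite -addrA llin ?llin ?addrA//; [exact: Hi|exact/Hcomb/Hv/Hi].
have Lb : bounded_functional H nrm L.
  split=> [[a b] u v Hu Hv|].
    rewrite /L lE// (_ : 'i%C *: ((a +i* b)%C *: u + v) = (- b +i* a)%C *: u + 'i%C *: v); last first.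
      rewrite scalerDr scalerA; congr (_ *: _ + _).
      by apply/eqP; rewrite eq_complex/=; apply/andP; split; apply/eqP; ring.
    rewrite lE//; last exact: Hi.
    by apply/eqP; rewrite eq_complex/=; apply/andP; split; apply/eqP; ring.
  exists (M + M) => u Hu; apply: le_trans (cabs_le _) _ => /=.
  by rewrite normrN mulrDl lerD ?lM// (le_trans (lM _ (Hi _ Hu)))// nrmZi.
have Wi u : W u -> W ('i%C *: u).
  by move=> Wu; have := Wcomb 'i%C u 0 Wu W0; rewrite addr0.
have L0 k : L (w_ k) = 0 by rewrite /L !lW//; [apply/eqP; rewrite eq_complex/= oppr0 !eqxx|exact: Wi].
have cv := cvw L Lb; rewrite (_ : (fun k => _) = fun=> 0 : R[i]^o) in cv; last exact/funext.
have c0 : ((0 : R[i]^o) @[_ --> \oo] --> (0 : R[i]^o)) by exact: cvg_cst.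
have Lw0 := @cvg_unique _ (@norm_hausdorff _ R[i]^o) _ _ _ _ cv c0.
have /(congr1 (@complex.Re R)) lw0 : L w = 0 by apply: Lw0; exact: fmap_proper_filter.
by move: lw; rewrite [l w]lw0 eqxx.
Qed.

End weak_closure.

(** * Mosco convergence *)

Lemma compact_bigcup_nondecreasing (T : topologicalType) (K : set T) (U : nat -> set T) :
  compact K -> (forall j, open (U j)) -> (forall j, U j `<=` U j.+1) ->
  K `<=` \bigcup_j U j -> exists N, forall j, (N <= j)%N -> K `<=` U j.
Proof.
move=> /compact_near_coveringP cK oU UU KU.
have ndU i j : (i <= j)%N -> U i `<=` U j.
  by move=> /subnK <-; elim: (j - i)%N => // k IH; apply: subset_trans IH _; exact: UU.
suff /(cK nat \oo (fun i x => U i x) _)[N _ NU] : forall x, K x ->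
    \forall x' \near x & i \near \oo, U i x' by exists N => j; exact: NU.
move=> x /KU[i _ Uix].
exists (U i, [set j | (i <= j)%N]) => /=.
  by split; [exact: open_nbhs_nbhs|exists i].
by move=> [y j] /= [Uiy ij]; exact: ndU Uiy.
Qed.

Section mosco_sobolev.
Context {R : realType} {m : nat} (s : R).
Local Notation H := (@sobolev R m s).
Local Notation nrm := (@sobolev_norm R m s).
Local Notation cabs := (@ComplexField.Normc.normc R).
Local Notation functional := (('rV[R]_m -> R[i]) -> R[i]).
Implicit Types (u v w : functional) (phi psi : 'rV[R]_m -> R[i]).
Implicit Types (Omega F G : set 'rV[R]_m).

Lemma sobolev_inner_product_space : inner_product_space H nrm (sobolev_ip s).
Proof.
split.
- exact: sobolev0.
- by move=> c u v Hu Hv; exact: (sobolev_comb c Hu Hv).1.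
- exact: sobolev_ipC.
- by move=> r u v z; exact: sobolev_ip_comb.
- exact: sobolev_ip_ge0.
- exact: sobolev_ipi.
- exact: sobolev_normE.
Qed.

Let ips := sobolev_inner_product_space.

Lemma bounded_functional_eval phi : schwartz phi -> bounded_functional H nrm (fun u => u phi).
Proof.
by move=> sphi; split=> //; have [C _ ?] := eval_bounded s sphi; exists C.
Qed.

Lemma eval_eq0_closed phi u : schwartz phi -> H u ->
  (forall e : R, 0 < e -> exists2 w, H w /\ w phi = 0 & nrm (u - w) < e) -> u phi = 0.
Proof.
move=> sphi Hu uw; have [C C0 Cb] := eval_bounded s sphi.
apply: ComplexField.Normc.eq0_normc; apply/eqP; rewrite eq_le cabs_ge0 andbT.
apply/ler_addgt0Pl => e e0; rewrite addr0.
have C1 : 0 < C + 1 by rewrite ltr_wpDl.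
have [|w [Hw w0] uwe] := uw (e / (C + 1)); first exact: divr_gt0.
have -> : u phi = (u - w) phi.
  by rewrite -[LHS]subr0 -w0.
apply: le_trans (Cb _ (ipsB ips Hu Hw)) _.
apply: (@le_trans _ _ (C * (e / (C + 1)))); first by rewrite ler_wpM2l// ltW.
by rewrite mulrCA ger_pMr// ler_pdivrMr// mul1r lerDl.
Qed.

Lemma closed_subspace_supported F : closed F -> closed_subspace H nrm (sobolev_supported s F).
Proof.
move=> cF; have suppP u : sobolev_supported s F u <->
    H u /\ forall phi, C0infty (~` F) phi -> u phi = 0.
  by split=> -[Hu]; [move/(sobolev_supportP cF Hu)|move=> h; split=> //; apply/(sobolev_supportP cF Hu)].
split.
- by move=> u [].
- by apply/suppP; split=> //; exact: ips_zero ips.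
- move=> c u v /suppP[Hu u0] /suppP[Hv v0]; apply/suppP; split; first exact: ips_comb ips _ _ _ Hu Hv.
  by move=> phi Fphi; rewrite [LHS](_ : _ = c * u phi + v phi)// u0// v0// mulr0 addr0.
- move=> u Hu uW; apply/suppP; split=> // phi Fphi.
  apply: eval_eq0_closed => //; first exact: C0infty_schwartz Fphi.
  by move=> e /uW[w /suppP[Hw w0] uw]; exists w => //; split=> //; exact: w0.
Qed.

Lemma sobolev_tilde_distr_of Omega phi : C0infty Omega phi ->
  sobolev_tilde s Omega (distr_of phi).
Proof.
move=> Ophi; split; first exact/sobolev_distr_of/(C0infty_schwartz Ophi).
by move=> e e0; exists phi => //; rewrite subrr (nrm0 ips).
Qed.

Lemma sobolev_tilde_subset Omega Omega' : Omega `<=` Omega' ->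
  sobolev_tilde s Omega `<=` sobolev_tilde s Omega'.
Proof.
move=> OO u [Hu uO]; split=> // e /uO[phi Ophi ue].
by exists phi => //; exact: C0infty_subset OO _ Ophi.
Qed.

Lemma C0infty0 Omega : C0infty Omega (0 : 'rV[R]_m -> R[i]).
Proof.
apply/C0inftyP; split; [exact: rsmooth_cst..|].
by exists set0; split=> //; exact: compact0.
Qed.

Lemma closed_subspace_tilde Omega : closed_subspace H nrm (sobolev_tilde s Omega).
Proof.
have Hd phi : C0infty Omega phi -> H (distr_of phi).
  by move=> Ophi; exact/sobolev_distr_of/(C0infty_schwartz Ophi).
split.
- by move=> u [].
- by rewrite -distr_of0; apply: sobolev_tilde_distr_of; exact: C0infty0.
- move=> c u v [Hu uO] [Hv vO]; split; first exact: ips_comb ips _ _ _ Hu Hv.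
  move=> e e0; set k : R := `|complex.Re c| + `|complex.Im c|.
  have k0 : 0 <= k by rewrite addr_ge0.
  have [|phi Ophi ue] := uO (e / 2 / (k + 1)); first by rewrite !divr_gt0// ltr_wpDl.
  have [|psi Opsi ve] := vO (e / 2); first exact: divr_gt0.
  exists (c *: phi + psi); first exact: C0infty_lin.
  rewrite distr_of_lin; [|exact: C0infty_schwartz Ophi|exact: C0infty_schwartz Opsi].
  rewrite (_ : _ - _ = c *: (u - distr_of phi) + (v - distr_of psi)); last first.
    by rewrite scalerBr opprD addrACA.
  have Hup := ipsB ips Hu (Hd _ Ophi); have Hvp := ipsB ips Hv (Hd _ Opsi).
  apply: le_lt_trans (nrm_triangle ips (ipsZ ips c Hup) Hvp) _.
  rewrite [ltRHS]splitr ler_ltD//; apply: le_trans (nrmZ_le ips c Hup) _.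
  apply: (@le_trans _ _ (k * (e / 2 / (k + 1)))); first by rewrite ler_wpM2l// ltW.
  by rewrite mulrCA ger_pMr ?divr_gt0// ler_pdivrMr ?ltr_wpDl// mul1r lerDl.
- move=> u Hu uO; split=> // e e0.
  have [|w [Hw wO] uw] := uO (e / 2); first exact: divr_gt0.
  have [|phi Ophi we] := wO (e / 2); first exact: divr_gt0.
  exists phi => //; rewrite (_ : u - _ = (u - w) + (w - distr_of phi)); last by rewrite addrA subrK.
  apply: le_lt_trans (nrm_triangle ips (ipsB ips Hu Hw) (ipsB ips Hw (Hd _ Ophi))) _.
  by rewrite [ltRHS]splitr ltrD.
Qed.

(** [distr_of phi] annihilates the test functions supported off [F], because the two supports are
    disjoint. Evaluation being continuous, this passes to the closure. *)
Lemma sobolev_tilde_supported Omega F : closed F -> Omega `<=` F ->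
  sobolev_tilde s Omega `<=` sobolev_supported s F.
Proof.
move=> cF OF u [Hu uO]; split=> //; apply/(sobolev_supportP cF Hu) => psi Fpsi.
have spsi := C0infty_schwartz Fpsi.
apply: eval_eq0_closed => // e /uO[phi Ophi ue]; exists (distr_of phi) => //.
split; first exact/sobolev_distr_of/(C0infty_schwartz Ophi).
rewrite distr_ofE// (_ : (fun x => _) = fun=> 0).
  by rewrite /cintegral /Rintegral/= integral0.
apply/funext => x; have [_ _ phiO] := Ophi; have [_ _ psiF] := Fpsi.
have [xphi|/fsupport_eq0 ->] := pselect (fsupport phi x); last exact: mul0r.
have [/psiF xF|/fsupport_eq0 ->] := pselect (fsupport psi x); last exact: mulr0.
by case: xF; apply/OF/phiO.
Qed.

Lemma sobolev_supported_bigcap_weak (G_ : nat -> set 'rV[R]_m) (j_ : nat -> nat)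
    (w_ : nat -> functional) w :
  (forall j, closed (G_ j)) -> (forall j, G_ j.+1 `<=` G_ j) ->
  {homo j_ : a b / (a < b)%N} -> (forall k, sobolev_supported s (G_ (j_ k)) (w_ k)) ->
  weakly_converges H nrm w_ w -> sobolev_supported s (\bigcap_j G_ j) w.
Proof.
move=> cG dG j_lt Gw [_ Hw cvw]; split=> //.
have cGI : closed (\bigcap_j G_ j) by exact: closed_bigI.
apply/(sobolev_supportP cGI Hw) => phi Gphi.
have [_ cphi phiG] := Gphi; have sphi := C0infty_schwartz Gphi.
have [j|j x nx /dG//|x /phiG|N phiN] :=
  @compact_bigcup_nondecreasing _ (fsupport phi) (fun j => ~` G_ j) cphi.
- exact: closed_openC.
- by rewrite setC_bigcap.
(* A strictly increasing index map dominates the identity, so the subsequence is past rank [N] as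
   soon as [k] is. *)
have j_ge k : (k <= j_ k)%N.
  by elim: k => // k /leq_ltn_trans; apply; exact: j_lt.
have wphi0 k : (N <= k)%N -> w_ k phi = 0.
  move=> Nk; have [Hwk Gwk] := Gw k.
  apply: (proj1 (sobolev_supportP (cG (j_ k)) Hwk) Gwk).
  have [sm _ _] := Gphi; split=> //; apply: phiN; exact: leq_trans Nk (j_ge k).
have cv := cvw _ (bounded_functional_eval sphi).
have cv0 : (w_ k phi : R[i]^o) @[k --> \oo] --> (0 : R[i]^o).
  by apply: cvg_near_cst; exists N => // k /= /wphi0 ->.
exact: (@cvg_unique _ (@norm_hausdorff _ R[i]^o) _ _ _ _ cv cv0).
Qed.

(* The approximants nearly minimise the distance to [w], so that no closest
   point, hence no completeness of [H], is needed. *)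
Lemma sobolev_tilde_approx (U G_ : nat -> set 'rV[R]_m) w :
  (forall j, open (U j)) -> (forall j, U j `<=` U j.+1) -> (forall j, U j `<=` G_ j) ->
  sobolev_tilde s (\bigcup_j U j) w ->
  exists w_ : nat -> functional, (forall j, sobolev_tilde s (G_ j) (w_ j)) /\
    nrm (w_ j - w) @[j --> \oo] --> (0 : R).
Proof.
move=> oU UU UG [Hw wU].
have HW j v : sobolev_tilde s (G_ j) v -> H (v - w) by move=> [Hv _]; apply: (ipsB ips Hv).
(* The approximant must not depend on [e]. Near-minimality lets [w_ j] compete with every element of
   its space: any test function supported in [G_ j] is at most 1/(j+1) closer to [w]. *)
have /choice[w_ wP] (j : nat) : exists v, sobolev_tilde s (G_ j) v /\
    forall v', sobolev_tilde s (G_ j) v' -> nrm (v - w) <= nrm (v' - w) + j.+1%:R^-1.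
  pose D := [set nrm (v - w) | v in sobolev_tilde s (G_ j)].
  have D0 : D !=set0.
    by exists (nrm (0 - w)), 0 => //; have [] := closed_subspace_tilde (G_ j).
  have Dlb : has_lbound D by exists 0 => _ [v /HW Hv <-]; exact: nrm_ge0 ips _ Hv.
  have j0 : 0 < j.+1%:R^-1 :> R by rewrite invr_gt0.
  have [_ [v Wv <-] vd] := inf_adherent j0 (conj D0 Dlb).
  exists v; split=> // v' Wv'; apply: le_trans (ltW vd) _; rewrite lerD2r.
  by apply: ge_inf => //; exists v'.
exists w_; split=> [j|]; first by have [] := wP j.
apply/cvgr0Pnorm_lt => e e0.
have [|phi Uphi we] := wU (e / 2); first exact: divr_gt0.
have [sm cphi phiU] := Uphi.
have [N phiN] := compact_bigcup_nondecreasing cphi oU UU phiU.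
have /cvgr0Pnorm_lt/(_ (e / 2)) : (n.+1%:R^-1 : R) @[n --> \oo] --> (0 : R).
  exact: cvg_harmonic.
rewrite divr_gt0// => /(_ erefl)[M _ MP].
exists (maxn N M) => // j /=; rewrite geq_max => /andP[Nj Mj].
have [Wj wmin] := wP j; rewrite ger0_norm; last exact: nrm_ge0 ips _ (HW _ _ Wj).
have Gphi : sobolev_tilde s (G_ j) (distr_of phi).
  by apply: sobolev_tilde_distr_of; split=> //; apply: subset_trans (UG j); exact: phiN.
have [Hd _] := Gphi.
apply: le_lt_trans (wmin _ Gphi) _; rewrite [ltRHS]splitr ltrD//.
  by rewrite (nrmB ips Hd Hw).
exact: le_lt_trans (ler_norm _) (MP _ Mj).
Qed.

Lemma mosco_tilde_nondecreasing G (G_ : nat -> set 'rV[R]_m) :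
  (forall j, open (G_ j)) -> (forall j, G_ j `<=` G_ j.+1) -> G = \bigcup_j G_ j ->
  mosco_converges H nrm (fun j => sobolev_tilde s (G_ j)) (sobolev_tilde s G).
Proof.
move=> oG GG ->; split.
- by move=> j; exact: closed_subspace_tilde.
- exact: closed_subspace_tilde.
- by move=> w; apply: (sobolev_tilde_approx oG GG) => j.
- move=> j_ w_ w _ Ww; apply: (weakly_closed ips (closed_subspace_tilde _)) => k.
  by apply: sobolev_tilde_subset (Ww k); exact: bigcup_sup.
Qed.

Lemma mosco_supported_nonincreasing G (G_ : nat -> set 'rV[R]_m) :
  (forall j, closed (G_ j)) -> (forall j, G_ j.+1 `<=` G_ j) -> G = \bigcap_j G_ j ->
  mosco_converges H nrm (fun j => sobolev_supported s (G_ j)) (sobolev_supported s G).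
Proof.
move=> cG GG ->; split.
- by move=> j; exact: closed_subspace_supported.
- by apply: closed_subspace_supported; exact: closed_bigI.
- move=> w [Hw wG]; exists (fun=> w); split=> [j|].
    by split=> //; apply: subset_trans wG _; exact: bigcap_inf.
  by rewrite subrr (nrm0 ips); exact: cvg_cst.
- by move=> j_ w_ w j_lt Ww; exact: sobolev_supported_bigcap_weak cG GG j_lt Ww.
Qed.

(** The inner sets yield strong approximation of the smaller space [sobolev_tilde s G], and the
    outer sets confine weak limits to [sobolev_supported s (closure G)]; the first hypothesis closes
    the gap between the two. *)
Lemma mosco_tilde_sandwiched G (G_ Gm_ Gp_ : nat -> set 'rV[R]_m) :
  sobolev_tilde s G = sobolev_supported s (closure G) ->
  (forall j, open (Gm_ j)) -> (forall j, closed (Gp_ j)) ->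
  (forall j, Gm_ j `<=` Gm_ j.+1) -> (forall j, Gp_ j.+1 `<=` Gp_ j) ->
  (forall j, Gm_ j `<=` G_ j) -> (forall j, G_ j `<=` Gp_ j) ->
  G = \bigcup_j Gm_ j -> closure G = \bigcap_j Gp_ j ->
  mosco_converges H nrm (fun j => sobolev_tilde s (G_ j)) (sobolev_tilde s G).
Proof.
move=> GE oGm cGp GGm GGp GmG GGp' Gm Gp; split.
- by move=> j; exact: closed_subspace_tilde.
- exact: closed_subspace_tilde.
- by rewrite Gm => w; exact: (sobolev_tilde_approx oGm GGm GmG).
- move=> j_ w_ w j_lt Ww; rewrite GE Gp; apply: (sobolev_supported_bigcap_weak cGp GGp j_lt) => k.
  by apply: sobolev_tilde_supported (Ww k); [exact: cGp|exact: GGp'].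
Qed.

End mosco_sobolev.

Unset Implicit Arguments.
Set Strict Implicit.
Set Printing Implicit Defensive.

Theorem proposition4p3 (R : realType) (n : nat) (hn : n = 2%N \/ n = 3%N) :
  let s : R := - 2^-1 in
  let H := @sobolev R n.-1 s in
  let nrm := @sobolev_norm R n.-1 s in
  [/\ (* increasing open *)
      forall (G : set 'rV[R]_n.-1) (G_ : nat -> set 'rV[R]_n.-1),
        [/\ G !=set0, bounded_set G & open G] ->
        (forall j, [/\ G_ j !=set0, bounded_set (G_ j) & open (G_ j)]) ->
        (forall j, G_ j `<=` G_ j.+1) ->
        G = \bigcup_j G_ j ->
        mosco_converges H nrm (fun j => sobolev_tilde s (G_ j))
          (sobolev_tilde s G),
      (* decreasing compact *)
      forall (G : set 'rV[R]_n.-1) (G_ : nat -> set 'rV[R]_n.-1),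
        G !=set0 -> compact G ->
        (forall j, G_ j !=set0 /\ compact (G_ j)) ->
        (forall j, G_ j.+1 `<=` G_ j) ->
        G = \bigcap_j G_ j ->
        mosco_converges H nrm (fun j => sobolev_supported s (G_ j))
          (sobolev_supported s G) &
      (* sandwiched *)
      forall (G : set 'rV[R]_n.-1) (G_ : nat -> set 'rV[R]_n.-1),
        [/\ G !=set0, bounded_set G & open G] ->
        (forall j, [/\ G_ j !=set0, bounded_set (G_ j) & open (G_ j)]) ->
        sobolev_tilde s G = sobolev_supported s (closure G) ->
        (exists Gm_ Gp_ : nat -> set 'rV[R]_n.-1,
          [/\ forall j, [/\ Gm_ j !=set0, bounded_set (Gm_ j) & open (Gm_ j)],
              forall j, Gp_ j !=set0 /\ compact (Gp_ j),
              forall j, [/\ Gm_ j `<=` Gm_ j.+1, Gp_ j.+1 `<=` Gp_ j,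
                            Gm_ j `<=` G_ j & G_ j `<=` Gp_ j],
              G = \bigcup_j Gm_ j &
              closure G = \bigcap_j Gp_ j]) ->
        mosco_converges H nrm (fun j => sobolev_tilde s (G_ j))
          (sobolev_tilde s G)].
Proof.
move=> s H nrm; split.
- move=> G G_ _ hG GG GE; apply: mosco_tilde_nondecreasing => // j.
  by have [] := hG j.
- move=> G G_ _ _ hG GG GE; apply: mosco_supported_nonincreasing => // j.
  by apply: compact_closed; [exact: norm_hausdorff|have [] := hG j].
- move=> G G_ _ _ GE [Gm_ [Gp_ [hm hp hG Gm Gp]]].
  apply: (mosco_tilde_sandwiched GE _ _ _ _ _ _ Gm Gp) => j;
    try by have [] := hG j.
    by have [] := hm j.
  by apply: compact_closed; [exact: norm_hausdorff|have [] := hp j].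
Qed.
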